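(* Assume that $V \in L^\infty(\Omega)$ is real-valued, that $\sigma > 0$, and that the exact solution $\psi$ of the nonlinear Schrödinger equation (NLSE) given in the context satisfies $\psi \in C([0, T]; H^2_{\mathrm{per}}(\Omega)) \cap C^1([0, T]; L^2(\Omega))$. Let $\psi^n$ ($n\ge 0$) be the semi-discrete sEWI approximations with time step $\tau$ defined in the context. Then there exist $\tau_0>0$ sufficiently small and a constant $C>0$ independent of $\tau$ and $n$ such that for all $0<\tau<\tau_0$ and all integers $n$ with $0 \leq n \leq T/\tau$, $$\| \psi(\cdot, t_n) - \psi^n \|_{L^2} \leq C \tau, \qquad \| \psi(\cdot, t_n) - \psi^n \|_{H^1} \leq C \tau^{1/2}, \qquad \|\psi^n\|_{H^2}\le C.$$
   Context: Let $\Omega=(a,b)\subset\mathbb{R}$ be a bounded interval. For integers $m\ge1$, $H^m_{\mathrm{per}}(\Omega)=\{\phi\in H^m(\Omega): \phi^{(k)}(a)=\phi^{(k)}(b),\ k=0,\dots,m-1\}$. All functions are complex-valued unless said otherwise. NLSE: with periodic boundary conditions on $\Omega$, $i\partial_t\psi = -\Delta\psi + V\psi + f(|\psi|^2)\psi$ for $x\in\Omega$, $t>0$, and $\psi(\cdot,0)=\psi_0$, where $\Delta=\partial_{xx}$, $V$ is a given real-valued potential, and $f(\rho)=\beta\rho^\sigma$ for $\rho\ge0$ with fixed $\beta\in\mathbb{R}$ and $\sigma>0$. Let $T_{\max}$ be the maximal existence time of the solution and fix $0<T<T_{\max}$. Define $B(v)=Vv+f(|v|^2)v$. Fourier coefficients: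 $\widehat u_l=\frac1{b-a}\int_a^b u(x)e^{-i\mu_l(x-a)}\,dx$, $\mu_l=\frac{2\pi l}{b-a}$, $l\in\mathbb{Z}$. Operators that are functions of $\Delta$ are Fourier multipliers obtained by replacing $\Delta$ by $-\mu_l^2$. Let $\varphi_{\mathrm s}(\theta)=\frac{\sin\theta}{\theta}$ (value $1$ at $0$) and $\varphi_1(z)=\frac{e^z-1}{z}$ (value $1$ at $0$). Semi-discrete sEWI: for a time step $\tau>0$ and $t_n=n\tau$, $\psi^0=\psi_0$, $\ \psi^1=e^{i\tau\Delta}\psi^0-i\tau\varphi_1(i\tau\Delta)B(\psi^0)$, and $\psi^{n+1}=e^{2i\tau\Delta}\psi^{n-1}-2i\tau e^{i\tau\Delta}\varphi_{\mathrm s}(\tau\Delta)B(\psi^n)$ for $n\ge1$. *)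

(* Defs.v *)
From HB Require Import structures.
From mathcomp Require Export all_boot all_order all_algebra.
From mathcomp Require Export all_classical all_reals all_analysis.
From mathcomp.real_closed Require Export complex.

Set Implicit Arguments.
Unset Strict Implicit.
Unset Printing Implicit Defensive.

Export Order.TTheory GRing.Theory Num.Theory.
Export numFieldNormedType.Exports.

Global Open Scope classical_set_scope.
Global Open Scope ring_scope.

(** Functions on Omega = ]a, b[ are represented by total functions
    [R -> R[i]]; only their values on ]a, b[ matter, up to null sets. *)

Definition Cintegral (R : realType) (a b : R) (f : R -> R[i]) : R[i] :=
  Complex (\int[lebesgue_measure]_(x in `]a, b[) complex.Re (f x))
          (\int[lebesgue_measure]_(x in `]a, b[) complex.Im (f x)).

Definition inL2 (R : realType) (a b : R) (u : R -> R[i]) : Prop :=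
  ((@complex.Re R \o u) \_ `]a, b[ \in Lfun lebesgue_measure 2%:E) /\
  ((@complex.Im R \o u) \_ `]a, b[ \in Lfun lebesgue_measure 2%:E).

Definition inLinfty (R : realType) (a b : R) (V : R -> R) : Prop :=
  V \_ `]a, b[ \in Lfun lebesgue_measure +oo%E.

Definition L2norm (R : realType) (a b : R) (u : R -> R[i]) : \bar R :=
  'N[lebesgue_measure]_2%:E[EFin \o ((@ComplexField.Normc.normc R \o u) \_ `]a, b[)]%E.

Definition test_function (R : realType) (a b : R) (phi : R -> R) : Prop :=
  (forall (k : nat) (x : R), derivable (phi^`(k))%classic x 1) /\
  exists c d : R, [/\ a < c, d < b & forall x, x \notin `[c, d] -> phi x = 0].

Definition weak_derivative (R : realType) (a b : R) (k : nat)
    (u w : R -> R[i]) : Prop :=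
  forall phi : R -> R, test_function a b phi ->
    Cintegral a b (fun x => u x * ((phi^`(k))%classic x)%:C%C) =
    (-1) ^+ k * Cintegral a b (fun x => w x * (phi x)%:C%C).

Definition inH (R : realType) (a b : R) (m : nat) (u : R -> R[i]) : Prop :=
  inL2 a b u /\
  forall k : nat, (k <= m)%N -> exists w, inL2 a b w /\ weak_derivative a b k u w.

(** The weak derivative as a function: unique up to null sets when it exists,
    and 0 otherwise. *)
Definition wderiv (R : realType) (a b : R) (k : nat) (u : R -> R[i]) : R -> R[i] :=
  xget (fun=> 0) [set w | inL2 a b w /\ weak_derivative a b k u w].

(** Equal to +oo outside H^m, so that a finite bound on [Hnorm a b m u]
    entails [inH a b m u]. *)
Definition Hnorm (R : realType) (a b : R) (m : nat) (u : R -> R[i]) : \bar R :=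
  if `[< inH a b m u >]
  then ((\sum_(k < m.+1) L2norm a b (wderiv a b k u) ^+ 2) `^ 2^-1)%E
  else +oo%E.

(** The endpoint values of [u^(k)] are those of its representative that is
    continuous on the closed interval [a, b]. *)
Definition inHper (R : realType) (a b : R) (m : nat) (u : R -> R[i]) : Prop :=
  inH a b m u /\
  forall k : nat, (k < m)%N -> exists w : R -> R[i],
    [/\ weak_derivative a b k u w,
        {within `[a, b], continuous (@complex.Re R \o w)},
        {within `[a, b], continuous (@complex.Im R \o w)} & w a = w b].

Definition nonlin (R : realType) (beta sigma rho : R) : R := beta * rho `^ sigma.

Definition Bop (R : realType) (V : R -> R) (beta sigma : R) (v : R -> R[i]) :
    R -> R[i] :=
  fun x => (V x)%:C%C * v x +
    (nonlin beta sigma (ComplexField.Normc.normc (v x) ^+ 2))%:C%C * v x.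

Definition continuous_in_norm (R : realType) (N : (R -> R[i]) -> \bar R) (T : R)
    (u : R -> R -> R[i]) : Prop :=
  forall t : R, 0 <= t <= T ->
    N (u s \- u t) @[s --> within `[0, T] (nbhs t)] --> 0%E.

Definition C0_Hper (R : realType) (a b : R) (m : nat) (T : R)
    (u : R -> R -> R[i]) : Prop :=
  (forall t : R, 0 <= t <= T -> inHper a b m (u t)) /\
  continuous_in_norm (Hnorm a b m) T u.

(** [du] is the time derivative of [u], one-sided at the endpoints of [0, T]. *)
Definition C1_L2 (R : realType) (a b : R) (T : R) (u du : R -> R -> R[i]) : Prop :=
  [/\ forall t : R, 0 <= t <= T -> inL2 a b (u t) /\ inL2 a b (du t),
      forall t : R, 0 <= t <= T ->
        L2norm a b (fun x => (u s x - u t x) / (s - t)%:C%C - du t x)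
          @[s --> within `[0, T] t^'] --> 0%E
    & continuous_in_norm (L2norm a b) T du].

(** The periodic boundary conditions are part of H^2_per. *)
Definition nlse_solution (R : realType) (a b : R) (V : R -> R) (beta sigma : R)
    (psi0 : R -> R[i]) (T : R) (psi : R -> R -> R[i]) : Prop :=
  exists dpsi : R -> R -> R[i],
  [/\ C0_Hper a b 2 T psi,
      C1_L2 a b T psi dpsi,
      forall t : R, 0 < t <= T ->
        {ae lebesgue_measure, forall x, x \in `]a, b[ ->
          'i%C * dpsi t x = - wderiv a b 2 (psi t) x + Bop V beta sigma (psi t) x},
      inL2 a b psi0
    & {ae lebesgue_measure, forall x, x \in `]a, b[ -> psi 0 x = psi0 x}].

Definition nlse_Tmax (R : realType) (a b : R) (V : R -> R) (beta sigma : R)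
    (psi0 : R -> R[i]) : \bar R :=
  ereal_sup [set T%:E | T in [set T : R | 0 < T /\
    exists psi, nlse_solution a b V beta sigma psi0 T psi]].

Definition cexp (R : realType) (z : R[i]) : R[i] :=
  Complex (expR (complex.Re z) * cos (complex.Im z))
          (expR (complex.Re z) * sin (complex.Im z)).

Definition freq (R : realType) (a b : R) (l : int) : R :=
  2 * pi * l%:~R / (b - a).

Definition fcoef (R : realType) (a b : R) (u : R -> R[i]) (l : int) : R[i] :=
  ((b - a)^-1)%:C%C *
  Cintegral a b (fun x => u x * cexp (- 'i%C * (freq a b l * (x - a))%:C%C)).

(** [m(Delta) u], the L^2-limit of the symmetric partial sums of
    sum_l m(- mu_l^2) u_l exp(i mu_l (x - a)); 0 if they do not converge. *)
Definition fmult (R : realType) (a b : R) (m : R -> R[i]) (u : R -> R[i]) :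
    R -> R[i] :=
  let term (l : int) (x : R) : R[i] :=
    m (- freq a b l ^+ 2) * fcoef a b u l *
    cexp ('i%C * (freq a b l * (x - a))%:C%C) in
  xget (fun=> 0) [set g | inL2 a b g /\
    L2norm a b (fun x => g x - \sum_(k < (2 * N).+1) term (k%:Z - N%:Z) x)
      @[N --> \oo] --> 0%E].

Definition phi_s (R : realType) (theta : R) : R :=
  if theta == 0 then 1 else sin theta / theta.

Definition phi_1 (R : realType) (z : R[i]) : R[i] :=
  if z == 0 then 1 else (cexp z - 1) / z.

Definition sEWI_first (R : realType) (a b : R) (V : R -> R) (beta sigma tau : R)
    (psi0 : R -> R[i]) : R -> R[i] :=
  fun x => fmult a b (fun d => cexp ('i%C * (tau * d)%:C%C)) psi0 x
    - 'i%C * tau%:C%C *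
      fmult a b (fun d => phi_1 ('i%C * (tau * d)%:C%C)) (Bop V beta sigma psi0) x.

(** [sEWI_step ... psi_prev psi_cur] is psi^{n+1} for psi_prev = psi^{n-1} and
    psi_cur = psi^n. *)
Definition sEWI_step (R : realType) (a b : R) (V : R -> R) (beta sigma tau : R)
    (psi_prev psi_cur : R -> R[i]) : R -> R[i] :=
  fun x => fmult a b (fun d => cexp (2 * 'i%C * (tau * d)%:C%C)) psi_prev x
    - 2 * 'i%C * tau%:C%C *
      fmult a b (fun d => cexp ('i%C * (tau * d)%:C%C))
        (fmult a b (fun d => (phi_s (tau * d))%:C%C) (Bop V beta sigma psi_cur)) x.

Fixpoint sEWI (R : realType) (a b : R) (V : R -> R) (beta sigma tau : R)
    (psi0 : R -> R[i]) (n : nat) {struct n} : R -> R[i] :=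
  match n with
  | 0 => psi0
  | n1.+1 =>
    match n1 with
    | 0 => sEWI_first a b V beta sigma tau psi0
    | n2.+1 => sEWI_step a b V beta sigma tau
                 (sEWI a b V beta sigma tau psi0 n2)
                 (sEWI a b V beta sigma tau psi0 n1)
    end
  end.

(* Main.v *)
Require Import Defs.
From mathcomp Require Import zify ring lra measurable_realfun.

(** Everything is read off the Fourier coefficients. For a function of
    H^2_per, taking the second derivative multiplies the l-th coefficient by
    - mu_l^2, so the equation becomes the family of ordinary differential
    equations u_l' = - i (mu_l^2 u_l + b_l), with b_l the l-th coefficient of
    B(psi). Both the starting step and the two-step recursion of the scheme
    apply the same map

      flow h (z, w) = exp(- i h mu^2) z - i h phi_1(- i h mu^2) w,

    which solves this equation exactly over a time h when b is frozen at the
    value w; here h = tau for the first step, and h = 2 tau afterwards because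
    exp(i theta) sin(theta) / theta = phi_1(2 i theta).

    Error in L^2. B is Lipschitz in L^2 on functions bounded by a fixed
    constant, and t |-> psi(t) is Lipschitz in L^2 since its derivative is
    bounded there by the H^2 norm of psi(t). Freezing b over a time h thus
    costs O(h^2) per step ([local_error]); the flow is an isometry in z and
    multiplies w by at most h, so that errors satisfy
    e_{n+1} <= e_{n-1} + 2 tau K e_n + O(tau^2), whence e_n = O(tau).

    Bound in H^2. Since (- i h mu^2) phi_1(- i h mu^2) = exp(- i h mu^2) - 1,

      mu^2 flow h (z, w) + w = exp(- i h mu^2) (mu^2 z + w)

    ([flow_chi]): the combination chi^{n+1} = mu^2 psi^{n+1} + B(psi^n)
    differs in norm from chi^{n-1} only by B(psi^n) - B(psi^{n-2}), which is
    O(tau) by the L^2 error bound and the time regularity of psi. Summing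
    O(1 / tau) such increments bounds chi^n, hence the H^2 norm of psi^n,
    without any loss of powers of tau.

    Error in H^1 and sup bound. Interpolating the L^2 error O(tau) with the
    H^2 bound gives O(tau^(1/2)) in H^1, and by Sobolev a sup-norm error
    O(tau^(1/2)), which is at most 1 for small tau: psi^n stays in the set
    where B is Lipschitz. These three estimates are proved together, by
    induction on n ([good_all]).

    The part before the time discretization builds the Fourier analysis of
    L^2(a, b): Riesz-Fischer, completeness and Parseval, weak derivatives
    against test functions, and their translation to coefficients. *)

Set Implicit Arguments.
Unset Strict Implicit.
Unset Printing Implicit Defensive.

Local Notation Re := complex.Re.
Local Notation Im := complex.Im.
Local Notation normc := ComplexField.Normc.normc.

(** * Complex numbers through their squared modulus *)

Section ComplexSquare.
Context {R : realType}.
Implicit Types z w : R[i].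

(** Multiplicative and polynomial in the components, hence easier to
    integrate and differentiate than the modulus. *)
Definition sq z : R := Re z ^+ 2 + Im z ^+ 2.

Lemma sq_ge0 z : 0 <= sq z.
Proof. by rewrite addr_ge0 // sqr_ge0. Qed.

Lemma normcE z : normc z = Num.sqrt (sq z).
Proof. by case: z. Qed.

Lemma normc_ge0 z : 0 <= normc z.
Proof. by rewrite normcE sqrtr_ge0. Qed.

Lemma sqr_normc z : normc z ^+ 2 = sq z.
Proof. by rewrite normcE sqr_sqrtr // sq_ge0. Qed.

Lemma ReD z w : Re (z + w) = Re z + Re w. Proof. by case: z; case: w. Qed.
Lemma ImD z w : Im (z + w) = Im z + Im w. Proof. by case: z; case: w. Qed.
Lemma ReN z : Re (- z) = - Re z. Proof. by case: z. Qed.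
Lemma ImN z : Im (- z) = - Im z. Proof. by case: z. Qed.
Lemma ReM z w : Re (z * w) = Re z * Re w - Im z * Im w.
Proof. by case: z; case: w. Qed.
Lemma ImM z w : Im (z * w) = Re z * Im w + Im z * Re w.
Proof. by case: z; case: w. Qed.
Lemma ReC (x : R) : Re x%:C%C = x. Proof. by []. Qed.
Lemma ImC (x : R) : Im x%:C%C = 0. Proof. by []. Qed.
Lemma Re0 : Re (0 : R[i]) = 0. Proof. by []. Qed.
Lemma Im0 : Im (0 : R[i]) = 0. Proof. by []. Qed.
Lemma Re1 : Re (1 : R[i]) = 1. Proof. by []. Qed.
Lemma Im1 : Im (1 : R[i]) = 0. Proof. by []. Qed.
Lemma Rei : Re ('i%C : R[i]) = 0. Proof. by []. Qed.
Lemma Imi : Im ('i%C : R[i]) = 1. Proof. by []. Qed.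
Lemma ReJ z : Re ((conjc z)) = Re z. Proof. by case: z. Qed.
Lemma ImJ z : Im ((conjc z)) = - Im z. Proof. by case: z. Qed.

Lemma cext z w : Re z = Re w -> Im z = Im w -> z = w.
Proof. by case: z; case: w => a b c d /= -> ->. Qed.

Definition ReImE := (ReD, ImD, ReN, ImN, ReM, ImM, ReC, ImC, Re0, Im0, Re1, Im1,
  Rei, Imi, ReJ, ImJ).

Lemma ReS I (r : seq I) (P : pred I) (F : I -> R[i]) :
  Re (\sum_(i <- r | P i) F i) = \sum_(i <- r | P i) Re (F i).
Proof. by elim/big_rec2: _ => // i y z _ <-; rewrite ReD. Qed.

Lemma ImS I (r : seq I) (P : pred I) (F : I -> R[i]) :
  Im (\sum_(i <- r | P i) F i) = \sum_(i <- r | P i) Im (F i).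
Proof. by elim/big_rec2: _ => // i y z _ <-; rewrite ImD. Qed.

Lemma sq0 : sq 0 = 0. Proof. by rewrite /sq !ReImE; ring. Qed.

Lemma sqM z w : sq (z * w) = sq z * sq w.
Proof. by rewrite /sq !ReImE; ring. Qed.

Lemma sqN z : sq (- z) = sq z.
Proof. by rewrite /sq !ReImE; ring. Qed.

Lemma sqJ z : sq ((conjc z)) = sq z.
Proof. by rewrite /sq !ReImE; ring. Qed.

Lemma JK z : conjc (conjc z) = z.
Proof. by case: z => x y; apply: cext => /=; ring. Qed.
Lemma JD z w : conjc (z + w) = conjc z + conjc w.
Proof. by case: z; case: w => x y x' y'; apply: cext => /=; ring. Qed.
Lemma JM z w : conjc (z * w) = conjc z * conjc w.
Proof. by case: z; case: w => x y x' y'; apply: cext => /=; ring. Qed.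

Lemma sqC (x : R) : sq x%:C%C = x ^+ 2.
Proof. by rewrite /sq !ReImE; ring. Qed.

Lemma sqi : sq 'i%C = 1.
Proof. by rewrite /sq !ReImE; ring. Qed.

Lemma sqB z w : sq (z - w) = sq (w - z).
Proof. by rewrite /sq !ReImE; ring. Qed.

Lemma sqD_le z w : sq (z + w) <= 2 * sq z + 2 * sq w.
Proof.
rewrite /sq !ReImE -subr_ge0.
have := sqr_ge0 (Re z - Re w); have := sqr_ge0 (Im z - Im w); nra.
Qed.

Lemma sq_eq0 z : sq z = 0 -> z = 0.
Proof.
move=> /eqP; rewrite /sq paddr_eq0 ?sqr_ge0 // !sqrf_eq0 => /andP[/eqP r /eqP i].
exact: cext.
Qed.

Lemma Re_le_sq z : Re z ^+ 2 <= sq z. Proof. by rewrite lerDl sqr_ge0. Qed.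
Lemma Im_le_sq z : Im z ^+ 2 <= sq z. Proof. by rewrite lerDr sqr_ge0. Qed.

Lemma normcM z w : normc (z * w) = normc z * normc w.
Proof. by rewrite !normcE sqM sqrtrM // sq_ge0. Qed.

Lemma normcC (x : R) : normc x%:C%C = `|x|.
Proof. by rewrite normcE sqC sqrtr_sqr. Qed.

Lemma normcD z w : normc (z + w) <= normc z + normc w.
Proof.
rewrite -(@ler_pXn2r _ 2) ?nnegrE ?addr_ge0 ?normc_ge0 // sqr_normc sqrrD !sqr_normc.
have : Re z * Re w + Im z * Im w <= normc z * normc w.
  rewrite -normcM normcE sqM.
  have [h|h] := leP (Re z * Re w + Im z * Im w) 0.
    by rewrite (le_trans h) // sqrtr_ge0.
  rewrite -(@ler_pXn2r _ 2) ?nnegrE ?sqrtr_ge0 ?(ltW h) // sqr_sqrtr ?mulr_ge0 ?sq_ge0 //.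
  rewrite /sq; have := sqr_ge0 (Re z * Im w - Im z * Re w); nra.
by rewrite /sq !ReImE; lra.
Qed.

End ComplexSquare.

(** * Square integrable complex functions *)

Section L2basics.
Context {R : realType} (a b : R).
Implicit Types u v w : R -> R[i].

Local Notation mu := (@lebesgue_measure R).
Local Notation D := (`]a, b[%classic : set R).

Definition Cmeas u := measurable_fun D (fun x => Re (u x)) /\
  measurable_fun D (fun x => Im (u x)).

Lemma mD : measurable D. Proof. exact: measurable_itv. Qed.
Hint Resolve mD : core.

Lemma muD_lty : (mu D < +oo)%E.
Proof. by rewrite lebesgue_measure_itv /=; case: ifP => _; rewrite ?ltry ?ltey. Qed.

Lemma mf_eq (f g : R -> R) : measurable_fun D f -> (forall x, g x = f x) ->
  measurable_fun D g.
Proof. by move=> mf h; have -> : g = f by apply/funext. Qed.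

Lemma CmeasD u v : Cmeas u -> Cmeas v -> Cmeas (fun x => u x + v x).
Proof.
move=> [ru iu] [rv iv]; split.
- by apply: mf_eq (fun x => ReD _ _); exact: measurable_funD.
- by apply: mf_eq (fun x => ImD _ _); exact: measurable_funD.
Qed.

Lemma CmeasN u : Cmeas u -> Cmeas (fun x => - u x).
Proof.
move=> [ru iu]; split.
- by apply: mf_eq (fun x => ReN _); exact: measurableT_comp.
- by apply: mf_eq (fun x => ImN _); exact: measurableT_comp.
Qed.

Lemma CmeasJ u : Cmeas u -> Cmeas (fun x => (conjc (u x))).
Proof.
move=> [ru iu]; split.
- by apply: mf_eq (fun x => ReJ _).
- by apply: mf_eq (fun x => ImJ _); exact: measurableT_comp.
Qed.

Lemma CmeasM u v : Cmeas u -> Cmeas v -> Cmeas (fun x => u x * v x).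
Proof.
move=> [ru iu] [rv iv]; split.
- by apply: mf_eq (fun x => ReM _ _); apply: measurable_funB; exact: measurable_funM.
- by apply: mf_eq (fun x => ImM _ _); apply: measurable_funD; exact: measurable_funM.
Qed.

Lemma CmeasC (f : R -> R) : measurable_fun D f -> Cmeas (fun x => (f x)%:C%C).
Proof. by move=> mf; split => //=; exact: measurable_cst. Qed.

Lemma Cmeas_cst (c : R[i]) : Cmeas (fun=> c).
Proof. by split; exact: measurable_cst. Qed.

Lemma Cmeas_sq u : Cmeas u -> measurable_fun D (fun x => sq (u x)).
Proof.
by move=> [ru iu]; apply: measurable_funD; exact: measurable_funX.
Qed.

Lemma rintD (f g : R -> R) : mu.-integrable D (EFin \o f) -> mu.-integrable D (EFin \o g) ->
  mu.-integrable D (EFin \o (fun x => f x + g x)).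
Proof. by move=> h k; exact: (integrableD _ h k). Qed.

Lemma rintB (f g : R -> R) : mu.-integrable D (EFin \o f) -> mu.-integrable D (EFin \o g) ->
  mu.-integrable D (EFin \o (fun x => f x - g x)).
Proof. by move=> h k; exact: (integrableB _ h k). Qed.

Lemma rintZ (c : R) (f : R -> R) : mu.-integrable D (EFin \o f) ->
  mu.-integrable D (EFin \o (fun x => c * f x)).
Proof. by move=> h; exact: (integrableZl _ c h). Qed.

Lemma rint_eq (f g : R -> R) : mu.-integrable D (EFin \o f) -> (forall x, g x = f x) ->
  mu.-integrable D (EFin \o g).
Proof. by move=> h k; have -> : g = f by apply/funext. Qed.

Lemma rint_dom (f g : R -> R) : measurable_fun D f -> mu.-integrable D (EFin \o g) ->
  (forall x, a < x < b -> `|f x| <= g x) -> mu.-integrable D (EFin \o f).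
Proof.
move=> mf ig h; apply: (le_integrable _ _ _ ig) => //.
  exact/measurable_EFinP.
move=> x; rewrite /= in_itv /= => /h hx.
by rewrite lee_fin (le_trans hx) // ler_norm.
Qed.

Lemma inL2P u : inL2 a b u <-> Cmeas u /\ mu.-integrable D (EFin \o (fun x => sq (u x))).
Proof.
have H (f : R -> R) : f \_ D \in Lfun mu 2%:E <->
    measurable_fun D f /\ mu.-integrable D (EFin \o (fun x => f x ^+ 2)).
  split.
  - move=> Lf; have := Lf; rewrite inE => /andP[]; rewrite inE /= => mf _.
    split; first exact/(measurable_restrictT _ mD).
    apply/integrable_mkcond => //.
    apply: eq_integrable (Lfun2_integrable_sqr Lf) => // x _.
    by rewrite /= !patchE /=; case: ifP => //=; rewrite expr0n.
  - move=> [mf iF]; rewrite inE; apply/andP; split.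
      by rewrite inE /=; apply/(measurable_restrictT _ mD).
    rewrite inE /= /finite_norm (@lty_poweRy _ _ 2) // powR_Lnorm //.
    move/integrable_mkcond : iF => /(_ mD) /integrableP [_].
    apply: le_lt_trans; rewrite le_eqVlt; apply/orP; left; apply/eqP.
    apply: eq_integral => x _ /=; rewrite !patchE /=; case: ifP => //= _.
    + by rewrite normrX powR_mulrn.
    + by rewrite normr0 powR0.
rewrite /inL2 !H /Cmeas /=; split.
- move=> [[mr ir] [mi ii]]; split=> //.
  exact: rintD.
- move=> [[mr mi] iq]; split; split => //.
  + apply: (rint_dom _ iq) => [|x _]; first exact: measurable_funX.
    by rewrite ger0_norm ?sqr_ge0 // Re_le_sq.
  + apply: (rint_dom _ iq) => [|x _]; first exact: measurable_funX.
    by rewrite ger0_norm ?sqr_ge0 // Im_le_sq.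
Qed.

Lemma inL2_meas u : inL2 a b u -> Cmeas u. Proof. by move/inL2P => []. Qed.
Lemma inL2_int u : inL2 a b u -> mu.-integrable D (EFin \o (fun x => sq (u x))).
Proof. by move/inL2P => []. Qed.

Lemma inL2_dom u (g : R -> R) : Cmeas u -> mu.-integrable D (EFin \o g) ->
  (forall x, a < x < b -> sq (u x) <= g x) -> inL2 a b u.
Proof.
move=> mu_ ig h; apply/inL2P; split=> //.
apply: (rint_dom _ ig) => [|x /h]; first exact: Cmeas_sq.
by rewrite ger0_norm ?sq_ge0.
Qed.

Lemma integrable_cstD (c : R) : mu.-integrable D (EFin \o (fun=> c)).
Proof.
apply: measurable_bounded_integrable => //; first exact: muD_lty.
exact: bounded_cst.
Qed.

Lemma inL2_bounded u (K : R) : Cmeas u -> (forall x, a < x < b -> sq (u x) <= K) ->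
  inL2 a b u.
Proof. by move=> m h; apply: (inL2_dom m (integrable_cstD K)) => x /h. Qed.

Lemma inL2_cst (c : R[i]) : inL2 a b (fun=> c).
Proof. exact: (inL2_bounded (Cmeas_cst c) (fun _ _ => lexx _)). Qed.

Lemma inL2D u v : inL2 a b u -> inL2 a b v -> inL2 a b (fun x => u x + v x).
Proof.
move=> Lu Lv; apply: (@inL2_dom _ (fun x => 2 * sq (u x) + 2 * sq (v x))).
- by apply: CmeasD; exact: inL2_meas.
- by apply: rintD; apply: rintZ; exact: inL2_int.
- by move=> x _; exact: sqD_le.
Qed.

Lemma inL2M_bounded u v (K : R) : Cmeas v -> (forall x, a < x < b -> sq (v x) <= K) ->
  inL2 a b u -> inL2 a b (fun x => v x * u x).
Proof.
move=> mv hv Lu; apply: (@inL2_dom _ (fun x => K * sq (u x))).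
- by apply: CmeasM => //; exact: inL2_meas.
- exact/rintZ/inL2_int.
- by move=> x /hv hx; rewrite sqM ler_wpM2r // sq_ge0.
Qed.

Lemma inL2Z u (c : R[i]) : inL2 a b u -> inL2 a b (fun x => c * u x).
Proof. by move=> Lu; apply: (inL2M_bounded (Cmeas_cst c) (fun _ _ => lexx _)). Qed.

Lemma inL2N u : inL2 a b u -> inL2 a b (fun x => - u x).
Proof.
move=> Lu; have := inL2Z (-1) Lu; congr (inL2 _ _ _).
by apply/funext => x; rewrite mulN1r.
Qed.

Lemma inL2B u v : inL2 a b u -> inL2 a b v -> inL2 a b (fun x => u x - v x).
Proof. by move=> Lu Lv; apply: inL2D => //; exact: inL2N. Qed.

Lemma inL2J u : inL2 a b u -> inL2 a b (fun x => (conjc (u x))).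
Proof.
move=> Lu; apply: (inL2_dom (CmeasJ (inL2_meas Lu)) (inL2_int Lu)) => x _.
by rewrite sqJ.
Qed.

Lemma inL2_sum I (r : seq I) (F : I -> R -> R[i]) :
  (forall i, inL2 a b (F i)) -> inL2 a b (fun x => \sum_(i <- r) F i x).
Proof.
move=> h; elim: r => [|i r IH].
  by under eq_fun do rewrite big_nil; exact: inL2_cst.
by under eq_fun do rewrite big_cons; exact: inL2D.
Qed.

Definition Cint u := mu.-integrable D (EFin \o (fun x => Re (u x))) /\
  mu.-integrable D (EFin \o (fun x => Im (u x))).

Lemma Cint_meas u : Cint u -> Cmeas u.
Proof. by move=> [/integrableP[m1 _] /integrableP[m2 _]]; split; exact/measurable_EFinP. Qed.

Lemma CintD u v : Cint u -> Cint v -> Cint (fun x => u x + v x).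
Proof.
move=> [ru iu] [rv iv]; split.
- by apply: (rint_eq (rintD ru rv)) => x; rewrite ReD.
- by apply: (rint_eq (rintD iu iv)) => x; rewrite ImD.
Qed.

Lemma CintZ u (c : R[i]) : Cint u -> Cint (fun x => c * u x).
Proof.
move=> [ru iu]; split.
- by apply: (rint_eq (rintB (rintZ (Re c) ru) (rintZ (Im c) iu))) => x; rewrite ReM.
- by apply: (rint_eq (rintD (rintZ (Re c) iu) (rintZ (Im c) ru))) => x; rewrite ImM.
Qed.

Lemma CintN u : Cint u -> Cint (fun x => - u x).
Proof.
move=> Lu; have := CintZ (-1) Lu; congr (Cint _).
by apply/funext => x; rewrite mulN1r.
Qed.

Lemma CintB u v : Cint u -> Cint v -> Cint (fun x => u x - v x).
Proof. by move=> Lu Lv; apply: CintD => //; exact: CintN. Qed.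

Lemma Cint_dom u (g : R -> R) : Cmeas u -> mu.-integrable D (EFin \o g) ->
  (forall x, a < x < b -> normc (u x) <= g x) -> Cint u.
Proof.
move=> [mr mi] ig h; split; apply: (rint_dom _ ig) => // x /h hx.
- by rewrite (le_trans _ hx) // normcE -sqrtr_sqr ler_wsqrtr // Re_le_sq.
- by rewrite (le_trans _ hx) // normcE -sqrtr_sqr ler_wsqrtr // Im_le_sq.
Qed.

Lemma Cint_normc u : Cint u -> mu.-integrable D (EFin \o (fun x => normc (u x))).
Proof.
move=> iu; have [ir ii] := iu.
apply: (rint_dom _ (rintD (integrable_norm ir) (integrable_norm ii))) => [|x _].
- apply: mf_eq (fun x => normcE _).
  apply: (measurableT_comp (continuous_measurable_fun (@sqrt_continuous R))).
  exact: (Cmeas_sq (Cint_meas iu)).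
- rewrite ger0_norm ?normc_ge0 // -(@ler_pXn2r _ 2) ?nnegrE ?addr_ge0 ?normc_ge0 //=.
  rewrite sqr_normc /sq -(real_normK (num_real (Re _))) -(real_normK (num_real (Im _))).
  by rewrite sqrrD addrAC lerDl mulrn_wge0 // mulr_ge0.
Qed.

Lemma Cint_bounded u (K : R) : Cmeas u -> (forall x, a < x < b -> sq (u x) <= K) -> Cint u.
Proof.
move=> m h; apply: (Cint_dom m (integrable_cstD (Num.sqrt K))) => x /h hx.
by rewrite normcE ler_wsqrtr.
Qed.

Lemma CintM u v : inL2 a b u -> inL2 a b v -> Cint (fun x => u x * v x).
Proof.
move=> Lu Lv; apply: (@Cint_dom _ (fun x => sq (u x) + sq (v x))).
- by apply: CmeasM; exact: inL2_meas.
- by apply: rintD; exact: inL2_int.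
- move=> x _; rewrite normcM -!sqr_normc.
  have := sqr_ge0 (normc (u x) - normc (v x)).
  have := sqr_ge0 (normc (u x)); have := sqr_ge0 (normc (v x)); nra.
Qed.

Lemma CintM_bounded u v (K : R) : Cmeas v -> (forall x, a < x < b -> sq (v x) <= K) ->
  Cint u -> Cint (fun x => u x * v x).
Proof.
move=> mv hv iu.
apply: (@Cint_dom _ (fun x => Num.sqrt K * normc (u x))).
- by apply: CmeasM => //; exact: Cint_meas.
- exact/rintZ/Cint_normc.
- move=> x /hv hx; rewrite normcM mulrC ler_wpM2r ?normc_ge0 // normcE ler_wsqrtr //.
Qed.

Lemma inL2_Cint u : inL2 a b u -> Cint u.
Proof.
move=> Lu; have := CintM Lu (inL2_cst 1); congr (Cint _).
by apply/funext => x; rewrite mulr1.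
Qed.

Lemma ReI u : Re (Cintegral a b u) = \int[mu]_(x in D) Re (u x). Proof. by []. Qed.
Lemma ImI u : Im (Cintegral a b u) = \int[mu]_(x in D) Im (u x). Proof. by []. Qed.

Lemma CintegralD u v : Cint u -> Cint v ->
  Cintegral a b (fun x => u x + v x) = Cintegral a b u + Cintegral a b v.
Proof.
move=> [ru iu] [rv iv]; apply: cext; rewrite !(ReI, ImI, ReImE).
- by under eq_Rintegral do rewrite ReD; rewrite RintegralD.
- by under eq_Rintegral do rewrite ImD; rewrite RintegralD.
Qed.

Lemma CintegralZ u (c : R[i]) : Cint u ->
  Cintegral a b (fun x => c * u x) = c * Cintegral a b u.
Proof.
move=> [ru iu]; apply: cext; rewrite !(ReI, ImI, ReImE).
- under eq_Rintegral do rewrite ReM.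
  rewrite RintegralB //; [|exact: rintZ..].
  by rewrite !RintegralZl.
- under eq_Rintegral do rewrite ImM.
  rewrite RintegralD //; [|exact: rintZ..].
  by rewrite !RintegralZl.
Qed.

Lemma CintegralN u : Cint u -> Cintegral a b (fun x => - u x) = - Cintegral a b u.
Proof.
by move=> iu; rewrite -mulN1r -CintegralZ //; congr Cintegral; apply/funext => x; rewrite mulN1r.
Qed.

Lemma CintegralB u v : Cint u -> Cint v ->
  Cintegral a b (fun x => u x - v x) = Cintegral a b u - Cintegral a b v.
Proof. by move=> iu iv; rewrite CintegralD ?CintegralN //; exact: CintN. Qed.

Lemma eq_Cintegral u v : (forall x, a < x < b -> u x = v x) ->
  Cintegral a b u = Cintegral a b v.
Proof.
move=> h; apply: cext; rewrite !(ReI, ImI); apply: eq_Rintegral => x;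
  by rewrite inE /= in_itv /= => /h ->.
Qed.

Lemma Cint_sum I (r : seq I) (F : I -> R -> R[i]) :
  (forall i, Cint (F i)) -> Cint (fun x => \sum_(i <- r) F i x).
Proof.
move=> h; elim: r => [|i r IH].
  by under eq_fun do rewrite big_nil; exact/inL2_Cint/inL2_cst.
by under eq_fun do rewrite big_cons; exact: CintD.
Qed.

Lemma Cintegral_sum I (r : seq I) (F : I -> R -> R[i]) : (forall i, Cint (F i)) ->
  Cintegral a b (fun x => \sum_(i <- r) F i x) = \sum_(i <- r) Cintegral a b (F i).
Proof.
move=> h; elim: r => [|i r IH].
  rewrite big_nil; under eq_fun do rewrite big_nil.
  by apply: cext; rewrite !(ReI, ImI) Rintegral_cst // mul0r.
rewrite big_cons; under eq_fun do rewrite big_cons.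
by rewrite CintegralD ?IH //; exact: Cint_sum.
Qed.

Lemma CintegralJ u : Cint u -> Cintegral a b (fun x => (conjc (u x))) = (conjc (Cintegral a b u)).
Proof.
move=> [ru iu]; apply: cext; rewrite !(ReI, ImI, ReImE).
- by under eq_Rintegral do rewrite ReJ.
- under eq_Rintegral do rewrite ImJ -mulN1r.
  by rewrite RintegralZl // mulN1r.
Qed.

Definition nsq u : R := \int[mu]_(x in D) sq (u x).

Lemma nsq_ge0 u : 0 <= nsq u.
Proof. by apply: Rintegral_ge0 => x _; exact: sq_ge0. Qed.

Lemma sq_mulJ (z w : R[i]) : z * (conjc w) =
  Complex (Re z * Re w + Im z * Im w) (Im z * Re w - Re z * Im w).
Proof. by case: z; case: w => x y x' y'; apply: cext => /=; ring. Qed.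

Lemma nsqE u : Cintegral a b (fun x => u x * (conjc (u x))) = (nsq u)%:C%C.
Proof.
apply: cext; rewrite !(ReI, ImI, ReImE).
- by apply: eq_Rintegral => x _; rewrite sq_mulJ /sq /= !expr2.
- under eq_Rintegral do rewrite sq_mulJ /= mulrC subrr.
  by rewrite Rintegral_cst // mul0r.
Qed.

Lemma L2normE u : inL2 a b u -> L2norm a b u = (Num.sqrt (nsq u))%:E.
Proof.
move=> Lu; rewrite /L2norm.
set N := ('N[_]__[_])%E.
have N0 : (0 <= N)%E by exact: Lnorm_ge0.
have N2 : (N `^ 2 = (nsq u)%:E)%E.
  rewrite /N powR_Lnorm // /nsq /Rintegral fineK; last first.
    by apply: integrable_fin_num => //; exact: inL2_int.
  rewrite [RHS]integral_mkcond; apply: eq_integral => x _.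
  rewrite /= !patchE /=; case: ifP => //= _.
    by rewrite ger0_norm ?normc_ge0 // powR_mulrn ?normc_ge0 // sqr_normc.
  by rewrite normr0 powR0.
have Nfin : N \is a fin_num.
  rewrite ge0_fin_numE // (@lty_poweRy _ _ 2) // N2 ltry //.
rewrite -(fineK Nfin) in N2 N0 *.
move: N2 => /= [N2]; congr (_%:E).
have n0 : 0 <= fine N by rewrite -lee_fin.
by rewrite -N2 powR_mulrn // sqrtr_sqr ger0_norm.
Qed.

Lemma L2norm_le u (A : R) : inL2 a b u -> 0 <= A ->
  (L2norm a b u <= A%:E)%E <-> nsq u <= A ^+ 2.
Proof.
move=> Lu A0; rewrite L2normE // lee_fin.
by rewrite -[X in _ <= X]ger0_norm // -sqrtr_sqr ler_sqrt // sqr_ge0.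
Qed.

(** Nonnegativity of the norm of [s u + t v] gives a Hermitian form in (s, t);
    the three choices of (s, t) below also cover vanishing norms. *)
Lemma cauchy_schwarz u v : inL2 a b u -> inL2 a b v ->
  sq (Cintegral a b (fun x => u x * (conjc (v x)))) <= nsq u * nsq v.
Proof.
move=> Lu Lv; set z := Cintegral _ _ _.
have key (s t : R[i]) : 0 <= sq s * nsq u + sq t * nsq v + 2 * Re (s * (conjc t) * z).
  have L1 := inL2D (inL2Z s Lu) (inL2Z t Lv).
  set q := (X in 0 <= X).
  suff E : Cintegral a b (fun x => (s * u x + t * v x) * (conjc (s * u x + t * v x))) = q%:C%C.
    have [<-] : (nsq (fun x => s * u x + t * v x))%:C%C = q%:C%C by rewrite -nsqE.
    exact: nsq_ge0.
  transitivity (Cintegral a b (fun x => s * (conjc s) * (u x * (conjc (u x)))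
     + (t * (conjc t) * (v x * (conjc (v x))) + (s * (conjc t) * (u x * (conjc (v x))) +
        (conjc (s * (conjc t))) * (conjc (u x * (conjc (v x)))))))).
    by apply: eq_Cintegral => x _; rewrite !(JD, JM, JK);
      move: (conjc s) (conjc t) (conjc (u x)) (conjc (v x)) => *; ring.
  have iuv := CintM Lu (inL2J Lv).
  have iuvJ : Cint (fun x => (conjc (u x * (conjc (v x))))).
    have := CintM (inL2J Lu) Lv; congr Cint; apply/funext => x.
    by rewrite JM JK.
  have iuu := CintM Lu (inL2J Lu).
  have ivv := CintM Lv (inL2J Lv).
  rewrite CintegralD; [|exact: CintZ|by apply: CintD; [|apply: CintD]; exact: CintZ].
  rewrite CintegralD; [|exact: CintZ|by apply: CintD; exact: CintZ].
  rewrite CintegralD; [|exact: CintZ..].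
  rewrite !CintegralZ // CintegralJ // !nsqE -/z.
  rewrite /q; clearbody z; move: (nsq u) (nsq v) => U V.
  by move: s t z {L1 q} => [? ?] [? ?] [? ?]; apply: cext; rewrite /sq /=; ring.
have nu := nsq_ge0 u; have nv := nsq_ge0 v.
have h1 := key (nsq v)%:C%C (- z).
have h2 := key (- (conjc z)) (nsq u)%:C%C.
have h3 := key 1 (- z).
clearbody z; move: (nsq u) (nsq v) nu nv h1 h2 h3 {key} => U V nu nv.
case: z => x y; rewrite /sq /= => h1 h2 h3.
have [V0|V0] := eqVneq V 0.
  have [U0|U0] := eqVneq U 0; first by move: h3; rewrite V0 U0; nra.
  have U1 : 0 < U by rewrite lt_neqAle eq_sym U0.
  rewrite -(ler_pM2l U1); nra.
have V1 : 0 < V by rewrite lt_neqAle eq_sym V0.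
rewrite -(ler_pM2l V1); nra.
Qed.

End L2basics.

Arguments sq : simpl never.
Arguments nsq : simpl never.
Arguments Cintegral : simpl never.

(** * The unit circle and symmetric sums *)

Section Cis.
Context {R : realType}.

Definition cis (t : R) : R[i] := Complex (cos t) (sin t).

Lemma cexp_i (t : R) : cexp ('i%C * t%:C%C) = cis t.
Proof.
rewrite /cexp !ReM !ImM /= !mul0r !mul1r subr0 add0r expR0 !mul1r.
by [].
Qed.

Lemma cexp_Ni (t : R) : cexp (- 'i%C * t%:C%C) = conjc (cis t).
Proof.
have -> : - 'i%C * t%:C%C = 'i%C * (- t)%:C%C :> R[i].
  by rewrite mulNr -mulrN -rmorphN.
by rewrite cexp_i /cis cosN sinN.
Qed.

Lemma cisD (s t : R) : cis (s + t) = cis s * cis t.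
Proof. by apply: cext; rewrite ?ReM ?ImM /= ?cosD ?sinD; ring. Qed.

Lemma cis0 : cis 0 = 1.
Proof. by rewrite /cis cos0 sin0. Qed.

Lemma cisN (t : R) : cis (- t) = conjc (cis t).
Proof. by rewrite /cis cosN sinN. Qed.

Lemma sq_cis (t : R) : sq (cis t) = 1.
Proof. by rewrite /sq /= cos2Dsin2. Qed.

Lemma cis_2pi (l : int) : cis (2 * pi * l%:~R) = 1.
Proof.
have N (n : nat) : cis (2 * pi * n%:R) = 1.
  elim: n => [|n IH]; first by rewrite mulr0 cis0.
  rewrite -[n.+1]addn1 natrD mulrDr cisD IH mulr1 mul1r.
  by have := @cosD2pi R 0; have := @sinD2pi R 0; rewrite /cis !add0r cos0 sin0 mulr_natl => -> ->.
case: (intP l) => [|n|n]; first by rewrite mulr0 cis0.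
  exact: (N n.+1).
rewrite mulrNz mulrN cisN; rewrite (N n.+1).
by apply: cext => /=; ring.
Qed.

End Cis.

Section SymSum.

Definition ssum {V : nmodType} (N : nat) (F : int -> V) : V :=
  \sum_(k < (2 * N).+1) F (k%:Z - N%:Z).

Lemma ssumD (V : nmodType) N (F G : int -> V) :
  ssum N (fun l => F l + G l) = ssum N F + ssum N G.
Proof. exact: big_split. Qed.

Lemma ssumZ (A : pzRingType) N (c : A) (F : int -> A) :
  ssum N (fun l => c * F l) = c * ssum N F.
Proof. by rewrite /ssum big_distrr. Qed.

Lemma eq_ssum (V : nmodType) N (F G : int -> V) : F =1 G -> ssum N F = ssum N G.
Proof. by move=> h; apply: eq_bigr. Qed.

Lemma ssum_recr (V : nmodType) N (F : int -> V) :
  ssum N.+1 F = ssum N F + (F N.+1%:Z + F (- N.+1%:Z)).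
Proof.
rewrite /ssum mulnS big_ord_recr big_ord_recl /=.
rewrite [F (_ - _)](_ : _ = F (- N.+1%:Z)); last by congr F; rewrite sub0r.
rewrite [X in _ + X](_ : _ = F N.+1%:Z); last by congr F; lia.
rewrite -addrA addrC -addrA; congr (_ + _).
by apply: eq_bigr => i _; congr F; rewrite /bump /=; lia.
Qed.

Lemma ssum0 (V : nmodType) (F : int -> V) : ssum 0 F = F 0.
Proof. by rewrite /ssum big_ord1. Qed.

Context {R : realDomainType}.
Implicit Types F G : int -> R.

Lemma ler_ssum N F G : (forall l, F l <= G l) -> ssum N F <= ssum N G.
Proof. by move=> h; apply: ler_sum. Qed.

Lemma ssum_ge0 N F : (forall l, 0 <= F l) -> 0 <= ssum N F.
Proof. by move=> h; apply: sumr_ge0. Qed.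

Lemma ssum_homo F : (forall l, 0 <= F l) -> {homo ssum^~ F : m n / (m <= n)%N >-> m <= n}.
Proof.
move=> h; apply: homo_leq => [x|y x z|n]; [exact: lexx|exact: le_trans|].
by rewrite ssum_recr lerDl addr_ge0.
Qed.

Lemma ssum_ge_term N F (l : int) : (forall l, 0 <= F l) -> (`|l| <= N)%N -> F l <= ssum N F.
Proof.
move=> h lN.
have k_lt : (`|(l + N%:Z)%R|%N < (2 * N).+1)%N by lia.
rewrite /ssum (bigD1 (Ordinal k_lt)) //=.
have -> : `|(l + N%:Z)%R|%N%:Z - N%:Z = l by lia.
by rewrite lerDl sumr_ge0.
Qed.

End SymSum.

Lemma ftc2 {R : realType} (c d : R) (F f : R -> R) : c < d ->
  (forall x : R, is_derive x 1 F (f x)) -> continuous f ->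
  \int[@lebesgue_measure R]_(x in `]c, d[) f x = F d - F c.
Proof.
move=> cd dF cf.
have icc : (@lebesgue_measure R).-integrable `[c, d] (EFin \o f).
  apply: continuous_compact_integrable; first exact: segment_compact.
  exact: continuous_subspaceT.
have ico : (@lebesgue_measure R).-integrable `[c, d[ (EFin \o f).
  by apply: integrableS icc => //; apply: subset_itvl; rewrite bnd_simp.
have ioo : (@lebesgue_measure R).-integrable `]c, d[ (EFin \o f).
  by apply: integrableS icc => //; exact: subset_itv_oo_cc.
rewrite (Rintegral_itv_obnd_cbnd ioo) (Rintegral_itv_bndo_bndc ico).
have dF1 (x : R) : derivable F x 1 by case: (dF x).
rewrite /Rintegral (@continuous_FTC2 _ f F) //.
- exact: continuous_subspaceT.
- split=> [x _ //||].
  + by apply: cvg_at_right_filter; apply/differentiable_continuous/derivable1_diffP.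
  + by apply: cvg_at_left_filter; apply/differentiable_continuous/derivable1_diffP.
- by move=> x _; rewrite derive1E; case: (dF x).
Qed.

(** * Trigonometric modes and Bessel *)

Section Trig.
Context {R : realType} (a b : R) (hab : a < b).
Implicit Types (u v g : R -> R[i]) (c : int -> R[i]).
Local Notation mu := (@lebesgue_measure R).
Local Notation D := (`]a, b[%classic : set R).

Let L0 : 0 < b - a. Proof. by rewrite subr_gt0. Qed.

Definition E (l : int) (x : R) : R[i] := cis (freq a b l * (x - a)).

Lemma freqD l k : freq a b (l + k) = freq a b l + freq a b k.
Proof. by rewrite /freq intrD; ring. Qed.

Lemma freqN l : freq a b (- l) = - freq a b l.
Proof. by rewrite /freq mulrNz; ring. Qed.

Lemma freq0 : freq a b 0 = 0.
Proof. by rewrite /freq mulr0 mul0r. Qed.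

Lemma freq_neq0 (l : int) : l != 0 -> freq a b l != 0.
Proof.
by move=> l0; rewrite /freq !mulf_neq0 ?invr_eq0 ?intr_eq0 // gt_eqF // pi_gt0.
Qed.

Lemma E_D l k x : E (l + k) x = E l x * E k x.
Proof. by rewrite /E freqD mulrDl cisD. Qed.

Lemma E_N l x : E (- l) x = conjc (E l x).
Proof. by rewrite /E freqN mulNr cisN. Qed.

Lemma E_0 x : E 0 x = 1.
Proof. by rewrite /E freq0 mul0r cis0. Qed.

Lemma sq_E l x : sq (E l x) = 1. Proof. exact: sq_cis. Qed.

Lemma E_a l : E l a = 1. Proof. by rewrite /E subrr mulr0 cis0. Qed.
Lemma E_b l : E l b = 1.
Proof. by rewrite /E /freq divfK ?cis_2pi // gt_eqF. Qed.

Let dlin (m x : R) : is_derive x 1 (fun x : R => m * (x - a)) m.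
Proof.
have h : is_derive x 1 (fun x : R => x - a) 1.
  by apply: is_derive_eq (is_deriveB _ _) _; rewrite subr0.
by apply: is_derive_eq (is_deriveZ m h) _; rewrite /GRing.scale /= mulr1.
Qed.

Lemma is_derive_ReE l (x : R) : is_derive x 1 (fun x => Re (E l x)) (- freq a b l * Im (E l x)).
Proof.
apply: (@is_derive_eq _ _ _ _ _ _ _ _ (@is_derive1_comp _ cos _ x _ _ _ (dlin (freq a b l) x))).
by rewrite mulrC mulrN mulNr.
Qed.

Lemma is_derive_ImE l (x : R) : is_derive x 1 (fun x => Im (E l x)) (freq a b l * Re (E l x)).
Proof.
apply: (@is_derive_eq _ _ _ _ _ _ _ _ (@is_derive1_comp _ sin _ x _ _ _ (dlin (freq a b l) x))).
by rewrite mulrC.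
Qed.

Lemma continuous_ReE l : continuous (fun x => Re (E l x)).
Proof.
move=> x; apply/differentiable_continuous/derivable1_diffP.
by case: (is_derive_ReE l x).
Qed.

Lemma continuous_ImE l : continuous (fun x => Im (E l x)).
Proof.
move=> x; apply/differentiable_continuous/derivable1_diffP.
by case: (is_derive_ImE l x).
Qed.

Lemma Cmeas_E l : Cmeas a b (E l).
Proof.
split; apply: measurable_funTS; apply: continuous_measurable_fun.
- exact: continuous_ReE.
- exact: continuous_ImE.
Qed.

Lemma inL2_E l : inL2 a b (E l).
Proof. by apply: (inL2_bounded (Cmeas_E l)) => x _; rewrite sq_E. Qed.

Lemma Cintegral_E l : Cintegral a b (E l) = if l == 0 then (b - a)%:C%C else 0.
Proof.
have [->|l0] := eqVneq l 0.
  rewrite (@eq_Cintegral _ _ _ _ (fun=> 1)); last by move=> x _; rewrite E_0.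
  have HD : fine (mu D) = b - a.
    by rewrite lebesgue_measure_itv /= lte_fin hab.
  by apply: cext; rewrite (ReI, ImI) /= Rintegral_cst ?HD ?mul1r ?mul0r // mD.
have m0 := freq_neq0 l0.
apply: cext; rewrite !(ReI, ImI).
- have d (x : R) : is_derive x 1 (fun x => (freq a b l)^-1 * Im (E l x)) (Re (E l x)).
    apply: is_derive_eq (is_deriveZ _ (is_derive_ImE l x)) _.
    by rewrite /GRing.scale /= mulKf.
  by rewrite (ftc2 hab d) ?E_a ?E_b ?subrr //; exact: continuous_ReE.
- have d (x : R) : is_derive x 1 (fun x => - (freq a b l)^-1 * Re (E l x)) (Im (E l x)).
    apply: is_derive_eq (is_deriveZ _ (is_derive_ReE l x)) _.
    by transitivity (- (freq a b l)^-1 * (- freq a b l * Im (E l x))) => //; rewrite mulNr mulNr mulrN opprK mulKf.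
  by rewrite (ftc2 hab d) ?E_a ?E_b ?subrr //; exact: continuous_ImE.
Qed.

Lemma E_ortho l k : Cintegral a b (fun x => E l x * conjc (E k x)) =
  if l == k then (b - a)%:C%C else 0.
Proof.
rewrite (@eq_Cintegral _ _ _ _ (E (l - k))) => [|x _]; last by rewrite E_D E_N.
by rewrite Cintegral_E subr_eq0.
Qed.

Lemma fcoefE u l : fcoef a b u l =
  ((b - a)^-1)%:C%C * Cintegral a b (fun x => u x * conjc (E l x)).
Proof.
by rewrite /fcoef; congr (_ * Cintegral _ _ _); apply/funext => x; rewrite cexp_Ni.
Qed.

Lemma Cint_mulEJ u l : Cint a b u -> Cint a b (fun x => u x * conjc (E l x)).
Proof.
move=> iu; apply: CintM_bounded (CmeasJ (Cmeas_E l)) _ iu => x _.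
by rewrite sqJ sq_E.
Qed.

Lemma fcoefD u v l : Cint a b u -> Cint a b v ->
  fcoef a b (fun x => u x + v x) l = fcoef a b u l + fcoef a b v l.
Proof.
move=> iu iv; rewrite !fcoefE -mulrDr -CintegralD; [|exact: Cint_mulEJ..].
by congr (_ * Cintegral _ _ _); apply/funext => x; rewrite mulrDl.
Qed.

Lemma fcoefZ u (z : R[i]) l : Cint a b u ->
  fcoef a b (fun x => z * u x) l = z * fcoef a b u l.
Proof.
move=> iu; rewrite !fcoefE [RHS]mulrCA -[z * _]CintegralZ; last exact: Cint_mulEJ.
by congr (_ * Cintegral _ _ _); apply/funext => x; rewrite mulrA.
Qed.

Lemma fcoefB u v l : Cint a b u -> Cint a b v ->
  fcoef a b (fun x => u x - v x) l = fcoef a b u l - fcoef a b v l.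
Proof.
move=> iu iv.
have -> : (fun x => u x - v x) = (fun x => u x + -1 * v x).
  by apply/funext => x; rewrite mulN1r.
by rewrite fcoefD ?fcoefZ ?mulN1r //; exact: CintZ.
Qed.

Lemma eq_fcoef u v l : (forall x, a < x < b -> u x = v x) -> fcoef a b u l = fcoef a b v l.
Proof.
by move=> h; rewrite !fcoefE; congr (_ * _); apply: eq_Cintegral => x /h ->.
Qed.

Definition psum c (N : nat) (x : R) : R[i] := ssum N (fun l => c l * E l x).

Lemma inL2_psum c N : inL2 a b (psum c N).
Proof. by apply: inL2_sum => k; apply: inL2Z; exact: inL2_E. Qed.

Lemma Cintegral_mul_psumJ u c N : inL2 a b u ->
  Cintegral a b (fun x => u x * conjc (psum c N x)) =
  (b - a)%:C%C * ssum N (fun l => fcoef a b u l * conjc (c l)).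
Proof.
move=> Lu.
rewrite (@eq_Cintegral _ _ _ _ (fun x => \sum_(k < (2 * N).+1)
   conjc (c (k%:Z - N%:Z)) * (u x * conjc (E (k%:Z - N%:Z) x)))); last first.
  move=> x _; rewrite -[LHS]mulr1 /psum /ssum (big_morph (@conjc R) (@JD R) (_ : conjc 0 = 0)).
    by rewrite mulr1 big_distrr /=; apply: eq_bigr => k _; rewrite JM mulrCA.
  by apply: cext => /=; ring.
rewrite Cintegral_sum => [|k]; last by apply: CintZ; apply: Cint_mulEJ; exact: inL2_Cint.
rewrite /ssum big_distrr /=; apply: eq_bigr => k _.
rewrite CintegralZ; last by apply: Cint_mulEJ; exact: inL2_Cint.
rewrite fcoefE [RHS]mulrA [RHS]mulrC; congr (_ * _).
by rewrite mulrA -rmorphM /= divff ?mul1r // gt_eqF.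
Qed.

Lemma fcoef_E l k : fcoef a b (E l) k = if l == k then 1 else 0.
Proof.
rewrite fcoefE E_ortho; case: ifP => _; rewrite ?mulr0 //.
by rewrite -rmorphM /= mulVf // gt_eqF.
Qed.

Lemma fcoef_psum c N l : (`|l| <= N)%N -> fcoef a b (psum c N) l = c l.
Proof.
move=> lN; have k_lt : (`|(l + N%:Z)%R|%N < (2 * N).+1)%N by lia.
have iE k : Cint a b (fun x => E k x * conjc (E l x)) by apply/Cint_mulEJ/inL2_Cint/inL2_E.
rewrite fcoefE (@eq_Cintegral _ _ _ _ (fun x => \sum_(k < (2 * N).+1)
   c (k%:Z - N%:Z) * (E (k%:Z - N%:Z) x * conjc (E l x)))); last first.
  by move=> x _; rewrite /psum /ssum big_distrl /=; apply: eq_bigr => k _; rewrite mulrA.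
rewrite Cintegral_sum => [|k]; last exact: CintZ.
rewrite (bigD1 (Ordinal k_lt)) //= big1 => [|k kl]; last first.
  rewrite CintegralZ // E_ortho ifN ?mulr0 //; apply: contraNneq kl => kl.
  by apply/eqP/val_inj => /=; lia.
rewrite CintegralZ // E_ortho ifT; last by apply/eqP; lia.
rewrite addr0 mulrCA -rmorphM /= mulVf ?mulr1 ?gt_eqF //; congr c; lia.
Qed.

(** Pythagoras: by orthogonality of the modes, the distance of [u] to a
    trigonometric sum splits into the best possible one and the defect of the
    coefficients. *)
Lemma nsq_sub_psum u c N : inL2 a b u ->
  nsq a b (fun x => u x - psum c N x) = nsq a b u
    - (b - a) * ssum N (fun l => sq (fcoef a b u l))
    + (b - a) * ssum N (fun l => sq (fcoef a b u l - c l)).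
Proof.
move=> Lu; have LS := inL2_psum c N.
have iuu := CintM Lu (inL2J Lu).
have iuS := CintM Lu (inL2J LS).
have iSS := CintM LS (inL2J LS).
have iuSJ : Cint a b (fun x => conjc (u x * conjc (psum c N x))).
  have := CintM (inL2J Lu) LS; congr Cint; apply/funext => x.
  by rewrite JM JK.
suff : (nsq a b (fun x => u x - psum c N x))%:C%C = (nsq a b u
    - (b - a) * ssum N (fun l => sq (fcoef a b u l))
    + (b - a) * ssum N (fun l => sq (fcoef a b u l - c l)))%:C%C by case.
rewrite -nsqE (@eq_Cintegral _ _ _ _ (fun x => (u x * conjc (u x) - u x * conjc (psum c N x))
    + (psum c N x * conjc (psum c N x) - conjc (u x * conjc (psum c N x))))); last first.
  move=> x _; rewrite !(JM, JK, JD) -mulN1r JM mulrDl !mulrDr.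
  have -> : conjc (-1) = -1 :> R[i] by apply: cext => /=; ring.
  by move: (u x) (psum c N x) (conjc _) (conjc _) => *; ring.
rewrite CintegralD; [|exact: CintB..].
rewrite !CintegralB // CintegralJ // nsqE !Cintegral_mul_psumJ //.
have -> : ssum N (fun l => fcoef a b (psum c N) l * conjc (c l)) =
          ssum N (fun l => c l * conjc (c l)).
  by apply: eq_bigr => k _; rewrite fcoef_psum //; have := ltn_ord k; lia.
apply: cext.
  rewrite !(ReD, ReN, ReM, ReJ, ImJ) /= !mul0r !subr0 /ssum !ReS -!addrA; congr (_ + _).
  rewrite -!mulrN -!mulrDr; congr (_ * _).
  rewrite -!sumrN -!big_split /=; apply: eq_bigr => k _.
  by rewrite /sq !ReImE; ring.
rewrite !(ImD, ImN, ImM, ReJ, ImJ) /= !mul0r !addr0 /ssum !ImS.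
rewrite [X in _ + (_ * X - _)]big1; first by ring.
by move=> k _; rewrite !ReImE; ring.
Qed.

Lemma bessel u N : inL2 a b u ->
  (b - a) * ssum N (fun l => sq (fcoef a b u l)) <= nsq a b u.
Proof.
move=> Lu; have := nsq_sub_psum (fcoef a b u) N Lu.
have -> : ssum N (fun l => sq (fcoef a b u l - fcoef a b u l)) = 0.
  by rewrite /ssum big1 // => k _; rewrite subrr sq0.
rewrite mulr0 addr0 => h; rewrite -subr_ge0 -h; exact: nsq_ge0.
Qed.

Lemma bessel1 u l : inL2 a b u -> (b - a) * sq (fcoef a b u l) <= nsq a b u.
Proof.
move=> Lu; apply: le_trans (bessel `|l| Lu); rewrite ler_pM2l //.
apply: (@ssum_ge_term _ _ (fun l => sq (fcoef a b u l))) => // k; exact: sq_ge0.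
Qed.

End Trig.

Section AlmostEverywhere.
Context {R : realType}.
Local Notation mu := (@lebesgue_measure R).

Lemma aeS (P Q : R -> Prop) : (forall x, P x -> Q x) ->
  {ae mu, forall x, P x} -> {ae mu, forall x, Q x}.
Proof. by move=> h hP; exact: (@filterS _ _ (ae_filter_ringOfSetsType mu) P Q h hP). Qed.

Lemma aeS2 (P Q S : R -> Prop) : (forall x, P x -> Q x -> S x) ->
  {ae mu, forall x, P x} -> {ae mu, forall x, Q x} -> {ae mu, forall x, S x}.
Proof.
move=> h hP hQ.
apply: aeS (@filterI _ _ (ae_filter_ringOfSetsType mu) _ _ hP hQ) => x [].
exact: h.
Qed.

End AlmostEverywhere.

(** * Riesz-Fischer *)

Section RieszFischer.
Context {R : realType} (a b : R) (hab : a < b).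
Implicit Types (u v g : R -> R[i]) (c : int -> R[i]).
Local Notation mu := (@lebesgue_measure R).
Local Notation D := (`]a, b[%classic : set R).
Local Notation L := (b - a).
Local Notation psum := (psum a b).

Let L0 : 0 < L. Proof. by rewrite subr_gt0. Qed.

Lemma EFin_rint (f : R -> R) : mu.-integrable D (EFin \o f) ->
  (\int[mu]_(x in D) (f x)%:E)%E = (\int[mu]_(x in D) f x)%:E.
Proof. by move=> fi; rewrite fineK // (integrable_fin_num _ fi). Qed.

Lemma Rintegral_cstD (k : R) : \int[mu]_(x in D) k = k * L.
Proof.
have -> : L = fine (mu D) by rewrite lebesgue_measure_itv /= lte_fin hab.
by rewrite Rintegral_cst //; exact: mD.
Qed.

Lemma nsqB u v : nsq a b (fun x => u x - v x) = nsq a b (fun x => v x - u x).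
Proof. by apply: eq_Rintegral => x _; rewrite sqB. Qed.

Lemma nsq_psum c N : nsq a b (psum c N) = L * ssum N (fun l => sq (c l)).
Proof.
have := nsq_sub_psum hab c N (inL2_psum a b c N).
have -> : nsq a b (fun x => psum c N x - psum c N x) = 0.
  transitivity (\int[mu]_(x in D) (0 : R)).
    by apply: eq_Rintegral => x _; rewrite subrr sq0.
  by rewrite Rintegral_cst ?mul0r //; exact: mD.
have h (G : R[i] -> R[i] -> R) : (forall z, G z z = 0) ->
    ssum N (fun l => G (fcoef a b (psum c N) l) (c l)) = 0.
  move=> G0; rewrite /ssum big1 // => k _; rewrite fcoef_psum //.
  by have := ltn_ord k; lia.
rewrite (h (fun z w => sq (z - w))) => [|z]; last by rewrite subrr sq0.
rewrite mulr0 addr0 => /eqP; rewrite eq_sym subr_eq0 => /eqP ->.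
congr (_ * _); apply: eq_bigr => k _; rewrite fcoef_psum //.
by have := ltn_ord k; lia.
Qed.

Lemma nsq_psumB c (M N : nat) : nsq a b (fun x => psum c M x - psum c N x) =
  L * `|ssum M (fun l => sq (c l)) - ssum N (fun l => sq (c l))|.
Proof.
wlog NM : M N / (N <= M)%N.
  by move=> H; have [/H //|/ltnW/H] := leqP N M; rewrite nsqB distrC.
rewrite nsq_sub_psum //; last exact: inL2_psum.
rewrite nsq_psum ger0_norm; last first.
  by rewrite subr_ge0; apply: ssum_homo NM => l; exact: sq_ge0.
have -> : ssum N (fun l => sq (fcoef a b (psum c M) l - c l)) = 0.
  rewrite /ssum big1 // => k _; rewrite fcoef_psum ?subrr ?sq0 //.
  by have := ltn_ord k; lia.
rewrite mulr0 addr0 -mulrBr; congr (_ * (_ - _)); apply: eq_bigr => k _.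
by rewrite fcoef_psum //; have := ltn_ord k; lia.
Qed.

(** Used on each component of the partial sums of a series of complex numbers,
    [d] being the sequence of the moduli of its terms. *)
Lemma summable_cvg (z : nat -> R) (d : nat -> R) (B : R) :
  (forall k, `|z k.+1 - z k| <= d k) -> (forall n, \sum_(0 <= k < n) d k <= B) ->
  cvgn z.
Proof.
move=> zd dB.
have ub : has_ubound (range [normed series (telescope z)]).
  exists B => _ [n _ <-]; apply: le_trans (dB n).
  by rewrite /series /=; apply: ler_sum => k _; exact: zd.
have : cvgn (series (telescope z)).
  apply: normed_cvg; apply: nondecreasing_is_cvgn ub.
  apply: nondecreasing_series => k _ _; exact: normr_ge0.
rewrite telescopeK => h.
have -> : z = (fun n => (z n - z 0%N) + z 0%N) by apply/funext => n; rewrite subrK.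
by apply: is_cvgD => //; exact: is_cvg_cst.
Qed.

Lemma limn_EFin (z : nat -> R) (l : R) : z k @[k --> \oo] --> l ->
  limn_einf (fun k => (z k)%:E) = l%:E /\ limn_esup (fun k => (z k)%:E) = l%:E.
Proof.
move=> zl; have h : (z k)%:E @[k --> \oo] --> l%:E by apply: cvg_EFin => //; exact: nearW.
by have [-> ->] := cvg_limn_einf_sup h.
Qed.

(** Coefficients are continuous for the L^2 norm by Bessel, and those of the
    partial sums are stationary. *)
Lemma fcoef_lim g c l : inL2 a b g ->
  nsq a b (fun x => g x - psum c N x) @[N --> \oo] --> (0 : R) -> fcoef a b g l = c l.
Proof.
move=> Lg lim; apply/eqP; rewrite -subr_eq0; apply/eqP/sq_eq0.
suff : L * sq (fcoef a b g l - c l) <= 0.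
  rewrite pmulr_rle0 // => h; apply/eqP; by rewrite eq_le h sq_ge0.
rewrite -(cvg_lim _ lim) //; apply: limr_ge; first exact: (cvgP _ lim).
exists `|l|%N => // N /= lN.
apply: le_trans (bessel1 hab l (inL2B Lg (inL2_psum a b c N))); rewrite ler_pM2l //.
rewrite fcoefB; [|exact: inL2_Cint|exact/inL2_Cint/inL2_psum].
by rewrite fcoef_psum.
Qed.

(** Along a subsequence whose successive L^2 distances are at most 2^-k, the
    partial sums converge absolutely almost everywhere, because the integral of
    the sum of the increments is finite. Fatou then shows that the pointwise limit is
    also the limit in L^2. *)
Lemma riesz_fischer c (B : R) : (forall N, ssum N (fun l => sq (c l)) <= B) ->
  exists g, [/\ inL2 a b g, forall l, fcoef a b g l = c l &
    nsq a b (fun x => g x - psum c N x) @[N --> \oo] --> (0 : R)].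
Proof.
move=> cB; pose s N := ssum N (fun l => sq (c l)).
have s_homo : {homo s : m n / (m <= n)%N >-> m <= n}.
  by apply: ssum_homo => l; exact: sq_ge0.
have s_ub : has_ubound (range s) by exists B => _ [n _ <-]; exact: cB.
have s_cvg := nondecreasing_cvgn s_homo s_ub.
set S := sup (range s) in s_cvg.
have s_le N : s N <= S by apply: ub_le_sup => //; exists N.
(* squared 2^-k, as the tail of the series bounds the squared norm of an increment *)
have /choice[f fP] : forall k : nat, exists m, S - s m < (2^-1) ^+ k ^+ 2.
  move=> k; have e0 : 0 < ((2 : R)^-1) ^+ k ^+ 2 by rewrite !exprn_gt0.
  have hs : has_sup (range s) by split => //; exists (s 0%N), 0%N.
  have [_ [m _ <-] hm] := sup_adherent e0 hs.
  by exists m; move: hm; rewrite -/S; lra.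
pose dd k x := normc (psum c (f k.+1) x - psum c (f k) x).
have Ld k : inL2 a b (fun x => psum c (f k.+1) x - psum c (f k) x).
  by apply: inL2B; exact: inL2_psum.
(* [2 |d| <= p + |d|^2 / p] with p = 2^-k replaces Cauchy-Schwarz *)
have int_dd k : (\int[mu]_(x in D) (dd k x)%:E <= (L * (2^-1) ^+ k)%:E)%E.
  have p0 : 0 < ((2 : R)^-1) ^+ k by rewrite exprn_gt0.
  set p := _ ^+ k in p0 *.
  have id := Cint_normc (inL2_Cint (Ld k)).
  have ik := inL2_int (Ld k).
  rewrite (EFin_rint id) lee_fin.
  have -> : L * p = \int[mu]_(x in D) (p / 2 + (p^-1 / 2) * sq (psum c (f k.+1) x - psum c (f k) x))
     + (L * p - \int[mu]_(x in D) (p / 2 + (p^-1 / 2) * sq (psum c (f k.+1) x - psum c (f k) x))).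
    by ring.
  rewrite -[X in X <= _]addr0; apply: lerD.
    apply: le_Rintegral => //.
      by apply: rintD; [exact: integrable_cstD|exact: rintZ].
    move=> x _; rewrite -sqr_normc -/(dd k x).
    have := sqr_ge0 (p - dd k x); rewrite -subr_ge0 => h.
    rewrite -(ler_pM2l p0) mulrDr !mulrA divff ?gt_eqF // -subr_ge0.
    by have := sqr_ge0 (p - dd k x); lra.
  rewrite RintegralD //; last 2 first.
  - exact: integrable_cstD.
  - exact: rintZ.
  rewrite Rintegral_cstD RintegralZl //.
  rewrite -/(nsq a b (fun x => psum c (f k.+1) x - psum c (f k) x)) nsq_psumB -!/(s _).
  have h : `|s (f k.+1) - s (f k)| <= p ^+ 2.
    have := fP k; have := fP k.+1; have := s_le (f k); have := s_le (f k.+1).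
    have : ((2 : R)^-1) ^+ k.+1 ^+ 2 <= p ^+ 2.
      rewrite (exprS _ k) -/p; nra.
    rewrite -/p => ? ? ? ? ?; rewrite ler_norml; apply/andP; split; lra.
  have : p^-1 / 2 * (L * `|s (f k.+1) - s (f k)|) <= p^-1 / 2 * (L * p ^+ 2).
    by rewrite ler_pM2l ?divr_gt0 ?invr_gt0 // ler_pM2l.
  have -> : p^-1 / 2 * (L * p ^+ 2) = L * p / 2 by field; rewrite gt_eqF.
  lra.
have mdd k : measurable_fun D (fun x => (dd k x)%:E).
  by have /integrableP[] := Cint_normc (inL2_Cint (Ld k)).
have sum_fin : {ae mu, forall x, D x -> (\sum_(0 <= k <oo) (dd k x)%:E < +oo)%E}.
  have : mu.-integrable D (fun x => \sum_(0 <= k <oo) (dd k x)%:E)%E.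
    apply/integrableP; split.
      apply: ge0_emeasurable_sum; last by move=> k _; exact: mdd.
      by move=> k x _ _; rewrite lee_fin; exact: normc_ge0.
    have -> : (\int[mu]_(x in D) `|\sum_(0 <= k <oo) (dd k x)%:E| =
               \int[mu]_(x in D) (\sum_(0 <= k <oo) (dd k x)%:E))%E.
      apply: eq_integral => x _; rewrite gee0_abs // nneseries_ge0 // => k _ _.
      by rewrite lee_fin normc_ge0.
    rewrite integral_nneseries //; last by move=> k x _; rewrite lee_fin normc_ge0.
    apply: (@le_lt_trans _ _ (2 * L)%:E); last exact: ltry.
    apply: lime_le.
      by apply: is_cvg_nneseries => k _ _; apply: integral_ge0 => x _; rewrite lee_fin normc_ge0.
    apply: nearW => n; apply: (@le_trans _ _ (\sum_(0 <= k < n) (L * (2^-1) ^+ k)%:E)%E).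
      exact: lee_sum.
    rewrite sumEFin lee_fin -mulr_sumr mulrC ler_pM2r //.
    suff -> : \sum_(0 <= k < n) ((2 : R)^-1) ^+ k = 2 - 2 * (2^-1) ^+ n.
      by rewrite lerBlDr lerDl mulr_ge0 // exprn_ge0 // invr_ge0.
    elim: n => [|n IH]; first by rewrite big_geq // expr0; ring.
    by rewrite big_nat_recr //= IH exprS; field.
  move=> ii; have := integrable_ae _ ii => /(_ (measurable_itv _)).
  apply: aeS => x h Dx; move/h: Dx;
  by rewrite fin_numE => /andP[_]; rewrite ltey.
have cvg_ae : {ae mu, forall x, D x -> cvgn (fun k => Re (psum c (f k) x)) /\
    cvgn (fun k => Im (psum c (f k) x))}.
  apply: aeS sum_fin => x /[apply] hx.
  have [B' B'P] : exists B', forall n, \sum_(0 <= k < n) dd k x <= B'.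
    exists (fine (\sum_(0 <= k <oo) (dd k x)%:E)) => n.
    rewrite -lee_fin fineK; last first.
      rewrite ge0_fin_numE // nneseries_ge0 // => k _ _; by rewrite lee_fin normc_ge0.
    rewrite -sumEFin; apply: nneseries_lim_ge => k _ _; by rewrite lee_fin normc_ge0.
  split; apply: (summable_cvg _ B'P) => k.
  - rewrite -ReN -ReD /dd normcE -sqrtr_sqr ler_wsqrtr //; exact: Re_le_sq.
  - rewrite -ImN -ImD /dd normcE -sqrtr_sqr ler_wsqrtr //; exact: Im_le_sq.
pose g x : R[i] := Complex (fine (limn_esup (fun k => (Re (psum c (f k) x))%:E)))
   (fine (limn_esup (fun k => (Im (psum c (f k) x))%:E))).
have mg : Cmeas a b g.
  have mp k := inL2_meas (inL2_psum a b c (f k)).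
  split; (apply: measurableT_comp; first exact: fine_measurable);
    apply: measurable_fun_limn_esup => k; apply/measurable_EFinP; by have [] := mp k.
have g_lim : {ae mu, forall x, D x -> forall N, sq (psum c (f k) x - psum c N x) @[k --> \oo] -->
    sq (g x - psum c N x)}.
  apply: aeS cvg_ae => x /[apply] -[cr ci] N.
  have E (z : nat -> R) : cvgn z -> z k @[k --> \oo] --> fine (limn_esup (EFin \o z)).
    by move=> /cvg_ex[/= l zl]; have [_ ->] := limn_EFin zl.
  rewrite /sq; under eq_fun do rewrite !(ReD, ImD, ReN, ImN).
  rewrite !(ReD, ImD, ReN, ImN); apply: cvgD; rewrite expr2; under eq_fun do rewrite expr2.
  - by apply: cvgM; apply: cvgD; [exact: E|exact: cvg_cst|exact: E|exact: cvg_cst].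
  - by apply: cvgM; apply: cvgD; [exact: E|exact: cvg_cst|exact: E|exact: cvg_cst].
have mgS N : Cmeas a b (fun x => g x - psum c N x).
  by apply: CmeasD => //; apply: CmeasN; exact/inL2_meas/inL2_psum.
have fat N : (\int[mu]_(x in D) (sq (g x - psum c N x))%:E <= (L * (S - s N))%:E)%E.
  have LS k : inL2 a b (fun x => psum c (f k) x - psum c N x).
    by apply: inL2B; exact: inL2_psum.
  have mS k : measurable_fun D (fun x => (sq (psum c (f k) x - psum c N x))%:E).
    by apply/measurable_EFinP; exact: (Cmeas_sq (inL2_meas (LS k))).
  have -> : (\int[mu]_(x in D) (sq (g x - psum c N x))%:E =
     \int[mu]_(x in D) limn_einf (fun k => (sq (psum c (f k) x - psum c N x))%:E))%E.
    apply: ae_eq_integral => //.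
    - by apply/measurable_EFinP; exact: (Cmeas_sq (mgS N)).
    - rewrite /limn_einf; apply: measurableT_comp => //.
      apply: (@measurable_fun_limn_esup _ _ _ _
        (fun k x => - (sq (psum c (f k) x - psum c N x))%:E)%E) => k.
      by apply: measurableT_comp => //; exact: mS.
    - apply: aeS g_lim => x /[apply] /(_ N) h.
      by have [-> _] := limn_EFin h.
  have /le_trans := fatou mu (measurable_itv _) mS (fun k x _ => sq_ge0 _).
  apply.
  have E k : (\int[mu]_(x in D) (sq (psum c (f k) x - psum c N x))%:E =
              (L * `|s (f k) - s N|)%:E)%E.
    by rewrite (EFin_rint (inL2_int (LS k))) -nsq_psumB.
  rewrite (_ : (fun k => _) = (fun k => (L * `|s (f k) - s N|)%:E)); last exact/funext.
  have sf : s (f k) @[k --> \oo] --> S.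
    apply/cvgrPdist_lt => e e0.
    have h2 : ((2 : R)^-1) ^+ k ^+ 2 @[k --> \oo] --> (0 : R).
      rewrite (_ : (fun k => _) = (fun k => ((2^-1) ^+ 2) ^+ k)); last first.
        by apply/funext => k; rewrite exprAC.
      by apply: cvg_expr; rewrite ger0_norm ?sqr_ge0 // exprVn invf_lt1 ?ltr1n // -natrX ltr1n.
    have /cvgrPdist_lt/(_ e e0) := h2; apply: filterS => k.
    rewrite sub0r normrN ger0_norm ?sqr_ge0 // => /(lt_trans (fP k)).
    by rewrite ger0_norm ?subr_ge0.
  have lim : (L * `|s (f k) - s N|) @[k --> \oo] --> L * `|S - s N|.
    by apply: cvgMr; apply: cvg_norm; apply: cvgB => //; exact: cvg_cst.
  by have [-> _] := limn_EFin lim; rewrite ger0_norm ?subr_ge0.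
have igS N : inL2 a b (fun x => g x - psum c N x).
  apply/inL2P; split=> //; apply/integrableP; split.
    by apply/measurable_EFinP; exact: (Cmeas_sq (mgS N)).
  apply: le_lt_trans (ltry (L * (S - s N))); apply: le_trans (fat N).
  rewrite le_eqVlt; apply/orP; left; apply/eqP; apply: eq_integral => x _ /=.
  by rewrite ger0_norm ?sq_ge0.
have Lg : inL2 a b g.
  have := inL2D (igS 0%N) (inL2_psum a b c 0); congr (inL2 _ _ _).
  by apply/funext => x; rewrite subrK.
have nle N : nsq a b (fun x => g x - psum c N x) <= L * (S - s N).
  by rewrite -lee_fin -EFin_rint //; exact: inL2_int.
have n0 : nsq a b (fun x => g x - psum c N x) @[N --> \oo] --> (0 : R).
  apply: (@squeeze_cvgr _ _ _ _ (fun=> 0) (fun N => L * (S - s N))).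
  - by apply: nearW => N; rewrite nsq_ge0 nle.
  - exact: cvg_cst.
  - have -> : (0 : R) = L * (S - S) by rewrite subrr mulr0.
    by apply: cvgMr; apply: cvgB => //; exact: cvg_cst.
exists g; split=> // l.
exact: fcoef_lim.
Qed.

End RieszFischer.

(** * Primitives of integrable functions *)

Section Primitive.
Context {R : realType} (a b : R) (hab : a < b).
Implicit Types (f e : R -> R).
Local Notation mu := (@lebesgue_measure R).
Local Notation D := (`]a, b[%classic : set R).
Local Notation L := (b - a).

Definition prim f (x : R) : R := \int[mu]_(t in `[a, x]) (f \_ D) t.

Lemma rint_patch f : mu.-integrable D (EFin \o f) -> mu.-integrable setT (EFin \o (f \_ D)).
Proof. by move=> fi; rewrite -restrict_EFin; exact: (integrable_mkcond _ _).1. Qed.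

Lemma rint_patchS f (A : set R) : measurable A -> mu.-integrable D (EFin \o f) ->
  mu.-integrable A (EFin \o (f \_ D)).
Proof. by move=> mA /rint_patch; apply: integrableS. Qed.

Lemma prim_a f : prim f a = 0.
Proof. by rewrite /prim set_itv1 Rintegral_set1. Qed.

Lemma prim_b f : mu.-integrable D (EFin \o f) -> prim f b = \int[mu]_(x in D) f x.
Proof.
move=> fi; rewrite /prim -(Rintegral_itv_bndo_bndc (rint_patchS _ fi)) //.
rewrite -(Rintegral_itv_obnd_cbnd (rint_patchS _ fi)) //.
by apply: eq_Rintegral => x xD; rewrite patchE xD.
Qed.

Lemma primB f x y : mu.-integrable D (EFin \o f) -> a <= x -> x <= y ->
  prim f y - prim f x = \int[mu]_(t in `]x, y]) (f \_ D) t.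
Proof.
move=> fi ax xy; apply: Rintegral_itvB; rewrite ?bnd_simp //.
exact: rint_patchS.
Qed.

Lemma continuous_prim f : mu.-integrable D (EFin \o f) -> {within `[a, b], continuous (prim f)}.
Proof.
move=> fi; apply: parameterized_integral_continuous; first exact: ltW.
exact: rint_patchS.
Qed.

Lemma measurable_prim f : mu.-integrable D (EFin \o f) -> measurable_fun D (prim f).
Proof.
move=> fi; apply: (@measurable_funS _ _ _ _ `[a, b]) => //; first exact: subset_itv_oo_cc.
by apply: subspace_continuous_measurable_fun => //; exact: continuous_prim.
Qed.

Lemma prim_bounded f x : mu.-integrable D (EFin \o f) -> `|prim f x| <= \int[mu]_(t in D) `|f t|.
Proof.
move=> fi; rewrite /prim; apply: le_trans (le_normr_Rintegral _ (rint_patchS _ fi)) _ => //.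
have -> : \int[mu]_(t in D) `|f t| = \int[mu]_t `|(f \_ D) t|.
  rewrite Rintegral_mkcond; apply: eq_Rintegral => t _; rewrite !patchE.
  by case: ifP => //; rewrite normr0.
rewrite /Rintegral fine_le //.
- by apply: integrable_fin_num => //; apply: integrable_norm; exact: rint_patchS.
- by apply: integrable_fin_num => //; apply: integrable_norm; exact: rint_patchS.
- apply: ge0_subset_integral => //.
  by have /integrableP[] := integrable_norm (rint_patch fi).
Qed.

Lemma prim_lipschitz f (K : R) x y : mu.-integrable D (EFin \o f) -> 0 <= K ->
  (forall t, a < t < b -> `|f t| <= K) -> a <= x -> x <= y ->
  `|prim f y - prim f x| <= K * (y - x).
Proof.
move=> fi K0 fK ax xy; rewrite primB //.
apply: le_trans (le_normr_Rintegral _ (rint_patchS _ fi)) _ => //.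
have -> : K * (y - x) = \int[mu]_(t in `]x, y]) K.
  have -> : y - x = fine (mu `]x, y]).
    rewrite lebesgue_measure_itv /= lte_fin.
    by move: xy; rewrite le_eqVlt => /predU1P[->|->] //; rewrite ltxx subrr.
  by rewrite Rintegral_cst.
apply: le_Rintegral => //.
- by apply: integrable_norm; exact: rint_patchS.
- apply: measurable_bounded_integrable => //; last exact: bounded_cst.
  have : (mu `]x, y] < +oo)%E; last by [].
  by rewrite lebesgue_measure_itv /=; case: ifP => _; rewrite ?ltry ?ltey.
- move=> t _; rewrite patchE; case: ifP => [|_]; last by rewrite normr0.
  by rewrite inE /= in_itv /=; exact: fK.
Qed.

(** By Lebesgue differentiation, almost everywhere [f] is the derivative of its
    primitive. *)
Lemma prim_cst_ae0 f (k : R) : mu.-integrable D (EFin \o f) ->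
  (forall x, a < x < b -> prim f x = k) -> {ae mu, forall x, D x -> f x = 0}.
Proof.
move=> fi hk.
have loc : locally_integrable [set: R] (f \_ D) by exact: integrable_locally.
have := @FTC1 _ (f \_ D) (BLeft a) (fun y => rint_patchS (measurable_itv _) fi) loc.
apply: aeS => x h Dx; move: (Dx); rewrite /= in_itv /= => /andP[ax xb].
have {h} [_] := h ax.
rewrite patchE mem_set // => <-.
rewrite derive1E -/(prim f) (@near_eq_derive _ _ _ (prim f) (cst k)) ?derive_cst //.
have : \forall y \near x, y \in `]a, b[ by exact: near_in_itvoo.
apply: filterS => y; rewrite in_itv /= => /hk; exact.
Qed.

Lemma continuous_bounded (g : R -> R) : {within `[a, b], continuous g} ->
  exists2 K : R, 0 <= K & forall x, a <= x <= b -> `|g x| <= K.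
Proof.
move=> cg.
have cn : {within `[a, b], continuous (fun x => `|g x|)}.
  by move=> x; apply: continuous_comp; [exact: cg|exact: norm_continuous].
have [c _ hc] := EVT_max (ltW hab) cn.
by exists `|g c| => // x xab; apply: hc; rewrite in_itv.
Qed.

(** The primitive need not be differentiable everywhere, so the formula comes
    from Fubini on the triangle below the diagonal. *)
Lemma prim_by_parts f e (de : R -> R) : mu.-integrable D (EFin \o f) ->
  (forall x : R, is_derive x 1 e (de x)) -> continuous de ->
  \int[mu]_(y in D) (prim f y * de y) = prim f b * e b - \int[mu]_(x in D) (f x * e x).
Proof.
move=> fi de_e cde.
have ce : continuous e.
  by move=> x; apply/differentiable_continuous/derivable1_diffP; case: (de_e x).
have [K K0 hK] := continuous_bounded (continuous_subspaceT cde).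
have [K' K'0 hK'] := continuous_bounded (continuous_subspaceT ce).
have inD x : D x -> a <= x <= b by rewrite /= in_itv /= => /andP[/ltW -> /ltW ->].
pose k (x y : R) : R := (de \_ D) y * (x <= y)%R%:R.
pose h (z : R * R) : R := (f \_ D) z.1 * k z.1 z.2.
have mde : measurable_fun setT (de \_ D).
  apply: (measurable_restrictT _ _).1 => //; apply: measurable_funTS.
  exact: continuous_measurable_fun.
have mf : measurable_fun setT (f \_ D).
  by have /integrableP[/measurable_EFinP] := rint_patch fi.
have mb : measurable_fun setT (fun c : bool => c%:R : R) by [].
have mh : measurable_fun setT h.
  apply: measurable_funM; first exact: (measurableT_comp mf).
  apply: measurable_funM; first exact: (measurableT_comp mde).
  by apply: (measurableT_comp mb); exact: measurable_fun_ler.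
have mk x : measurable_fun setT (k x).
  apply: measurable_funM => //; apply: (measurableT_comp mb).
  exact: measurable_fun_ler.
have kE x : k x = (fun y => de y * (x <= y)%R%:R) \_ D.
  by apply/funext => y; rewrite /k !patchE; case: ifP => //; rewrite mul0r.
have bk x y : `|k x y| <= K.
  rewrite /k patchE; case: ifP => [yD|_]; last by rewrite mul0r normr0.
  rewrite normrM -[leRHS]mulr1 ler_pM // ?hK //; first exact/inD/set_mem.
  by case: (x <= y); rewrite ?normr1 ?normr0.
have ik x : mu.-integrable setT (EFin \o k x).
  rewrite kE; apply: rint_patch.
  apply: (rint_dom _ (integrable_cstD a b K)) => [|y yab].
    apply: measurable_funTS; apply: measurable_funM; first exact: continuous_measurable_fun.
    by apply: (measurableT_comp mb); exact: measurable_fun_ler.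
  have yD : y \in D by rewrite inE /= in_itv.
  by have := bk x y; rewrite kE patchE yD.
have muD : mu D = L%:E by rewrite lebesgue_measure_itv /= lte_fin hab.
have ih : (mu \x mu)%E.-integrable setT (EFin \o h).
  apply/integrable12ltyP; first exact/measurable_EFinP.
  apply: (@le_lt_trans _ _ (\int[mu]_x ((K * L) * `|(f \_ D) x|)%:E)%E); last first.
    exact: (integrable_lty _ (integrableZl _ (K * L) (integrable_norm (rint_patch fi)))).
  have int_k x : (\int[mu]_y `|(h (x, y))%:E| <= ((K * L) * `|(f \_ D) x|)%:E)%E.
    have -> : ((K * L) * `|(f \_ D) x|)%:E = (\int[mu]_(y in D) (K * `|(f \_ D) x|)%:E)%E.
      by rewrite integral_cst //= muD -EFinM; congr (_%:E); ring.
    rewrite [leRHS]integral_mkcond; apply: ge0_le_integral => //.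
    - apply/measurable_EFinP; apply: measurableT_comp => //.
      exact: (measurable_funM (measurable_cst ((f \_ D) x)) (mk x)).
    - by apply: (measurable_restrictT _ _).1 => //; exact: measurable_cst.
    - move=> y _; rewrite [leRHS]patchE /h /=; case: ifPn => yD.
        by rewrite lee_fin normrM mulrC ler_wpM2r.
      by rewrite kE [_ y]patchE (negbTE yD) mulr0 normr0.
  apply: ge0_le_integral => //.
  - by move=> x _; apply: integral_ge0.
  - apply: (@measurable_fun_fubini_tonelli_F _ _ _ _ _ mu (fun z => `|(h z)%:E|)%E).
      by apply/measurable_EFinP; apply: measurableT_comp.
    by [].
  - apply/measurable_EFinP; apply: measurable_funM => //; exact: measurableT_comp.
  - by move=> x _; exact: int_k.
have := Fubini ih.
have q x : D x -> \int[mu]_y k x y = e b - e x.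
  rewrite /= in_itv /= => /andP[ax xb].
  have io : mu.-integrable `]x, b[ (EFin \o de).
    apply: (@integrableS _ _ _ mu `[x, b]) => //; first exact: subset_itv_oo_cc.
    apply: continuous_compact_integrable; first exact: segment_compact.
    exact: continuous_subspaceT.
  rewrite -(ftc2 xb de_e cde) (Rintegral_itv_obnd_cbnd io) [RHS]Rintegral_mkcond.
  apply: eq_Rintegral => y _; rewrite kE !patchE.
  have -> : (y \in D) = (a < y < b) by apply/idP/idP; rewrite inE /= in_itv.
  have -> : (y \in `[x, b[%classic) = (x <= y < b) by apply/idP/idP; rewrite inE /= in_itv.
  have [xy|yx] := leP x y; last by rewrite mulr0 if_same.
  by rewrite (lt_le_trans ax xy) /= mulr1.
have ife : mu.-integrable D (EFin \o (fun x => f x * e x)).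
  apply: (rint_dom _ (rintZ K' (integrable_norm fi))) => [|x /andP[xa xb]].
    apply: measurable_funM; last by apply: measurable_funTS; exact: continuous_measurable_fun.
    by have /integrableP[/measurable_EFinP] := fi.
  by rewrite normrM mulrC ler_wpM2r // hK' // !ltW.
have ifeb := rintZ (e b) fi.
have -> : (\int[mu]_x \int[mu]_y (EFin \o h) (x, y))%E =
   (\int[mu]_(x in D) (e b * f x - f x * e x))%:E.
  have E x : (\int[mu]_y (EFin \o h) (x, y))%E = ((f \_ D) x * \int[mu]_y k x y)%:E.
    rewrite EFinM fineK; last by apply: integrable_fin_num (ik x).
    by rewrite -integralZl //; exact: ik.
  rewrite -EFin_rint; last exact: rintB.
  rewrite [RHS]integral_mkcond; apply: eq_integral => x _.
  rewrite E !patchE; case: ifP => xD; last by rewrite mul0r.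
  by rewrite q; [congr (_%:E); ring|exact/set_mem].
have -> : (\int[mu]_y \int[mu]_x (EFin \o h) (x, y))%E =
   (\int[mu]_(y in D) (prim f y * de y))%:E.
  have E y : (\int[mu]_x (EFin \o h) (x, y))%E = ((de \_ D) y * prim f y)%:E.
    have ip : mu.-integrable setT (EFin \o ((f \_ D) \_ `[a, y])).
      by rewrite -restrict_EFin; apply: (integrable_mkcond _ _).1 => //; exact: rint_patchS.
    rewrite EFinM /prim Rintegral_mkcond fineK; last exact: (integrable_fin_num _ ip).
    rewrite -integralZl //.
    apply: eq_integral => x _; rewrite /h /k /= -EFinM; congr (_%:E).
    rewrite mulrCA; congr (_ * _); rewrite [RHS]patchE.
    have -> : (x \in `[a, y]%classic) = (a <= x <= y) by apply/idP/idP; rewrite inE /= in_itv.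
    have [xy|yx] := leP x y; last by rewrite andbF mulr0.
    rewrite andbT mulr1; case: ifPn => //; rewrite -ltNge => xa.
    by rewrite patchE ifF //; apply/negP; rewrite inE /= in_itv /= => /andP[/(lt_trans xa)]; rewrite ltxx.
  rewrite -EFin_rint; last first.
    have [K'' K''0 hK''] := continuous_bounded (continuous_prim fi).
    apply: (rint_dom _ (integrable_cstD a b (K'' * K))) => [|y /andP[ya yb]].
      apply: measurable_funM; first exact: measurable_prim.
      by apply: measurable_funTS; exact: continuous_measurable_fun.
    by rewrite normrM ler_pM // ?hK'' ?hK // !ltW.
  rewrite [RHS]integral_mkcond; apply: eq_integral => y _.
  by rewrite E !patchE; case: ifP => yD; rewrite ?mul0r // mulrC.
move=> [<-].
by rewrite prim_b // RintegralB // RintegralZl // mulrC.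
Qed.

End Primitive.

Arguments prim : simpl never.

Lemma Re_cis {R : realType} (t : R) : Re (cis t) = cos t. Proof. by []. Qed.
Lemma Im_cis {R : realType} (t : R) : Im (cis t) = sin t. Proof. by []. Qed.

Opaque Cintegral cis cexp.

(** * Completeness of the trigonometric system *)

Section Completeness.
Context {R : realType} (a b : R) (hab : a < b).
Implicit Types (u v g r : R -> R[i]).
Local Notation mu := (@lebesgue_measure R).
Local Notation D := (`]a, b[%classic : set R).
Local Notation L := (b - a).
Local Notation E := (E a b).

Let L0 : 0 < L. Proof. by rewrite subr_gt0. Qed.

Lemma ae_Rintegral (f g : R -> R) (A : set R) : measurable A ->
  measurable_fun A f -> measurable_fun A g ->
  {ae mu, forall x, A x -> f x = g x} -> \int[mu]_(x in A) f x = \int[mu]_(x in A) g x.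
Proof.
move=> mA mf mg fg; congr fine; apply: ae_eq_integral => //.
- exact/measurable_EFinP.
- exact/measurable_EFinP.
- by apply: aeS fg => x h /h ->.
Qed.

Lemma ae_inD (P : R -> Prop) : {ae mu, forall x, x \in `]a, b[ -> P x} <->
  {ae mu, forall x, D x -> P x}.
Proof. by split; apply: aeS. Qed.

(** The primitive vanishes identically, and it is differentiable with derivative
    [h] at every interior point by continuity; the end points follow by limits. *)
Lemma ae0_continuous (h : R -> R) : {within `[a, b], continuous h} ->
  {ae mu, forall x, D x -> h x = 0} -> forall x, a <= x <= b -> h x = 0.
Proof.
move=> ch h0.
have [cD ca cb] := (continuous_within_itvP h hab).1 ch.
have hi : mu.-integrable D (EFin \o h).
  apply: (@integrableS _ _ _ mu `[a, b]) => //; first exact: subset_itv_oo_cc.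
  by apply: continuous_compact_integrable => //; exact: segment_compact.
have p0 x : prim a b h x = 0.
  transitivity (\int[mu]_(t in `[a, x]) (0 : R)); last by rewrite Rintegral_cst ?mul0r.
  apply: ae_Rintegral => //.
    apply: measurable_funTS; apply: (measurable_restrictT _ _).1 => //.
    by have /integrableP[/measurable_EFinP] := hi.
  by apply: aeS h0 => t ht _; rewrite patchE; case: ifP => // /set_mem /ht.
have hD x : a < x < b -> h x = 0.
  move=> /andP[ax xb].
  have xin : x \in `]a, b[ by rewrite in_itv /= ax.
  have cx : {for x, continuous (h \_ D)}.
    have near_eq : \forall y \near x, h y = (h \_ D) y.
      have := near_in_itvoo xin; apply: filterS => y yin.
      by rewrite patchE mem_set.
    rewrite /prop_for /continuous_at patchE mem_set //.
    by apply: cvg_trans (cD _ xin); apply: near_eq_cvg.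
  have [_] := continuous_FTC1 (f := h \_ D) (a := BLeft a) xb (rint_patchS (measurable_itv _) hi) ax cx.
  rewrite patchE mem_set // => <-.
  by rewrite (_ : (fun x => _) = cst 0) ?derive1_cst //; apply/funext => y; exact: p0.
move=> x /andP[]; rewrite le_eqVlt => /predU1P[<- _|ax].
  apply: (cvg_unique _ ca) => //; apply: cvg_near_cst; near=> y.
  by apply: hD; apply/andP; split.
rewrite le_eqVlt => /predU1P[->|xb]; last by apply: hD; rewrite ax.
apply: (cvg_unique _ cb) => //; apply: cvg_near_cst; near=> y.
by apply: hD; apply/andP; split.
Unshelve. all: by end_near. Qed.

Definition cprim u (x : R) : R[i] :=
  Complex (prim a b (fun x => Re (u x)) x) (prim a b (fun x => Im (u x)) x).

Lemma cprim_a u : cprim u a = 0.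
Proof. by apply: cext; rewrite /= prim_a. Qed.

Lemma Cmeas_cprim u : Cint a b u -> Cmeas a b (cprim u).
Proof. by move=> [ru iu]; split => /=; exact: measurable_prim. Qed.

Lemma cprim_bounded u : Cint a b u -> exists K, forall x, sq (cprim u x) <= K.
Proof.
move=> [ru iu].
exists ((\int[mu]_(t in D) `|Re (u t)|) ^+ 2 + (\int[mu]_(t in D) `|Im (u t)|) ^+ 2) => x.
rewrite /sq /= -(real_normK (num_real (prim _ _ _ _))) -[X in _ + X](real_normK (num_real (prim _ _ _ _))).
by apply: lerD; rewrite ler_sqr ?nnegrE // ?Rintegral_ge0 // prim_bounded.
Qed.

Lemma Cint_cprim u : Cint a b u -> Cint a b (cprim u).
Proof.
move=> iu; have [K hK] := cprim_bounded iu.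
by apply: (Cint_bounded (Cmeas_cprim iu)) => x _; exact: hK.
Qed.

Lemma cprim_by_parts u (e de : R -> R[i]) : Cint a b u ->
  (forall x : R, is_derive x 1 (fun x => Re (e x)) (Re (de x))) ->
  (forall x : R, is_derive x 1 (fun x => Im (e x)) (Im (de x))) ->
  continuous (fun x => Re (de x)) -> continuous (fun x => Im (de x)) ->
  Cintegral a b (fun x => cprim u x * de x) =
  cprim u b * e b - Cintegral a b (fun x => u x * e x).
Proof.
move=> iu dr di cr ci; have [ru iiu] := iu.
have contin (h dh : R -> R) : (forall x : R, is_derive x 1 h (dh x)) -> continuous h.
  by move=> dh_ x; apply/differentiable_continuous/derivable1_diffP; case: (dh_ x).
have bnd (h f : R -> R) : continuous h -> mu.-integrable D (EFin \o f) ->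
    mu.-integrable D (EFin \o (fun x => f x * h x)).
  move=> ch fi; have [K K0 hK] := continuous_bounded hab (continuous_subspaceT ch).
  apply: (rint_dom _ (rintZ K (integrable_norm fi))) => [|x /andP[xa xb]].
    apply: measurable_funM; last by apply: measurable_funTS; exact: continuous_measurable_fun.
    by have /integrableP[/measurable_EFinP] := fi.
  by rewrite normrM mulrC ler_wpM2r // hK // !ltW.
have [rp ip] := Cint_cprim iu.
have cer := contin _ _ dr; have cei := contin _ _ di.
apply: cext.
- rewrite ReD ReN ReM [LHS]ReI [X in _ - X]ReI; transitivity (\int[mu]_(x in D) (prim a b (fun x => Re (u x)) x * Re (de x) -
     prim a b (fun x => Im (u x)) x * Im (de x))).
    by apply: eq_Rintegral => x _; rewrite ReM.
  rewrite RintegralB //; [|exact: bnd..].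
  rewrite (prim_by_parts hab ru dr cr) (prim_by_parts hab iiu di ci).
  have -> : \int[mu]_(x in D) Re (u x * e x) =
    \int[mu]_(x in D) (Re (u x) * Re (e x)) - \int[mu]_(x in D) (Im (u x) * Im (e x)).
    rewrite -RintegralB //; [|exact: bnd..].
    by apply: eq_Rintegral => x _; rewrite ReM.
  by rewrite /cprim /=; ring.
- rewrite ImD ImN ImM [LHS]ImI [X in _ - X]ImI; transitivity (\int[mu]_(x in D) (prim a b (fun x => Re (u x)) x * Im (de x) +
     prim a b (fun x => Im (u x)) x * Re (de x))).
    by apply: eq_Rintegral => x _; rewrite ImM.
  rewrite RintegralD //; [|exact: bnd..].
  rewrite (prim_by_parts hab ru di ci) (prim_by_parts hab iiu dr cr).
  have -> : \int[mu]_(x in D) Im (u x * e x) =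
    \int[mu]_(x in D) (Re (u x) * Im (e x)) + \int[mu]_(x in D) (Im (u x) * Re (e x)).
    rewrite -RintegralD //; [|exact: bnd..].
    by apply: eq_Rintegral => x _; rewrite ImM.
  by rewrite /cprim /=; ring.
Qed.

(** Integration by parts; the boundary term is the mean value of [u]. *)
Lemma fcoef_cprim u l : Cint a b u ->
  'i%C * (freq a b l)%:C%C * fcoef a b (cprim u) l =
  fcoef a b u l - (L^-1)%:C%C * cprim u b.
Proof.
move=> iu; set m := freq a b l.
have ic := Cint_cprim iu.
have dr (x : R) : is_derive x 1 (fun x => Re (conjc (E l x)))
    (Re (- ('i%C * m%:C%C) * conjc (E l x))).
  rewrite (_ : Re _ = - m * Im (E l x)); last by case: (E l x) => ? ? /=; ring.
  rewrite (_ : (fun x => _) = (fun x => Re (E l x))); first exact: is_derive_ReE.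
  by apply/funext => y; rewrite ReJ.
have di (x : R) : is_derive x 1 (fun x => Im (conjc (E l x)))
    (Im (- ('i%C * m%:C%C) * conjc (E l x))).
  rewrite (_ : Im _ = - (m * Re (E l x))); last by case: (E l x) => ? ? /=; ring.
  rewrite (_ : (fun x => _) = (fun x => - Im (E l x))).
    by have := is_deriveN (is_derive_ImE a b l x); exact.
  by apply/funext => y; rewrite ImJ.
have cr : continuous (fun x => Re (- ('i%C * m%:C%C) * conjc (E l x))).
  rewrite (_ : (fun x => _) = (fun x => (- m) * Im (E l x))).
    by move=> x; apply: cvgMr; exact: continuous_ImE.
  by apply/funext => x; case: (E l x) => ? ? /=; ring.
have ci : continuous (fun x => Im (- ('i%C * m%:C%C) * conjc (E l x))).
  rewrite (_ : (fun x => _) = (fun x => (- m) * Re (E l x))).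
    by move=> x; apply: cvgMr; exact: continuous_ReE.
  by apply/funext => x; case: (E l x) => ? ? /=; ring.
have := cprim_by_parts iu dr di cr ci.
rewrite (_ : (fun x => _) = (fun x => - ('i%C * m%:C%C) * (cprim u x * conjc (E l x)))); last first.
  by apply/funext => x; rewrite mulrCA.
rewrite CintegralZ; last exact: Cint_mulEJ.
have -> : conjc (E l b) = 1 by rewrite E_b //; apply: cext => /=; ring.
rewrite mulr1 => h; rewrite !fcoefE.
move: h; move: (Cintegral _ _ _) (Cintegral _ _ _) (cprim u b) (_%:C)%C => A B F k h.
rewrite mulrCA -[_ * B]opprK -mulNr h; move: (_%:C)%C => *; ring.
Qed.

(** Removing the mean of the primitive makes its coefficients vanish whenever
    those of [r] do, so that integrating twice turns an integrable function with zero
    coefficients into a Lipschitz one. *)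
Definition cprim0 r (x : R) : R[i] := cprim r x - fcoef a b (cprim r) 0.

Lemma fcoef_cst (z : R[i]) l : fcoef a b (fun=> z) l = if 0 == l then z else 0.
Proof.
rewrite (@eq_fcoef _ _ _ _ (fun x => z * E 0 x)) => [|x _]; last by rewrite E_0 mulr1.
rewrite fcoefZ ?fcoef_E //; last exact/inL2_Cint/inL2_E.
by case: ifP; rewrite ?mulr1 ?mulr0.
Qed.

Lemma cprim_b0 r : Cint a b r -> fcoef a b r 0 = 0 -> cprim r b = 0.
Proof.
move=> ir r0; have := fcoef_cprim 0 ir.
rewrite freq0 mulr0 mul0r r0 sub0r => /eqP; rewrite eq_sym oppr_eq0 mulf_eq0.
case/orP => /eqP // h; have := congr1 (@complex.Re R) h => /= /eqP.
by rewrite invr_eq0 gt_eqF.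
Qed.

Lemma Cint_cprim0 r : Cint a b r -> Cint a b (cprim0 r).
Proof. by move=> ir; apply: CintB; [exact: Cint_cprim|exact/inL2_Cint/inL2_cst]. Qed.

Lemma fcoef_cprim0 r : Cint a b r -> (forall l, fcoef a b r l = 0) ->
  forall l, fcoef a b (cprim0 r) l = 0.
Proof.
move=> ir r0 l.
rewrite fcoefB; [|exact: Cint_cprim|exact/inL2_Cint/inL2_cst].
rewrite fcoef_cst; case: eqP => [<-|/eqP l0]; first by rewrite subrr.
rewrite subr0; have := fcoef_cprim l ir.
rewrite r0 cprim_b0 // mulr0 subrr => /eqP; rewrite mulf_eq0 => /orP[|/eqP //].
rewrite mulf_eq0 => /orP[] /eqP h.
  by have := congr1 (@complex.Im R) h => /= /eqP; rewrite oner_eq0.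
have := congr1 (@complex.Re R) h => /= /eqP; rewrite (negbTE (freq_neq0 hab _)) //.
by rewrite eq_sym.
Qed.

Lemma ssum_step N (A B : R) : ssum N (fun l : int => if (0 <= l)%R then A else B) =
  N.+1%:R * A + N%:R * B.
Proof.
elim: N => [|N IH]; first by rewrite ssum0 lexx mul1r mul0r addr0.
by rewrite ssum_recr IH /= -(natr1 N.+1) -(natr1 N); ring.
Qed.

(** Invariance under the shift fails to connect -1 and 0 only. *)
Lemma int_step (F : int -> R) (l : int) : (forall l, l != 0 -> F (l - 1) = F l) ->
  F l = if (0 <= l)%R then F 0 else F (-1).
Proof.
move=> h.
have pos (n : nat) : F n%:Z = F 0.
  by elim: n => // n IH; rewrite -h // -IH; congr F; lia.
have neg (n : nat) : F (- n.+1%:Z) = F (-1).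
  by elim: n => // n IH; rewrite -IH -[in RHS]h //; congr F; lia.
case: (leP 0 l) => l0; first by rewrite -(pos `|l|%N); congr F; lia.
by rewrite -(neg `|l|.-1%N); congr F; lia.
Qed.

(** sin y = y cos c with 0 < c < y, and the cosine decreases. *)
Lemma sin_ge_cos (y : R) : 0 <= y <= pi / 2 -> y * cos y <= sin y.
Proof.
move=> /andP[]; rewrite le_eqVlt => /predU1P[<- _|y0 yp]; first by rewrite mul0r sin0.
have ds (x : R) : x \in `]0, y[ -> is_derive x 1 sin (cos x) by move=> _; exact: is_derive_sin.
have [c] := MVT y0 ds (continuous_subspaceT (@continuous_sin R)).
rewrite sin0 !subr0 => /itvP cy ->; rewrite mulrC ler_pM2r //.
have p0 := pi_gt0 R.
rewrite ltW // ltr_cos ?cy // in_itv /= ?cy ?(ltW y0) /=; last by lra.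
by have := cy; rewrite (ltW (lt_le_trans _ (_ : y <= pi))) ?cy //; lra.
Qed.

(** The chord is 2 |sin((s - t) / 2)|; it is comparable with the arc as long as
    the arc stays away from a full turn. *)
Lemma cis_sep (m : R) : 0 <= m < pi -> exists2 k : R, 0 < k &
  forall s t, `|s - t| <= 2 * m -> k * (s - t) ^+ 2 <= sq (cis s - cis t).
Proof.
move=> /andP[m0 mp]; have p0 := pi_gt0 R.
set c := cos (m / 2).
have c0 : 0 < c by apply: cos_gt0_pihalf; apply/andP; split; lra.
exists (c ^+ 4) => [|s t h]; first by rewrite exprn_gt0.
pose th := `|s - t| / 2.
have th0 : 0 <= th by rewrite divr_ge0.
have thm : th <= m by rewrite /th; lra.
have -> : sq (cis s - cis t) = 4 * sin th ^+ 2.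
  have -> : sq (cis s - cis t) = 2 - 2 * cos (s - t).
    rewrite /sq !(ReD, ReN, ImD, ImN, Re_cis, Im_cis) cosB.
    have := @cos2Dsin2 R s; have := @cos2Dsin2 R t; nra.
  have -> : cos (s - t) = cos (th *+ 2).
    rewrite -mulr_natr /th divfK ?pnatr_eq0 //.
    by have [h0|h0] := leP 0 (s - t); [rewrite ger0_norm|rewrite ltr0_norm // cosN].
  by rewrite cos_mulr2n; have := @cos2Dsin2 R th; rewrite -mulr_natl; nra.
have -> : (s - t) ^+ 2 = 4 * th ^+ 2.
  by rewrite /th exprMn -normrX ger0_norm ?sqr_ge0 // exprVn; field.
have half : sin th = 2 * (sin (th / 2) * cos (th / 2)).
  have {1}-> : th = (th / 2) *+ 2 by rewrite -mulr_natr divfK ?pnatr_eq0.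
  by rewrite sin_mulr2n -mulr_natl mulrC [cos _ * _]mulrC mulrC.
have cc : c <= cos (th / 2).
  have : th / 2 <= m / 2 by lra.
  rewrite le_eqVlt => /predU1P[->//|lt]; rewrite ltW // ltr_cos // in_itv /=; apply/andP; split; lra.
have s0 : th / 2 * cos (th / 2) <= sin (th / 2).
  by apply: sin_ge_cos; apply/andP; split; lra.
have : th * c ^+ 2 <= sin th.
  rewrite half; apply: (@le_trans _ _ (2 * (th / 2 * cos (th / 2) * cos (th / 2)))).
    have -> : 2 * (th / 2 * cos (th / 2) * cos (th / 2)) = th * cos (th / 2) ^+ 2 by field.
    by rewrite ler_wpM2l // ler_sqr // nnegrE ltW // (lt_le_trans c0 cc).
  by rewrite ler_pM2l // ler_wpM2r // ltW // (lt_le_trans c0 cc).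
move=> h1; rewrite mulrCA ler_pM2l //.
have -> : c ^+ 4 * th ^+ 2 = (th * c ^+ 2) ^+ 2 by ring.
have h2 : 0 <= th * c ^+ 2 by rewrite mulr_ge0 ?sqr_ge0.
by rewrite ler_sqr // nnegrE // (le_trans h2).
Qed.

(** Chernoff's argument. Dividing [Q - Q x0] by [E 1 - E 1 x0] gives a bounded
    function [g], whose coefficients satisfy a recursion of ratio of modulus 1 away from 0:
    their modulus is constant on each side of 0, hence zero by Bessel. The recursion at
    l = 0 then reads off Q x0 = 0. *)
Lemma lipschitz_fcoef0 (Q : R -> R[i]) (K : R) : Cmeas a b Q ->
  (forall x y, a < x < b -> a < y < b -> sq (Q x - Q y) <= K * (x - y) ^+ 2) ->
  (forall l, fcoef a b Q l = 0) -> forall x, a < x < b -> Q x = 0.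
Proof.
move=> mQ lipQ Q0 x0 x0D; have [ax0 x0b] := andP x0D.
pose w x := E 1 x - E 1 x0.
pose g x := (Q x - Q x0) * (conjc (w x) * ((sq (w x)) `^ (-1))%:C%C).
have m1 : freq a b 1 = 2 * pi / L by rewrite /freq mulr1.
pose M := Num.max (x0 - a) (b - x0).
have M0 : 0 < M by rewrite lt_max subr_gt0 ax0.
have ML : M < L by rewrite gt_max; apply/andP; split; lra.
have p0 := pi_gt0 R.
have mM : 0 <= pi * M / L < pi.
  by rewrite divr_ge0 ?mulr_ge0 ?ltW //= ltr_pdivrMr // ltr_pM2l.
have [k k0 hk] := cis_sep mM.
have w_low x : a < x < b -> k * (freq a b 1 * (x - x0)) ^+ 2 <= sq (w x).
  move=> /andP[ax xb]; have -> : freq a b 1 * (x - x0) = freq a b 1 * (x - a) - freq a b 1 * (x0 - a) by ring.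
  apply: hk; have -> : freq a b 1 * (x - a) - freq a b 1 * (x0 - a) = freq a b 1 * (x - x0) by ring.
  have c0 : 0 < 2 * pi / L by rewrite divr_gt0 ?mulr_gt0.
  rewrite m1 normrM (gtr0_norm c0).
  have -> : 2 * (pi * M / L) = 2 * pi / L * M by ring.
  rewrite ler_pM2l // /M.
  have [h|h] := leP 0 (x - x0); first by rewrite ger0_norm // le_max; apply/orP; right; lra.
  by rewrite ltr0_norm // le_max; apply/orP; left; lra.
have f1 : 0 < freq a b 1 by rewrite m1 divr_gt0 ?mulr_gt0.
pose K1 := `|K| / (k * freq a b 1 ^+ 2).
have K1_ge0 : 0 <= K1 by rewrite divr_ge0 // mulr_ge0 ?sqr_ge0 // (ltW k0).
have wE x : a < x < b -> x != x0 -> 0 < sq (w x).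
  move=> xD xx0; apply: lt_le_trans (w_low x xD).
  by rewrite mulr_gt0 // exprn_even_gt0 //= mulf_eq0 subr_eq0 (negbTE xx0) orbF gt_eqF.
have gE x : a < x < b -> Q x - Q x0 = w x * g x.
  move=> xD; have [->|xx0] := eqVneq x x0; first by rewrite /w !subrr mul0r.
  have s0 := wE x xD xx0.
  rewrite /g mulrCA [w x * _]mulrA powR_inv1 ?(ltW s0) //.
  have -> : w x * conjc (w x) = (sq (w x))%:C%C.
    by rewrite sq_mulJ; apply: cext; rewrite /= /sq; ring.
  by rewrite -rmorphM /= divff ?gt_eqF // mulr1.
have g_bd x : a < x < b -> sq (g x) <= K1.
  move=> xD; have [->|xx0] := eqVneq x x0.
    by rewrite /g subrr mul0r sq0.
  have s0 := wE x xD xx0.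
  rewrite -(ler_pM2l s0) -sqM -gE //.
  apply: le_trans (lipQ _ _ xD x0D) _.
  apply: (@le_trans _ _ (`|K| * (x - x0) ^+ 2)).
    by rewrite ler_wpM2r ?sqr_ge0 // ler_norm.
  have -> : `|K| * (x - x0) ^+ 2 = (k * (freq a b 1 * (x - x0)) ^+ 2) * K1.
    by rewrite /K1; field; rewrite !gt_eqF.
  by rewrite ler_wpM2r // w_low.
have mw : Cmeas a b w by apply: CmeasD; [exact: Cmeas_E|exact: Cmeas_cst].
have mg : Cmeas a b g.
  apply: CmeasM; first by apply: CmeasD => //; exact: Cmeas_cst.
  apply: CmeasM; first exact: CmeasJ.
  apply: CmeasC; apply: (measurableT_comp (measurable_powR _)); exact: Cmeas_sq.
have Lg : inL2 a b g := inL2_bounded mg g_bd.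
have ig := inL2_Cint Lg.
have iQ : Cint a b Q.
  apply: (@Cint_bounded _ _ _ _ (2 * (2 * L ^+ 2 * `|K|) + 2 * sq (Q x0))) => // x xD.
  have -> : Q x = (Q x - Q x0) + Q x0 by rewrite subrK.
  apply: le_trans (sqD_le _ _) _; rewrite lerD2r ler_pM2l //.
  apply: le_trans (lipQ _ _ xD x0D) _.
  apply: (@le_trans _ _ (`|K| * (x - x0) ^+ 2)).
    by rewrite ler_wpM2r ?sqr_ge0 // ler_norm.
  rewrite mulrC ler_wpM2r //; have [/andP[? ?]] := (xD, x0D); nra.
have iEg : Cint a b (fun x => g x * E 1 x).
  by apply: (CintM_bounded (Cmeas_E a b 1) _ ig (K := 1)) => x _; rewrite sq_E.
have step l : fcoef a b g (l - 1) - E 1 x0 * fcoef a b g l = if 0 == l then - Q x0 else 0.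
  have -> : fcoef a b g (l - 1) = fcoef a b (fun x => g x * E 1 x) l.
    rewrite !fcoefE; congr (_ * _); apply: eq_Cintegral => x _.
    by rewrite -mulrA; congr (_ * _); rewrite -!E_N -E_D opprB.
  rewrite -fcoefZ // -fcoefB //; last exact: CintZ.
  rewrite (@eq_fcoef _ _ _ _ (fun x => Q x - Q x0)) => [|x xD]; last first.
    by rewrite gE // /w; move: (E 1 x) (E 1 x0) => *; ring.
  rewrite fcoefB //; last exact/inL2_Cint/inL2_cst.
  by rewrite Q0 fcoef_cst sub0r; case: ifP; rewrite ?oppr0.
have sq_step l : l != 0 -> sq (fcoef a b g (l - 1)) = sq (fcoef a b g l).
  move=> l0; have := step l; rewrite eq_sym (negbTE l0) => /eqP; rewrite subr_eq0 => /eqP ->.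
  by rewrite sqM sq_E mul1r.
pose A := sq (fcoef a b g 0); pose B := sq (fcoef a b g (-1)).
have sqE l : sq (fcoef a b g l) = if (0 <= l)%R then A else B.
  exact: (int_step (F := fun l => sq (fcoef a b g l))).
have bes N : L * (N.+1%:R * A + N%:R * B) <= nsq a b g.
  by rewrite -ssum_step -(eq_ssum _ sqE); exact: bessel.
have small (X : R) : 0 <= X -> (forall N : nat, L * (N%:R * X) <= nsq a b g) -> X = 0.
  move=> X0 h; apply/eqP; rewrite eq_le X0 andbT leNgt; apply/negP => Xp.
  have := h (Num.truncn (nsq a b g / (L * X))).+1.
  have := truncnS_gt (nsq a b g / (L * X)).
  rewrite ltr_pdivrMr ?mulr_gt0 // => h1 h2.
  by have := le_lt_trans h2 h1; rewrite mulrCA ltxx.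
have A_ge0 : 0 <= A by exact: sq_ge0.
have B_ge0 : 0 <= B by exact: sq_ge0.
have A0 : A = 0.
  apply: small => // N; apply: le_trans (bes N); rewrite ler_pM2l //.
  by rewrite -natr1; have := ler0n R N; nra.
have B0 : B = 0.
  apply: small => // N; apply: le_trans (bes N); rewrite ler_pM2l //.
  by rewrite A0 mulr0 add0r.
have := step 0; rewrite eqxx sub0r (sq_eq0 A0) (sq_eq0 B0) mulr0 subrr => /eqP.
by rewrite eq_sym oppr_eq0 => /eqP.
Qed.

(** Two integrations reduce the claim to a Lipschitz function. *)
Lemma fcoef0_ae0 r : Cint a b r -> (forall l, fcoef a b r l = 0) ->
  {ae mu, forall x, D x -> r x = 0}.
Proof.
move=> ir r0.
have ir1 := Cint_cprim0 ir; have r1 := fcoef_cprim0 ir r0.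
have ir2 := Cint_cprim0 ir1; have r2 := fcoef_cprim0 ir1 r1.
have cstp u (z : R[i]) : Cint a b u -> (forall x, a < x < b -> cprim u x = z) ->
    {ae mu, forall x, D x -> u x = 0}.
  move=> [ru iu] h.
  have hr := prim_cst_ae0 ru (fun x xD => congr1 (@complex.Re R) (h x xD)).
  have hi := prim_cst_ae0 iu (fun x xD => congr1 (@complex.Im R) (h x xD)).
  by apply: aeS2 hr hi => x hr hi xD; apply: cext; [exact: hr|exact: hi].
have [K hK] := cprim_bounded ir.
have q2 : forall x, a < x < b -> cprim0 (cprim0 r) x = 0.
  pose K1 := 2 * K + 2 * sq (- fcoef a b (cprim r) 0).
  have hK1 x : sq (cprim0 r x) <= K1.
    by apply: le_trans (sqD_le _ _) _; rewrite lerD2r ler_pM2l.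
  apply: (@lipschitz_fcoef0 _ (2 * K1)) => //; first exact: Cint_meas.
  move=> x y; wlog xy : x y / x <= y.
    move=> H xD yD; have [/H|/ltW/H] := leP x y; first exact.
    move/(_ yD xD) => h; have -> : (x - y) ^+ 2 = (y - x) ^+ 2 by ring.
    by rewrite sqB.
  move=> /andP[ax xb] /andP[ay yb].
  have K10 : 0 <= K1 by apply: le_trans (hK1 a); exact: sq_ge0.
  have s0 : 0 <= Num.sqrt K1 by exact: sqrtr_ge0.
  have [ru iu] := ir1.
  have hr t : a < t < b -> `|Re (cprim0 r t)| <= Num.sqrt K1.
    by move=> _; rewrite -sqrtr_sqr ler_wsqrtr // (le_trans (Re_le_sq _)).
  have hi t : a < t < b -> `|Im (cprim0 r t)| <= Num.sqrt K1.
    by move=> _; rewrite -sqrtr_sqr ler_wsqrtr // (le_trans (Im_le_sq _)).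
  have := prim_lipschitz ru s0 hr (ltW ax) xy; have := prim_lipschitz iu s0 hi (ltW ax) xy.
  rewrite -(@ler_pXn2r _ 2) ?nnegrE ?mulr_ge0 ?subr_ge0 // real_normK ?num_real // exprMn sqr_sqrtr // => h1.
  rewrite -(@ler_pXn2r _ 2) ?nnegrE ?mulr_ge0 ?subr_ge0 // real_normK ?num_real // exprMn sqr_sqrtr // => h2.
  have -> : cprim0 (cprim0 r) x - cprim0 (cprim0 r) y = cprim (cprim0 r) x - cprim (cprim0 r) y.
    by rewrite {1 3}/cprim0; move: (fcoef _ _ _ _) (cprim _ x) (cprim _ y) => *; ring.
  rewrite sqB /sq /cprim /=; move: h1 h2; nra.
have c1 : {ae mu, forall x, D x -> cprim0 r x = 0}.
  apply: (cstp _ (fcoef a b (cprim (cprim0 r)) 0)) => // x xD.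
  by apply/eqP; rewrite -subr_eq0; apply/eqP; exact: q2.
apply: (cstp _ (fcoef a b (cprim r) 0)) => // x /andP[ax xb].
have [ru iu] := ir.
have xab : a <= x <= b by rewrite !ltW.
have hr : Re (cprim0 r x) = 0.
  apply: (@ae0_continuous (fun x => Re (cprim0 r x)) _ _ _ xab); last by apply: aeS c1 => y h /h ->.
  rewrite (_ : (fun x => _) = (fun x => prim a b (fun x => Re (r x)) x + Re (- fcoef a b (cprim r) 0))).
    by move=> y; apply: cvgD; [exact: (continuous_prim hab ru)|exact: cvg_cst].
  by apply/funext => y; rewrite /cprim0 ReD.
have hi : Im (cprim0 r x) = 0.
  apply: (@ae0_continuous (fun x => Im (cprim0 r x)) _ _ _ xab); last by apply: aeS c1 => y h /h ->.
  rewrite (_ : (fun x => _) = (fun x => prim a b (fun x => Im (r x)) x + Im (- fcoef a b (cprim r) 0))).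
    by move=> y; apply: cvgD; [exact: (continuous_prim hab iu)|exact: cvg_cst].
  by apply/funext => y; rewrite /cprim0 ImD.
by apply/eqP; rewrite -subr_eq0; apply/eqP; apply: cext.
Qed.

End Completeness.

(** * Parseval and bounds on coefficients *)

Section Parseval.
Context {R : realType} (a b : R) (hab : a < b).
Implicit Types (u v g r : R -> R[i]) (c d : int -> R[i]).
Local Notation mu := (@lebesgue_measure R).
Local Notation D := (`]a, b[%classic : set R).
Local Notation L := (b - a).
Local Notation E := (E a b).
Local Notation psum := (psum a b).

Let L0 : 0 < L. Proof. by rewrite subr_gt0. Qed.

Definition ae_eqD u v := {ae mu, forall x, D x -> u x = v x}.

Lemma ae_Cintegral u v : Cmeas a b u -> Cmeas a b v -> ae_eqD u v ->
  Cintegral a b u = Cintegral a b v.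
Proof.
move=> [mur mui] [mvr mvi] h; apply: cext; rewrite (ReI, ImI) (ReI, ImI).
- by apply: ae_Rintegral => //; apply: aeS h => x h /h ->.
- by apply: ae_Rintegral => //; apply: aeS h => x h /h ->.
Qed.

Lemma ae_nsq u v : Cmeas a b u -> Cmeas a b v -> ae_eqD u v -> nsq a b u = nsq a b v.
Proof.
move=> mu_ mv h; apply: ae_Rintegral; [exact: mD|exact: Cmeas_sq|exact: Cmeas_sq|].
by apply: aeS h => x h /h ->.
Qed.

Lemma ae_fcoef u v l : Cmeas a b u -> Cmeas a b v -> ae_eqD u v ->
  fcoef a b u l = fcoef a b v l.
Proof.
move=> mu_ mv h; rewrite !fcoefE; congr (_ * _); apply: ae_Cintegral.
- by apply: CmeasM => //; apply: CmeasJ; exact: Cmeas_E.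
- by apply: CmeasM => //; apply: CmeasJ; exact: Cmeas_E.
- by apply: aeS h => x h /h ->.
Qed.

Lemma nsq_ae0 u : inL2 a b u -> nsq a b u = 0 -> ae_eqD u (fun=> 0).
Proof.
move=> Lu n0; apply: (fcoef0_ae0 hab (inL2_Cint Lu)) => l.
apply/sq_eq0/eqP; rewrite eq_le sq_ge0 andbT.
by have := bessel1 hab l Lu; rewrite n0 pmulr_rle0.
Qed.

Lemma ae_fcoefP u v : Cint a b u -> Cint a b v ->
  (forall l, fcoef a b u l = fcoef a b v l) -> ae_eqD u v.
Proof.
move=> iu iv h.
have h0 : ae_eqD (fun x => u x - v x) (fun=> 0).
  by apply: (fcoef0_ae0 hab (CintB iu iv)) => l; rewrite fcoefB // h subrr.
by apply: aeS h0 => x h0 /h0 /eqP; rewrite subr_eq0 => /eqP.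
Qed.

(** Riesz-Fischer provides a limit of the partial sums, which has the same
    coefficients as [u] and so equals [u] by completeness. *)
Lemma psum_cvg u : inL2 a b u ->
  nsq a b (fun x => u x - psum (fcoef a b u) N x) @[N --> \oo] --> (0 : R).
Proof.
move=> Lu.
have bd N : ssum N (fun l => sq (fcoef a b u l)) <= L^-1 * nsq a b u.
  by rewrite mulrC ler_pdivlMr // mulrC; exact: bessel.
have [g [Lg gu lim]] := riesz_fischer hab bd.
have gu_ae := ae_fcoefP (inL2_Cint Lg) (inL2_Cint Lu) gu.
rewrite (_ : (fun N => _) = (fun N => nsq a b (fun x => g x - psum (fcoef a b u) N x))) //.
apply/funext => N; apply: ae_nsq.
- by apply: CmeasD; [exact: inL2_meas|apply: CmeasN; exact/inL2_meas/inL2_psum].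
- by apply: CmeasD; [exact: inL2_meas|apply: CmeasN; exact/inL2_meas/inL2_psum].
- by apply: aeS gu_ae => x h /h ->.
Qed.

(** The norm of L^2(a, b) on sequences of coefficients. Bounding all finite
    sums avoids infinite series, and composes well with termwise comparisons. *)
Definition l2le c (A : R) := forall N, L * ssum N (fun l => sq (c l)) <= A ^+ 2.

Lemma parseval u (A : R) : inL2 a b u -> nsq a b u <= A ^+ 2 <-> l2le (fcoef a b u) A.
Proof.
move=> Lu; split=> [h N|h]; first exact: le_trans (bessel hab N Lu) h.
have lim : (A ^+ 2 + nsq a b (fun x => u x - psum (fcoef a b u) N x)) @[N --> \oo] --> A ^+ 2 + 0.
  by apply: cvgD; [exact: cvg_cst|exact: psum_cvg].
rewrite addr0 in lim.
rewrite -(cvg_lim _ lim) //; apply: limr_ge; first exact: (cvgP _ lim).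
apply: nearW => N; rewrite nsq_sub_psum //.
have -> : ssum N (fun l => sq (fcoef a b u l - fcoef a b u l)) = 0.
  by rewrite /ssum big1 // => k _; rewrite subrr sq0.
by have := h N; lra.
Qed.

Lemma L2norm_l2le u (A : R) : inL2 a b u -> 0 <= A ->
  (L2norm a b u <= A%:E)%E <-> l2le (fcoef a b u) A.
Proof. by move=> Lu A0; rewrite (L2norm_le Lu A0); exact: parseval. Qed.

Lemma l2le_fun c (A : R) : l2le c A -> exists2 g, inL2 a b g & fcoef a b g = c.
Proof.
move=> h.
have bd N : ssum N (fun l => sq (c l)) <= L^-1 * A ^+ 2.
  by rewrite mulrC ler_pdivlMr // mulrC; exact: h.
have [g [Lg gc _]] := riesz_fischer hab bd.
by exists g => //; apply/funext.
Qed.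

Lemma l2le_dom c d (A : R) : (forall l, sq (c l) <= sq (d l)) -> l2le d A -> l2le c A.
Proof. by move=> h dA N; apply: le_trans (dA N); rewrite ler_pM2l //; exact: ler_ssum. Qed.

Lemma l2le_mono c (A B : R) : l2le c A -> 0 <= A -> A <= B -> l2le c B.
Proof.
by move=> h A0 AB N; apply: le_trans (h N) _; rewrite ler_sqr // nnegrE (le_trans A0).
Qed.

Lemma l2leZ c (z : R[i]) (k A : R) : sq z <= k ^+ 2 -> l2le c A -> l2le (fun l => z * c l) (k * A).
Proof.
move=> zk h N.
have -> : ssum N (fun l => sq (z * c l)) = sq z * ssum N (fun l => sq (c l)).
  by rewrite -ssumZ; apply: eq_ssum => l; rewrite sqM.
rewrite mulrCA exprMn ler_pM ?sq_ge0 ?mulr_ge0 ?(ltW L0) ?ssum_ge0 // => l; exact: sq_ge0.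
Qed.

Lemma l2leN c (A : R) : l2le c A -> l2le (fun l => - c l) A.
Proof. by apply: l2le_dom => l; rewrite sqN. Qed.

Lemma l2le_term c (A : R) l : l2le c A -> L * sq (c l) <= A ^+ 2.
Proof.
move=> h; apply: le_trans (h `|l|%N); rewrite ler_pM2l //.
apply: (@ssum_ge_term _ _ (fun l => sq (c l))) => // k; exact: sq_ge0.
Qed.

Lemma ssum_lin N (x y : R) (F G : int -> R) :
  ssum N (fun l => x * F l + y * G l) = x * ssum N F + y * ssum N G.
Proof. by rewrite -!ssumZ -ssumD. Qed.

(** Lets the triangle inequality be proved with strictly positive bounds. *)
Lemma l2le_sub c (A : R) : (forall e, 0 < e -> l2le c (A + e)) -> 0 <= A -> l2le c A.
Proof.
move=> h A0 N; apply/ler_addgt0Pr => e e0.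
pose d := Num.min 1 (e / (2 * A + 1)).
have d0 : 0 < d by rewrite lt_min ltr01 divr_gt0 //; lra.
have d1 : d <= 1 by rewrite ge_min lexx.
have de : d * (2 * A + 1) <= e by rewrite -ler_pdivlMr ?ge_min ?lexx ?orbT //; lra.
apply: le_trans (h _ d0 N) _; nra.
Qed.

(** Young's inequality with the ratio B / A of the two norms. *)
Lemma l2leD c d (A B : R) : 0 <= A -> 0 <= B -> l2le c A -> l2le d B ->
  l2le (fun l => c l + d l) (A + B).
Proof.
move=> A0 B0 hc hd; apply: l2le_sub; last exact: addr_ge0.
move=> e e0 N.
pose A' := A + e / 2; pose B' := B + e / 2.
have A'0 : 0 < A' by rewrite /A'; lra.
have B'0 : 0 < B' by rewrite /B'; lra.
have hc' : l2le c A' by apply: l2le_mono hc A0 _; rewrite /A'; lra.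
have hd' : l2le d B' by apply: l2le_mono hd B0 _; rewrite /B'; lra.
have -> : A + B + e = A' + B' by rewrite /A' /B'; field.
have young l : sq (c l + d l) <= (1 + B' / A') * sq (c l) + (1 + A' / B') * sq (d l).
  have k0 : 0 < B' / A' by rewrite divr_gt0.
  have -> : A' / B' = (B' / A')^-1 by rewrite invf_div.
  set k := B' / A' in k0 *.
  have gen (x y : R) : (x + y) ^+ 2 <= (1 + k) * x ^+ 2 + (1 + k^-1) * y ^+ 2.
    rewrite -(ler_pM2l k0).
    have -> : k * ((1 + k) * x ^+ 2 + (1 + k^-1) * y ^+ 2) = k * (x ^+ 2 + y ^+ 2) + (k ^+ 2 * x ^+ 2 + y ^+ 2).
      by field; rewrite gt_eqF.
    have := sqr_ge0 (k * x - y); nra.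
  have := gen (Re (c l)) (Re (d l)); have := gen (Im (c l)) (Im (d l)).
  rewrite /sq ReD ImD; lra.
have {young} := ler_ssum N young.
rewrite ssum_lin => h.
have := hc' N; have := hd' N; move: h.
set Z := ssum N _; set X := ssum N (fun l => sq (c l)); set Y := ssum N (fun l => sq (d l)).
move=> h hY hX.
apply: (@le_trans _ _ (L * ((1 + B' / A') * X + (1 + A' / B') * Y))).
  by rewrite ler_pM2l.
have -> : L * ((1 + B' / A') * X + (1 + A' / B') * Y) =
  (1 + B' / A') * (L * X) + (1 + A' / B') * (L * Y) by ring.
have -> : (A' + B') ^+ 2 = (1 + B' / A') * A' ^+ 2 + (1 + A' / B') * B' ^+ 2.
  by field; rewrite !gt_eqF.
by apply: lerD; rewrite ler_pM2l // addr_gt0 // divr_gt0.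
Qed.

Lemma l2leB c d (A B : R) : 0 <= A -> 0 <= B -> l2le c A -> l2le d B ->
  l2le (fun l => c l - d l) (A + B).
Proof. by move=> A0 B0 hc hd; apply: l2leD => //; exact: l2leN. Qed.

(** Young's inequality 2 m <= k + m^2 / k with k = B / A, applied to m = mu_l^2;
    the shift by d avoids a vanishing A or B. *)
Lemma l2le_interp c (A B : R) : 0 <= A -> 0 <= B -> l2le c A ->
  l2le (fun l => (freq a b l ^+ 2)%:C%C * c l) B ->
  l2le (fun l => (freq a b l)%:C%C * c l) (Num.sqrt (A * B)).
Proof.
move=> A0 B0 hA hB N; rewrite sqr_sqrtr ?mulr_ge0 //.
apply/ler_addgt0Pr => e e0.
pose d := Num.min 1 (e / (A + B + 1)).
have d0 : 0 < d by rewrite lt_min ltr01 divr_gt0 //; lra.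
have d1 : d <= 1 by rewrite ge_min lexx.
have de : d * (A + B + 1) <= e by rewrite -ler_pdivlMr ?ge_min ?lexx ?orbT //; lra.
have A'0 : 0 < A + d by lra.
have B'0 : 0 < B + d by lra.
have hA' : l2le c (A + d) by apply: l2le_mono hA A0 _; lra.
have hB' : l2le (fun l => (freq a b l ^+ 2)%:C%C * c l) (B + d) by apply: l2le_mono hB B0 _; lra.
suff : L * ssum N (fun l => sq ((freq a b l)%:C%C * c l)) <= (A + d) * (B + d).
  by move/le_trans; apply; nra.
have k0 : 0 < (B + d) / (A + d) by rewrite divr_gt0.
set k := (B + d) / (A + d) in k0.
have young l : sq ((freq a b l)%:C%C * c l) <=
    k / 2 * sq (c l) + k^-1 / 2 * sq ((freq a b l ^+ 2)%:C%C * c l).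
  rewrite !sqM !sqC; set m := freq a b l ^+ 2.
  have -> : k / 2 * sq (c l) + k^-1 / 2 * (m ^+ 2 * sq (c l)) =
     (k / 2 + k^-1 / 2 * m ^+ 2) * sq (c l) by ring.
  rewrite ler_wpM2r ?sq_ge0 // -(ler_pM2l k0).
  have -> : k * (k / 2 + k^-1 / 2 * m ^+ 2) = (k ^+ 2 + m ^+ 2) / 2 by field; rewrite gt_eqF.
  have := sqr_ge0 (k - m); lra.
apply: (@le_trans _ _ (L * ssum N (fun l => k / 2 * sq (c l) + k^-1 / 2 * sq ((freq a b l ^+ 2)%:C%C * c l)))).
  by rewrite ler_pM2l //; exact: ler_ssum.
rewrite ssum_lin mulrDr mulrCA [L * (k^-1 / 2 * _)]mulrCA.
have -> : (A + d) * (B + d) = k / 2 * (A + d) ^+ 2 + k^-1 / 2 * (B + d) ^+ 2.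
  by rewrite /k; field; rewrite !gt_eqF.
by apply: lerD; rewrite ler_pM2l ?divr_gt0 ?invr_gt0.
Qed.

Lemma sq_Cintegral_psum u v c N : inL2 a b u -> inL2 a b v ->
  sq (Cintegral a b (fun x => u x * v x) - Cintegral a b (fun x => psum c N x * v x)) <=
  nsq a b (fun x => u x - psum c N x) * nsq a b v.
Proof.
move=> Lu Lv; have LS := inL2_psum a b c N.
rewrite -CintegralB; [|exact: CintM..].
have -> : (fun x => u x * v x - psum c N x * v x) =
  (fun x => (u x - psum c N x) * conjc (conjc (v x))).
  by apply/funext => x; rewrite JK mulrBl.
apply: le_trans (cauchy_schwarz (inL2B Lu LS) (inL2J Lv)) _.
rewrite le_eqVlt; apply/orP; left; apply/eqP; congr (_ * _).
by apply: eq_Rintegral => x _; rewrite sqJ.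
Qed.

(** Pairing with a fixed square integrable function is continuous in L^2, so it is
    enough to compare pairings of partial sums, that is, of single modes. *)
Lemma pairing_modes u w v z : inL2 a b u -> inL2 a b w -> inL2 a b v -> inL2 a b z ->
  (forall l, fcoef a b u l * Cintegral a b (fun x => E l x * v x) =
             fcoef a b w l * Cintegral a b (fun x => E l x * z x)) ->
  Cintegral a b (fun x => u x * v x) = Cintegral a b (fun x => w x * z x).
Proof.
move=> Lu Lw Lv Lz h.
have pE u' v' N : inL2 a b v' ->
    Cintegral a b (fun x => psum (fcoef a b u') N x * v' x) =
    ssum N (fun l => fcoef a b u' l * Cintegral a b (fun x => E l x * v' x)).
  move=> Lv'; have iE l : Cint a b (fun x => E l x * v' x) by apply: CintM => //; exact: inL2_E.
  rewrite (@eq_Cintegral _ _ _ _ (fun x => \sum_(k < (2 * N).+1)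
     fcoef a b u' (k%:Z - N%:Z) * (E (k%:Z - N%:Z) x * v' x))); last first.
    by move=> x _; rewrite /psum /ssum big_distrl /=; apply: eq_bigr => k _; rewrite mulrA.
  rewrite Cintegral_sum => [|k]; last exact: CintZ.
  by apply: eq_bigr => k _; rewrite CintegralZ.
set X := Cintegral _ _ _; set Y := Cintegral _ _ _.
apply/eqP; rewrite -subr_eq0; apply/eqP/sq_eq0/eqP; rewrite eq_le sq_ge0 andbT.
have lim : (2 * (nsq a b (fun x => u x - psum (fcoef a b u) N x) * nsq a b v) +
   2 * (nsq a b (fun x => w x - psum (fcoef a b w) N x) * nsq a b z)) @[N --> \oo] -->
   2 * (0 * nsq a b v) + 2 * (0 * nsq a b z).
  by apply: cvgD; apply: cvgMr; apply: cvgMl; exact: psum_cvg.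
rewrite !mul0r mulr0 addr0 in lim.
rewrite -(cvg_lim _ lim) //; apply: limr_ge; first exact: (cvgP _ lim).
apply: nearW => N.
have hX := sq_Cintegral_psum (fcoef a b u) N Lu Lv.
have hY := sq_Cintegral_psum (fcoef a b w) N Lw Lz.
have e : Cintegral a b (fun x => psum (fcoef a b u) N x * v x) =
         Cintegral a b (fun x => psum (fcoef a b w) N x * z x).
  by rewrite !pE //; apply: eq_ssum.
rewrite -/X e in hX; rewrite -/Y in hY.
set S := Cintegral _ _ _ in hX hY.
have -> : X - Y = (X - S) + (S - Y) by move: X Y S {hX hY e} => *; ring.
by apply: le_trans (sqD_le _ _) _; rewrite [sq (S - Y)]sqB; apply: lerD; rewrite ler_pM2l.
Qed.

End Parseval.

(** * Smooth flat functions *)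

Section Smooth.
Context {R : realType}.
Implicit Types f g : R -> R.

Fixpoint diffn (n : nat) f : Prop :=
  if n is n'.+1 then (forall x : R, derivable f x 1) /\ diffn n' (f^`())%classic else True.

Definition smooth f := forall n, diffn n f.

Lemma smooth_derivable f : smooth f ->
  forall (k : nat) (x : R), derivable (f^`(k))%classic x 1.
Proof.
move=> sf k; elim: k f sf => [|k IH] f sf x; first by have [h _] := sf 1%N; exact: h.
rewrite derive1Sn; apply: IH => n; by have [] := sf n.+1.
Qed.

Lemma smoothP f : (forall (k : nat) (x : R), derivable (f^`(k))%classic x 1) <-> smooth f.
Proof.
split=> [h n|]; last exact: smooth_derivable.
elim: n f h => // n IH f h; split; first exact: (h 0%N).
by apply: IH => k x; have := h k.+1 x; rewrite derive1Sn.
Qed.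

Lemma diffnS n f : diffn n.+1 f -> diffn n f.
Proof. by elim: n f => // n IH f [h1 h2]; split => //; exact: IH. Qed.

Lemma deriv_ext f (df : R -> R) : (forall x : R, is_derive x 1 f (df x)) -> (f^`())%classic = df.
Proof. by move=> h; apply/funext => x; rewrite derive1E; case: (h x). Qed.

Lemma diffnD n f g : diffn n f -> diffn n g -> diffn n (fun x => f x + g x).
Proof.
elim: n f g => // n IH f g [df hf] [dg hg].
have d (x : R) : is_derive x 1 (fun x => f x + g x) ((f^`())%classic x + (g^`())%classic x).
  rewrite !derive1E; apply: is_deriveD; exact: derivableP.
split; first by move=> x; case: (d x).
rewrite (deriv_ext d); exact: IH.
Qed.

Lemma diffnM n f g : diffn n f -> diffn n g -> diffn n (fun x => f x * g x).
Proof.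
elim: n f g => // n IH f g hf hg; have [df hf'] := hf; have [dg hg'] := hg.
have d (x : R) : is_derive x 1 (fun x => f x * g x)
    ((f^`())%classic x * g x + f x * (g^`())%classic x).
  rewrite !derive1E; apply: is_derive_eq (is_deriveM (derivableP (df x)) (derivableP (dg x))) _.
  by rewrite /GRing.scale /=; ring.
split; first by move=> x; case: (d x).
by rewrite (deriv_ext d); apply: diffnD; apply: IH => //; exact: diffnS.
Qed.

Lemma diffn_cst n (c : R) : diffn n (fun=> c).
Proof.
elim: n c => // n IH c; split; first by move=> x; exact: derivable_cst.
have d (x : R) : is_derive x 1 (fun=> c : R) 0 by exact: is_derive_cst.
by rewrite (deriv_ext d).
Qed.

Lemma diffn_affine n f (p q : R) : diffn n f -> diffn n (fun x => f (p * x + q)).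
Proof.
elim: n f => // n IH f [df hf].
have daff (x : R) : is_derive x 1 (fun x => p * x + q) p.
  have h : is_derive x 1 (fun x : R => p * x) p.
    apply: is_derive_eq (is_deriveZ p (is_derive_id x 1)) _; by rewrite /GRing.scale /= mulr1.
  by apply: is_derive_eq (is_deriveD h (is_derive_cst q x 1)) _; rewrite addr0.
have dcomp (x : R) : is_derive x 1 (fun x => f (p * x + q)) ((f^`())%classic (p * x + q) * p).
  have hd (y : R) : is_derive y 1 f ((f^`())%classic y) by rewrite derive1E; exact: derivableP.
  exact: (@is_derive1_comp R f (fun x => p * x + q) x _ _ (hd _) (daff x)).
split; first by move=> x; case: (dcomp x).
rewrite (deriv_ext dcomp); apply: diffnM; last exact: diffn_cst.
exact: IH.
Qed.

(** The family P(1/x) exp(-1/x) is stable under differentiation, which makes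
    its members smooth by induction on the order. *)
Definition flat (P : {poly R}) (x : R) : R :=
  if 0 < x then P.[x^-1] * expR (- x^-1) else 0.

Lemma poly_le_exp (P : {poly R}) : exists2 C : R, 0 <= C &
  forall y, 0 <= y -> `|P.[y]| <= C * expR y.
Proof.
have [C [n [C0 hC]]] : exists C : R, exists n : nat, 0 <= C /\
    forall y, 0 <= y -> `|P.[y]| <= C * (1 + y) ^+ n.+1.
  elim/poly_ind: P => [|P c [C [n [C0 hC]]]].
    by exists 0, 0%N; split=> // y _; rewrite horner0 normr0 mul0r.
  exists (C + `|c|), n.+1; split=> [|y y0]; first exact: addr_ge0.
  rewrite hornerMXaddC; apply: le_trans (ler_normD _ _) _.
  have p1 : 1 <= (1 + y) ^+ n.+1 by rewrite exprn_ege1 // lerDl.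
  have p2 : 1 <= (1 + y) ^+ n.+2 by rewrite exprn_ege1 // lerDl.
  rewrite normrM (ger0_norm y0) mulrDl; apply: lerD; last by rewrite ler_peMr.
  apply: (@le_trans _ _ (C * (1 + y) ^+ n.+1 * y)); first by rewrite ler_wpM2r // hC.
  rewrite -mulrA ler_wpM2l // [leRHS]exprSr ler_wpM2l ?(le_trans ler01 p1) // lerDr //.
exists (C * n.+1%:R ^+ n.+1) => [|y y0]; first by rewrite mulr_ge0 // exprn_ge0.
apply: le_trans (hC y y0) _; rewrite -mulrA ler_wpM2l //.
have n0 : 0 < n.+1%:R :> R by rewrite ltr0n.
have -> : expR y = expR (y / n.+1%:R) ^+ n.+1.
  by rewrite -expRM_natl; congr expR; field; rewrite gt_eqF // natr1 ltr0n.
rewrite -exprMn ler_pXn2r ?nnegrE ?addr_ge0 ?mulr_ge0 ?expR_ge0 //.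
apply: (@le_trans _ _ (n.+1%:R * (1 + y / n.+1%:R))); last first.
  by rewrite ler_pM2l // expR_ge1Dx.
rewrite mulrDr mulr1 mulrCA divff ?gt_eqF // mulr1 lerD2r ler1n //.
Qed.

(** Quadratic decay at 0 yields the derivative there. *)
Lemma flat_le_sqr (P : {poly R}) : exists2 C : R, 0 <= C & forall t, `|flat P t| <= C * t ^+ 2.
Proof.
have [C C0 hC] := poly_le_exp (P * 'X^2).
exists C => // t; rewrite /flat; case: ifPn => t0; last by rewrite normr0 mulr_ge0 // sqr_ge0.
have y0 : 0 < t^-1 by rewrite invr_gt0.
have := hC _ (ltW y0); rewrite hornerM hornerXn normrM (ger0_norm (sqr_ge0 _)) => h.
rewrite normrM (gtr0_norm (expR_gt0 _)) expRN ler_pdivrMr ?expR_gt0 //.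
rewrite -(ler_pM2r (exprn_gt0 2 y0)); apply: le_trans h _.
have -> : C * t ^+ 2 * expR t^-1 * t^-1 ^+ 2 = C * expR t^-1 * (t * t^-1) ^+ 2.
  by move: (expR _) => z; move: (t^-1) => *; ring.
by rewrite divff ?gt_eqF // expr1n mulr1.
Qed.

Lemma is_derive_flat (P : {poly R}) (x : R) :
  is_derive x 1 (flat P) (flat ('X^2 * (P - P^`())) x).
Proof.
have [x0|x0|->] := ltgtP x 0.
- have E : \forall y \near x, flat P y = cst 0 y.
    near=> y; rewrite /flat ltNge ifF //; apply/negbTE; rewrite negbK ltW //.
    by near: y; exact: lt_nbhsl.
  rewrite [X in is_derive _ _ _ X](_ : _ = 0); last by rewrite /flat ltNge (ltW x0).
  by apply: near_eq_is_derive (is_derive_cst 0 x 1); apply: filterS E => y ->.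
- have E : \forall y \near x, flat P y = P.[y^-1] * expR (- y^-1).
    near=> y; rewrite /flat ifT //; near: y; exact: lt_nbhsr.
  have xn0 : x != 0 by rewrite gt_eqF.
  have dinv : is_derive x 1 (fun y : R => y^-1) (- x ^- 2).
    apply: is_derive_eq (is_deriveV xn0 (is_derive_id x 1)) _.
    by rewrite /GRing.scale /= mulr1.
  have dP : is_derive x 1 (fun y : R => P.[y^-1]) (P^`().[x^-1] * (- x ^- 2)).
    exact: (is_derive1_comp (is_derive_poly P x^-1) dinv).
  have dE : is_derive x 1 (fun y : R => expR (- y^-1)) (expR (- x^-1) * x ^- 2).
    have dN : is_derive x 1 (fun y : R => - y^-1) (x ^- 2).
      by apply: is_derive_eq (is_deriveN dinv) _; rewrite opprK.
    exact: (@is_derive1_comp R expR (fun y => - y^-1) x _ _ (is_derive_expR _) dN).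
  have E' : \forall y \near x, P.[y^-1] * expR (- y^-1) = flat P y.
    by apply: filterS E => y ->.
  apply: near_eq_is_derive E' _.
  apply: is_derive_eq (is_deriveM dP dE) _.
  rewrite /flat x0 !hornerE -[_ *: (_ / _)]/(_ * _) -[expR _ *: _]/(_ * _).
  move: (P.[_]) (P^`().[_]) (expR _) => A B C; field.
  by rewrite gt_eqF.
- have -> : flat ('X^2 * (P - P^`())) 0 = 0 by rewrite /flat ltxx.
  have [C C0 hC] := flat_le_sqr P.
  have f0 : flat P 0 = 0 by rewrite /flat ltxx.
  have lim : h^-1 *: ((flat P \o shift 0) (h *: (1 : R)) - flat P 0) @[h --> 0^'] --> (0 : R).
    have lim0 : C * `|h| @[h --> (0 : R)^'] --> (0 : R).
      have : C * `|h| @[h --> (0 : R)] --> C * `|0 : R|.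
        by apply: cvgMr; apply: cvg_norm; exact: cvg_id.
      by rewrite normr0 mulr0; apply: cvg_trans; apply: cvg_app; exact: nbhs_dnbhs.
    apply/cvgr0Pnorm_le => e e0.
    have /cvgr0Pnorm_le/(_ e e0) := lim0.
    apply: filterS2 (nbhs_dnbhs_neq _) => h h0.
    rewrite /= f0 subr0 addr0 [h *: 1]mulr1 ger0_norm ?mulr_ge0 //.
    apply: le_trans; rewrite [_ *: _]/(_ * _) normrM normfV.
    have n0 : 0 < `|h| by rewrite normr_gt0.
    rewrite mulrC ler_pdivrMr //; apply: le_trans (hC h) _.
    by rewrite -mulrA -expr2 real_normK ?num_real.
  by apply: DeriveDef; [exact: (cvgP _ lim)|exact: (cvg_lim _ lim)].
Unshelve. all: by end_near. Qed.

Lemma smooth_flat (P : {poly R}) : smooth (flat P).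
Proof.
move=> n; elim: n P => // n IH P; split.
  by move=> x; case: (is_derive_flat P x).
by rewrite (deriv_ext (is_derive_flat P)).
Qed.

Lemma flat1_ge0 (x : R) : 0 <= flat 1 x.
Proof. by rewrite /flat; case: ifP => // _; rewrite mulr_ge0 ?expR_ge0 // hornerE. Qed.

Lemma flat1_le1 (x : R) : flat 1 x <= 1.
Proof.
rewrite /flat; case: ifP => // x0; rewrite hornerE mul1r -expR0 ler_expR.
by rewrite oppr_le0 invr_ge0 ltW.
Qed.

End Smooth.

(** * Test functions and the calculus of variations *)

Section Test.
Context {R : realType} (a b : R) (hab : a < b).
Implicit Types (u v w : R -> R[i]) (phi : R -> R).
Local Notation mu := (@lebesgue_measure R).
Local Notation D := (`]a, b[%classic : set R).
Local Notation L := (b - a).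
Local Notation E := (E a b).

Lemma test_smooth phi : test_function a b phi -> smooth phi.
Proof. by move=> [h _]; exact/smoothP. Qed.

Lemma test_is_derive phi (x : R) : test_function a b phi -> is_derive x 1 phi ((phi^`())%classic x).
Proof. by move=> [h _]; rewrite derive1E; apply: derivableP; exact: (h 0%N). Qed.

Lemma smooth_continuous phi : smooth phi -> continuous phi.
Proof.
move=> s x; apply/differentiable_continuous/derivable1_diffP.
by have [h _] := s 1%N; exact: h.
Qed.

Lemma test_deriv phi : test_function a b phi -> test_function a b (phi^`())%classic.
Proof.
move=> [h [c [d [ac db h0]]]]; split.
  by move=> k x; rewrite -derive1Sn; exact: h.
exists c, d; split=> // x xcd.
have [dx|xd] := ltP d x.
  rewrite derive1E (@near_eq_derive _ _ _ phi (cst 0)) ?derive_cst //.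
  near=> y; apply: h0; rewrite in_itv /= negb_and -!ltNge; apply/orP; right.
  by near: y; exact: lt_nbhsr.
have xc : x < c by move: xcd; rewrite in_itv /= xd andbT -ltNge.
rewrite derive1E (@near_eq_derive _ _ _ phi (cst 0)) ?derive_cst //.
near=> y; apply: h0; rewrite in_itv /= negb_and -!ltNge; apply/orP; left.
by near: y; exact: lt_nbhsl.
Unshelve. all: by end_near. Qed.

Lemma test_derivn phi k : test_function a b phi -> test_function a b (phi^`(k))%classic.
Proof.
move=> t; elim: k => [//|k IH]; rewrite derive1nS; exact: test_deriv.
Qed.

Lemma test_out phi x : test_function a b phi -> ~~ (a < x < b) -> phi x = 0.
Proof.
move=> [_ [c [d [ac db h0]]]] xab; apply: h0; apply: contra xab.
rewrite in_itv /= => /andP[cx xd]; by rewrite (lt_le_trans ac cx) (le_lt_trans xd db).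
Qed.

Lemma inL2_continuous phi : continuous phi -> inL2 a b (fun x => (phi x)%:C%C).
Proof.
move=> c; have [K K0 hK] := continuous_bounded hab (continuous_subspaceT c).
apply: (@inL2_bounded _ _ _ _ (K ^+ 2)).
  by apply: CmeasC; apply: measurable_funTS; exact: continuous_measurable_fun.
move=> x /andP[ax xb]; rewrite sqC -real_normK ?num_real // ler_sqr ?nnegrE //.
by rewrite hK // !ltW.
Qed.

Lemma inL2_test phi : test_function a b phi -> inL2 a b (fun x => (phi x)%:C%C).
Proof. by move=> t; apply/inL2_continuous/smooth_continuous; exact: test_smooth. Qed.

(** Increases with [n] to the indicator of ]c, d[. *)
Definition bump (c d : R) (n : nat) (x : R) : R :=
  flat 1 (n.+1%:R * (x - c)) * flat 1 (n.+1%:R * (d - x)).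

Lemma bump_test c d n : a < c -> d < b -> test_function a b (bump c d n).
Proof.
move=> ac db; split.
  apply: smooth_derivable => k; apply: diffnM.
  - have := @diffn_affine _ k _ n.+1%:R (- (n.+1%:R * c)) (@smooth_flat R 1 k).
    by congr (diffn k _); apply/funext => x; rewrite mulrBr.
  - have := @diffn_affine _ k _ (- n.+1%:R) (n.+1%:R * d) (@smooth_flat R 1 k).
    by congr (diffn k _); apply/funext => x; congr flat; ring.
exists c, d; split=> // x; rewrite in_itv /= negb_and -!ltNge => /orP[xc|dx].
- by rewrite /bump /flat ifF ?mul0r //; apply/negbTE; rewrite -leNgt pmulr_rle0 ?ltr0n // subr_le0 ltW.
- by rewrite /bump [flat 1 (_ * (d - x))]/flat ifF ?mulr0 //; apply/negbTE; rewrite -leNgt pmulr_rle0 ?ltr0n // subr_le0 ltW.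
Qed.

Lemma bump_ge0 c d n x : 0 <= bump c d n x.
Proof. by rewrite mulr_ge0 ?flat1_ge0. Qed.

Lemma bump_le1 c d n x : bump c d n x <= 1.
Proof. by rewrite -[leRHS]mulr1 ler_pM ?flat1_ge0 ?flat1_le1. Qed.

Lemma flat1_cvg (y : R) : 0 < y -> flat 1 (n.+1%:R * y) @[n --> \oo] --> (1 : R).
Proof.
move=> y0.
have -> : (fun n : nat => flat 1 (n.+1%:R * y)) = (fun n => expR (- (y^-1 * n.+1%:R^-1))).
  apply/funext => n; rewrite /flat mulr_gt0 ?ltr0n // hornerE mul1r invfM.
  by rewrite [_^-1 * _]mulrC.
have l : (y^-1 * n.+1%:R^-1) @[n --> \oo] --> y^-1 * 0.
  by apply: cvgMr; exact: cvg_harmonic.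
rewrite -[X in _ --> X](_ : expR (- (y^-1 * 0)) = 1); last by rewrite mulr0 oppr0 expR0.
apply: (@cvg_comp _ _ _ (fun n : nat => - (y^-1 * n.+1%:R^-1)) expR _ (nbhs (- (y^-1 * 0)))).
  exact: cvgN.
exact: continuous_expR.
Qed.

Lemma bump_cvg c d x : bump c d n x @[n --> \oo] --> (\1_(`]c, d[%classic) x : R).
Proof.
rewrite indicE; have [|] := boolP (x \in `]c, d[%classic).
  rewrite inE /= in_itv /= => /andP[cx xd].
  rewrite -[X in _ --> X](mulr1 (1 : R)); apply: cvgM; apply: flat1_cvg; by rewrite subr_gt0.
move=> /negP xn; have -> : (fun n => bump c d n x) = (fun=> 0); last exact: cvg_cst.
apply/funext => n.
have [cx|xc] := ltP c x; last first.
  by rewrite /bump /flat ifF ?mul0r //; apply/negbTE; rewrite -leNgt pmulr_rle0 ?ltr0n // subr_le0.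
have [xd|dx] := ltP x d; first by exfalso; apply: xn; rewrite inE /= in_itv /= cx xd.
by rewrite /bump [flat 1 (_ * (d - x))]/flat ifF ?mulr0 //; apply/negbTE; rewrite -leNgt pmulr_rle0 ?ltr0n // subr_le0.
Qed.

(** Bumps converge to indicators of intervals, so the primitive of [f] is constant
    inside ]a, b[. *)
Lemma test_int0_ae0 (f : R -> R) : mu.-integrable D (EFin \o f) ->
  (forall phi, test_function a b phi -> \int[mu]_(x in D) (f x * phi x) = 0) ->
  {ae mu, forall x, D x -> f x = 0}.
Proof.
move=> fi h.
have mf : measurable_fun D f by have /integrableP[/measurable_EFinP] := fi.
have zero c d : a < c -> c < d -> d < b -> \int[mu]_(x in D) (f x * \1_(`]c, d[%classic) x) = 0.
  move=> ac cd db.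
  have mb n : measurable_fun D (bump c d n).
    apply: measurable_funTS; apply: continuous_measurable_fun; apply: smooth_continuous.
    by apply: test_smooth; exact: bump_test.
  have m1 n : measurable_fun D (fun x => (f x * bump c d n x)%:E).
    by apply/measurable_EFinP; exact: measurable_funM.
  have fn n : mu.-integrable D (EFin \o (fun x => f x * bump c d n x)).
    apply: (rint_dom _ (integrable_norm fi)) => [|x _]; first exact: measurable_funM.
    by rewrite normrM ler_piMr // ger0_norm ?bump_ge0 ?bump_le1.
  have pc x : D x -> (f x * bump c d n x)%:E @[n --> \oo] --> (f x * \1_(`]c, d[%classic) x)%:E.
    move=> _; apply: cvg_EFin; first exact: nearW.
    by apply: cvgMr; exact: bump_cvg.
  have gb n x : D x -> (`|(f x * bump c d n x)%:E| <= `|f x|%:E)%E.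
    by move=> _; rewrite lee_fin normrM ler_piMr // ger0_norm ?bump_ge0 ?bump_le1.
  have lim : (\int[mu]_(x in D) (f x * bump c d n x)%:E)%E @[n --> \oo] -->
      (\int[mu]_(x in D) (f x * \1_(`]c, d[%classic) x)%:E)%E.
    apply: (@dominated_cvg _ _ _ mu D (measurable_itv _) _ _ (fun x => `|f x|%:E)) => //.
    exact: (integrable_norm fi).
  rewrite /Rintegral; rewrite (_ : (fun n => _) = (fun=> 0%E)) in lim; last first.
    by apply/funext => n; rewrite EFin_rint // h //; exact: bump_test.
  by rewrite -(cvg_lim _ lim) // lim_cst.
have cst : forall x y, a < x -> x <= y -> y < b -> prim a b f x = prim a b f y.
  move=> x y ax; rewrite le_eqVlt => /predU1P[->//|xy] yb.
  apply/eqP; rewrite eq_sym -subr_eq0 (primB fi (ltW ax) (ltW xy)).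
  rewrite -(Rintegral_itv_bndo_bndc (rint_patchS (measurable_itv _) fi)).
  apply/eqP; rewrite -[RHS](zero _ _ ax xy yb).
  rewrite Rintegral_mkcond [RHS]Rintegral_mkcond; apply: eq_Rintegral => t _.
  rewrite !patchE indicE; case: ifPn => txy; last first.
    by case: ifP => // _; rewrite mulr0.
  by rewrite mulr1.
apply: (prim_cst_ae0 fi (k := prim a b f ((a + b) / 2))) => x /andP[ax xb].
have [h1|h1] := leP x ((a + b) / 2).
  by apply: cst => //; lra.
by symmetry; apply: cst; [lra|exact: ltW|].
Qed.

Lemma Cintegral_mulC u phi : Cint a b u -> continuous phi ->
  [/\ Cint a b (fun x => u x * (phi x)%:C%C),
      Re (Cintegral a b (fun x => u x * (phi x)%:C%C)) = \int[mu]_(x in D) (Re (u x) * phi x) &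
      Im (Cintegral a b (fun x => u x * (phi x)%:C%C)) = \int[mu]_(x in D) (Im (u x) * phi x)].
Proof.
move=> iu cp; split.
- have [K K0 hK] := continuous_bounded hab (continuous_subspaceT cp).
  apply: (@CintM_bounded _ _ _ _ _ (K ^+ 2)) => //.
    by apply: CmeasC; apply: measurable_funTS; exact: continuous_measurable_fun.
  move=> x /andP[ax xb]; rewrite sqC -real_normK ?num_real // ler_sqr ?nnegrE //.
  by rewrite hK // !ltW.
- by rewrite ReI; apply: eq_Rintegral => x _; case: (u x) => p q /=; ring.
- by rewrite ImI; apply: eq_Rintegral => x _; case: (u x) => p q /=; ring.
Qed.

Lemma test_Cintegral0 u : Cint a b u ->
  (forall phi, test_function a b phi -> Cintegral a b (fun x => u x * (phi x)%:C%C) = 0) ->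
  ae_eqD a b u (fun=> 0).
Proof.
move=> iu h; have [ru iiu] := iu.
have hr : {ae mu, forall x, D x -> Re (u x) = 0}.
  apply: test_int0_ae0 => // phi t.
  by have [_ <- _] := Cintegral_mulC iu (smooth_continuous (test_smooth t)); rewrite h.
have hi : {ae mu, forall x, D x -> Im (u x) = 0}.
  apply: test_int0_ae0 => // phi t.
  by have [_ _ <-] := Cintegral_mulC iu (smooth_continuous (test_smooth t)); rewrite h.
by apply: aeS2 hr hi => x hr hi xD; apply: cext; [exact: hr|exact: hi].
Qed.

Lemma test_Cintegral_eq u v : Cint a b u -> Cint a b v ->
  (forall phi, test_function a b phi ->
    Cintegral a b (fun x => u x * (phi x)%:C%C) = Cintegral a b (fun x => v x * (phi x)%:C%C)) ->
  ae_eqD a b u v.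
Proof.
move=> iu iv h.
have h0 : ae_eqD a b (fun x => u x - v x) (fun=> 0).
  apply: test_Cintegral0 => [|phi t]; first exact: CintB.
  have cp := smooth_continuous (test_smooth t).
  have [iup _ _] := Cintegral_mulC iu cp; have [ivp _ _] := Cintegral_mulC iv cp.
  rewrite (_ : (fun x => _) = (fun x => u x * (phi x)%:C%C - v x * (phi x)%:C%C)); last first.
    by apply/funext => x; rewrite mulrBl.
  by rewrite CintegralB // h // subrr.
by apply: aeS h0 => x h0 /h0 /eqP; rewrite subr_eq0 => /eqP.
Qed.

(** The primitive is constant on each side of the support, and both constants
    vanish because the mean does. *)
Lemma test_primitive phi : test_function a b phi -> \int[mu]_(x in D) phi x = 0 ->
  exists2 Phi, test_function a b Phi & (Phi^`())%classic = phi.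
Proof.
move=> t mean0; have sp := test_smooth t; have cp := smooth_continuous sp.
have ip : mu.-integrable D (EFin \o phi).
  have [h _ _] := Cintegral_mulC (inL2_Cint (inL2_cst a b 1)) cp.
  have [h1 _] := h; apply: rint_eq h1 _ => x /=; ring.
have pD : phi \_ D = phi.
  apply/funext => x; rewrite patchE; case: ifPn => // xD; rewrite (test_out t) //.
  by apply: contra xD => ab; rewrite inE /= in_itv.
have iA (A : set R) : measurable A -> mu.-integrable A (EFin \o phi).
  by move=> mA; rewrite -pD; exact: rint_patchS.
have [c [d [ac db cd h0]]] : exists c d, [/\ a < c, d < b, c <= d & forall x, x \notin `[c, d] -> phi x = 0].
  have [_ [c [d [ac db h0]]]] := t; have [cd|dc] := leP c d; first by exists c, d.
  exists ((a + b) / 2), ((a + b) / 2); split; [exact: (midf_lt hab).1|exact: (midf_lt hab).2|exact: lexx|move=> x _].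
  apply: h0; rewrite in_itv /= negb_and -!ltNge; have [//|cx] := ltP x c.
  exact: lt_le_trans dc cx.
pose Phi := prim a b phi.
have PhiE x : Phi x = \int[mu]_(t in `[a, x]) phi t by rewrite /Phi /prim pD.
have left0 x : x < c -> Phi x = 0.
  move=> xc; rewrite PhiE (@eq_Rintegral _ _ _ mu _ (fun=> 0)); first by rewrite Rintegral_cst ?mul0r.
  move=> y; rewrite inE /= in_itv /= => /andP[_ yx]; apply: h0.
  by rewrite in_itv /= negb_and -ltNge (le_lt_trans yx xc).
have after y z : d <= y -> y <= z -> Phi y = Phi z.
  move=> dy yz; have ay : a <= y.
    by rewrite (le_trans (ltW ac)) // (le_trans cd).
  apply/eqP; rewrite eq_sym -subr_eq0 (primB ip ay yz) pD.
  apply/eqP; rewrite (@eq_Rintegral _ _ _ mu _ (fun=> 0)); first by rewrite Rintegral_cst ?mul0r.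
  move=> x; rewrite inE /= in_itv /= => /andP[yx _]; apply: h0.
  by rewrite in_itv /= negb_and -!ltNge (le_lt_trans dy yx) orbT.
have Phib : Phi b = 0 by rewrite /Phi prim_b.
have right0 x : d < x -> Phi x = 0.
  move=> dx; have [xb|bx] := leP x b; first by rewrite (after x b) // ltW.
  by rewrite -(after b x) // ltW.
have dPhi (x : R) : is_derive x 1 Phi (phi x).
  have [ax|xa] := ltP a x.
    have xx : x < x + 1 by rewrite ltrDl.
    have [h1 h2] := continuous_FTC1 (f := phi) (a := BLeft a) xx (iA _ (measurable_itv _)) ax (cp x).
    have -> : Phi = fun x => \int[mu]_(t in `[a, x]) phi t by apply/funext.
    by apply: DeriveDef => //; rewrite -derive1E.
  have xc : x < c by exact: le_lt_trans xa ac.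
  have -> : phi x = 0 by apply: h0; rewrite in_itv /= negb_and -ltNge xc.
  apply: near_eq_is_derive (is_derive_cst 0 x 1).
  near=> y; rewrite left0 //; near: y; exact: lt_nbhsl.
exists Phi; last exact: (deriv_ext dPhi).
split.
  case=> [|k] x; first by case: (dPhi x).
  by rewrite derive1Sn (deriv_ext dPhi); exact: smooth_derivable.
exists c, d; split=> // x; rewrite in_itv /= negb_and -!ltNge => /orP[|]; [exact: left0|exact: right0].
Unshelve. all: by end_near. Qed.

(** A nonnegative bump of zero mean would have a nondecreasing primitive that
    vanishes at both ends, hence would be zero. *)
Lemma test_mean_pos : exists2 theta, test_function a b theta & 0 < \int[mu]_(x in D) theta x.
Proof.
pose c := a + L / 4; pose d := b - L / 4.
have L0 : 0 < L by rewrite subr_gt0.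
have ac : a < c by rewrite /c; lra.
have db : d < b by rewrite /d; lra.
have cd : c < d by rewrite /c /d; lra.
have t := bump_test 0 ac db.
exists (bump c d 0) => //.
rewrite lt_def Rintegral_ge0 ?andbT => [|x _]; last exact: bump_ge0.
apply/eqP => I0.
have [Phi tPhi PhiE] := test_primitive t I0.
have PhiM x y : x <= y -> Phi x <= Phi y.
  rewrite le_eqVlt => /predU1P[->//|xy].
  have cPhi := smooth_continuous (test_smooth tPhi).
  have dP (z : R) : z \in `]x, y[ -> is_derive z 1 Phi (bump c d 0 z).
    by move=> _; rewrite -PhiE; exact: test_is_derive.
  have [z _ h] := MVT xy dP (continuous_subspaceT cPhi).
  by rewrite -subr_ge0 h mulr_ge0 ?bump_ge0 // subr_ge0 ltW.
have Phi0 x : Phi x = 0.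
  have [ax|] := ltP a x; last by move=> xa; rewrite (test_out tPhi) // negb_and -leNgt xa.
  have [xb|] := ltP x b; last by move=> bx; rewrite (test_out tPhi) // negb_and -!leNgt bx orbT.
  apply/eqP; rewrite eq_le; apply/andP; split.
    have := PhiM _ _ (ltW xb); by rewrite (@test_out _ b tPhi) // ltxx andbF.
  by have := PhiM _ _ (ltW ax); rewrite (@test_out _ a tPhi) // ltxx.
have : bump c d 0 ((a + b) / 2) = 0.
  rewrite -PhiE (_ : Phi = cst 0); last exact/funext.
  exact: derive1_cst.
have m1 : 0 < 1%:R * ((a + b) / 2 - c) by rewrite /c; lra.
have m2 : 0 < 1%:R * (d - (a + b) / 2) by rewrite /d; lra.
have h1 (y : R) : (1 : {poly R}).[y] = 1 by rewrite hornerE.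
by rewrite /bump /flat m1 m2 !h1 => /eqP; rewrite gt_eqF // !mulr_gt0 ?expR_gt0.
Qed.

Lemma testD phi psi : test_function a b phi -> test_function a b psi ->
  test_function a b (fun x => phi x + psi x).
Proof.
move=> tp tq; have sp := test_smooth tp; have sq_ := test_smooth tq.
split; first by apply: smooth_derivable => n; exact: diffnD.
have [_ [c [d [ac db h0]]]] := tp; have [_ [c' [d' [ac' db' h0']]]] := tq.
exists (Num.min c c'), (Num.max d d'); split.
- by rewrite lt_min ac.
- by rewrite gt_max db.
- move=> x; rewrite in_itv /= ge_min le_max negb_and !negb_or => h.
  have [hc|hc] := boolP (x \in `[c, d]).
    by move: hc h; rewrite in_itv /= => /andP[-> ->].
  have [hc'|hc'] := boolP (x \in `[c', d']).
    by move: hc' h; rewrite in_itv /= => /andP[-> ->]; rewrite !andbF.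
  by rewrite h0 // h0' // addr0.
Qed.

Lemma testZ (k : R) phi : test_function a b phi -> test_function a b (fun x => k * phi x).
Proof.
move=> tp; have sp := test_smooth tp; have [_ [c [d [ac db h0]]]] := tp.
split; first by apply: smooth_derivable => n; apply: diffnM => //; exact: diffn_cst.
by exists c, d; split=> // x /h0 ->; rewrite mulr0.
Qed.

(** Subtracting from a test function the multiple of a fixed one that has the same mean
    leaves the derivative of a test function (Du Bois-Reymond). *)
Lemma weak_cst v : Cint a b v ->
  (forall phi, test_function a b phi -> Cintegral a b (fun x => v x * ((phi^`())%classic x)%:C%C) = 0) ->
  exists k : R[i], ae_eqD a b v (fun=> k).
Proof.
move=> iv h; have [theta tt I0] := test_mean_pos.
set I := \int[mu]_(x in D) theta x in I0.
pose k := (I^-1)%:C%C * Cintegral a b (fun x => v x * (theta x)%:C%C).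
exists k; apply: test_Cintegral_eq => [//||phi tphi]; first exact/inL2_Cint/inL2_cst.
have cphi := smooth_continuous (test_smooth tphi).
have ct := smooth_continuous (test_smooth tt).
have iphi (f : R -> R) : continuous f -> mu.-integrable D (EFin \o f).
  move=> cf; have [h' _ _] := Cintegral_mulC (inL2_Cint (inL2_cst a b 1)) cf.
  by have [h1 _] := h'; apply: rint_eq h1 _ => x /=; ring.
pose m := (\int[mu]_(x in D) phi x) / I.
have t0 : test_function a b (fun x => phi x + (- m) * theta x) by apply: testD => //; exact: testZ.
have mean0 : \int[mu]_(x in D) (phi x + (- m) * theta x) = 0.
  rewrite RintegralD //; [|exact: iphi|by apply: rintZ; exact: iphi].
  rewrite RintegralZl //; last exact: iphi.
  by rewrite -/I /m; field; rewrite gt_eqF.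
have [Phi tPhi PhiE] := test_primitive t0 mean0.
have := h _ tPhi; rewrite PhiE.
have [ivp _ _] := Cintegral_mulC iv cphi; have [ivt _ _] := Cintegral_mulC iv ct.
rewrite (_ : (fun x => _) = (fun x => v x * (phi x)%:C%C + (- m)%:C%C * (v x * (theta x)%:C%C))); last first.
  by apply/funext => x; rewrite rmorphD rmorphM /= mulrDr mulrCA.
rewrite CintegralD //; last exact: CintZ.
rewrite (CintegralZ _ ivt) => /eqP; rewrite addr_eq0 => /eqP ->.
have -> : Cintegral a b (fun x => k * (phi x)%:C%C) = k * (\int[mu]_(x in D) phi x)%:C%C.
  have [i1 r1 im1] := Cintegral_mulC (inL2_Cint (inL2_cst a b 1)) cphi.
  rewrite (_ : (fun x => _) = (fun x => k * (1 * (phi x)%:C%C))); last by apply/funext => x; rewrite mul1r.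
  rewrite CintegralZ //; congr (_ * _); apply: cext.
    by rewrite r1 /=; apply: eq_Rintegral => x _; rewrite mul1r.
  rewrite im1 /= -[RHS](mul0r (\int[mu]_(x in D) phi x)) -RintegralZl //; exact: iphi.
rewrite /k /m; set J := \int[mu]_(x in D) phi x; set C := Cintegral _ _ _.
rewrite rmorphN rmorphM /= mulNr opprK; move: (_%:C)%C (_%:C)%C => p q; ring.
Qed.

End Test.

(** * Weak derivatives and Fourier coefficients *)

Section Weak.
Context {R : realType} (a b : R) (hab : a < b).
Implicit Types (u v w : R -> R[i]) (phi : R -> R).
Local Notation mu := (@lebesgue_measure R).
Local Notation D := (`]a, b[%classic : set R).
Local Notation L := (b - a).
Local Notation E := (E a b).
Local Notation freq := (freq a b).
Local Notation fcoef := (fcoef a b).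
Local Notation ae_eqD := (ae_eqD a b).
Local Notation Cint := (Cint a b).
Local Notation inL2 := (inL2 a b).
Local Notation weak_derivative := (weak_derivative a b).

Lemma test_cont phi : test_function a b phi -> continuous phi.
Proof. by move=> t; exact/smooth_continuous/(test_smooth t). Qed.

Lemma mode_deriv phi l : test_function a b phi ->
  Cintegral a b (fun x => E l x * ((phi^`())%classic x)%:C%C) =
  - ('i%C * (freq l)%:C%C) * Cintegral a b (fun x => E l x * (phi x)%:C%C).
Proof.
move=> t; have t' := test_deriv t.
have iE := inL2_Cint (inL2_E a b l).
have [i1 r1 m1] := Cintegral_mulC hab iE (test_cont t).
have [i2 r2 m2] := Cintegral_mulC hab iE (test_cont t').
have [[j1 j2] [j3 j4]] := (i1, i2).
have cp := test_cont t; have cp' := test_cont t'.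
have dp (x : R) := test_is_derive x t.
have pa : phi a = 0 by apply: (test_out t); rewrite ltxx.
have pb : phi b = 0 by apply: (test_out t); rewrite ltxx andbF.
have Iext (f g : R -> R) : (forall x, f x = g x) -> mu.-integrable D (EFin \o f) -> mu.-integrable D (EFin \o g).
  by move=> h i; apply: rint_eq i _ => x; rewrite h.
have ir1 : mu.-integrable D (EFin \o (fun x => Re (E l x) * phi x)).
  by apply: Iext j1 => x; case: (E l x) => p q /=; ring.
have ii1 : mu.-integrable D (EFin \o (fun x => Im (E l x) * phi x)).
  by apply: Iext j2 => x; case: (E l x) => p q /=; ring.
have ir2 : mu.-integrable D (EFin \o (fun x => Re (E l x) * (phi^`())%classic x)).
  by apply: Iext j3 => x; case: (E l x) => p q /=; ring.
have ii2 : mu.-integrable D (EFin \o (fun x => Im (E l x) * (phi^`())%classic x)).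
  by apply: Iext j4 => x; case: (E l x) => p q /=; ring.
have hr : \int[mu]_(x in D) (Re (E l x) * (phi^`())%classic x - freq l * (Im (E l x) * phi x)) = 0.
  have dE (x : R) : is_derive x 1 (fun x => Re (E l x) * phi x)
      (Re (E l x) * (phi^`())%classic x - freq l * (Im (E l x) * phi x)).
    apply: is_derive_eq (is_deriveM (is_derive_ReE a b l x) (dp x)) _.
    by rewrite /GRing.scale /=; ring.
  rewrite (ftc2 hab dE) ?pa ?pb ?mulr0 ?subrr //.
  move=> x; apply: cvgB; first by apply: cvgM; [exact: continuous_ReE|exact: cp'].
  by apply: cvgMr; apply: cvgM; [exact: continuous_ImE|exact: cp].
have hi : \int[mu]_(x in D) (Im (E l x) * (phi^`())%classic x + freq l * (Re (E l x) * phi x)) = 0.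
  have dE (x : R) : is_derive x 1 (fun x => Im (E l x) * phi x)
      (Im (E l x) * (phi^`())%classic x + freq l * (Re (E l x) * phi x)).
    apply: is_derive_eq (is_deriveM (is_derive_ImE a b l x) (dp x)) _.
    by rewrite /GRing.scale /=; ring.
  rewrite (ftc2 hab dE) ?pa ?pb ?mulr0 ?subrr //.
  move=> x; apply: cvgD; first by apply: cvgM; [exact: continuous_ImE|exact: cp'].
  by apply: cvgMr; apply: cvgM; [exact: continuous_ReE|exact: cp].
move: hr hi; rewrite RintegralB //; last exact: rintZ.
rewrite RintegralZl // RintegralD //; last exact: rintZ.
rewrite RintegralZl // -r1 -m1 -r2 -m2.
move: (Cintegral _ _ _) (Cintegral _ _ _) => [p q] [r s] /= h1 h2.
by apply: cext => /=; lra.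
Qed.

Lemma mode_derivn phi l k : test_function a b phi ->
  Cintegral a b (fun x => E l x * ((phi^`(k))%classic x)%:C%C) =
  (- ('i%C * (freq l)%:C%C)) ^+ k * Cintegral a b (fun x => E l x * (phi x)%:C%C).
Proof.
move=> t; elim: k => [|k IH]; first by rewrite expr0 mul1r derive1n0.
by rewrite derive1nS mode_deriv ?IH ?exprS ?mulrA //; exact: test_derivn.
Qed.

(** Integration by parts is explicit on each mode; [pairing_modes] transfers
    it to [u] and [w]. *)
Lemma weak_of_coef u w k : inL2 u -> inL2 w ->
  (forall l, fcoef w l = ('i%C * (freq l)%:C%C) ^+ k * fcoef u l) ->
  weak_derivative k u w.
Proof.
move=> Lu Lw h phi t.
have Lp := inL2_test hab t; have Lpk := inL2_test hab (test_derivn k t).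
rewrite -CintegralZ; last by have [] := Cintegral_mulC hab (inL2_Cint Lw) (test_cont t).
rewrite (_ : (fun x => (-1) ^+ k * _) = (fun x => (((-1) ^+ k) * w x) * (phi x)%:C%C)); last first.
  by apply/funext => x; rewrite mulrA.
apply: (pairing_modes hab) => // [|l]; first exact: inL2Z.
rewrite mode_derivn // fcoefZ; last exact: inL2_Cint.
rewrite h [in LHS]exprNn.
move: (fcoef u l) (Cintegral _ _ _) => f C.
move: ((_ * _) ^+ k : R[i]) => p; move: ((-1) ^+ k : R[i]) => s; ring.
Qed.

Lemma weak_unique u w w' k : Cint w -> Cint w' ->
  weak_derivative k u w -> weak_derivative k u w' -> ae_eqD w w'.
Proof.
move=> iw iw' h h'; apply: (test_Cintegral_eq hab) => // phi t.
have s0 : (-1 : R[i]) ^+ k != 0 by rewrite expf_neq0 // oppr_eq0 oner_eq0.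
by apply: (mulfI s0); rewrite -h // h'.
Qed.

Lemma weak0_ae u w : Cint u -> Cint w -> weak_derivative 0 u w -> ae_eqD u w.
Proof.
move=> iu iw h; apply: (test_Cintegral_eq hab) => // phi t.
by have := h phi t; rewrite expr0 mul1r.
Qed.

Lemma weakB u u' w w' k : Cint u -> Cint u' -> Cint w -> Cint w' ->
  weak_derivative k u w -> weak_derivative k u' w' ->
  weak_derivative k (fun x => u x - u' x) (fun x => w x - w' x).
Proof.
move=> iu iu' iw iw' h h' phi t.
have [iup _ _] := Cintegral_mulC hab iu (test_cont (test_derivn k t)).
have [iup' _ _] := Cintegral_mulC hab iu' (test_cont (test_derivn k t)).
have [iwp _ _] := Cintegral_mulC hab iw (test_cont t).
have [iwp' _ _] := Cintegral_mulC hab iw' (test_cont t).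
have e1 (f g : R -> R[i]) (p : R -> R) : (fun x => (f x - g x) * (p x)%:C%C) = (fun x => f x * (p x)%:C%C - g x * (p x)%:C%C).
  by apply/funext => x; rewrite mulrBl.
by rewrite !e1 !CintegralB // h // h' // mulrBr.
Qed.

Lemma wderivP u w k : inL2 w -> weak_derivative k u w ->
  [/\ inL2 (wderiv a b k u), weak_derivative k u (wderiv a b k u) & ae_eqD (wderiv a b k u) w].
Proof.
move=> Lw h.
have [L' h'] : (fun w => inL2 w /\ weak_derivative k u w) (wderiv a b k u).
  by apply: (@xgetPex _ (fun=> 0) [set w | inL2 w /\ weak_derivative k u w]); exists w.
by split=> //; exact: (weak_unique (inL2_Cint L') (inL2_Cint Lw) h' h).
Qed.

Lemma inL2_within w : {within `[a, b], continuous (@complex.Re R \o w)} ->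
  {within `[a, b], continuous (@complex.Im R \o w)} -> inL2 w.
Proof.
move=> cr ci.
have [K1 K10 h1] := continuous_bounded hab cr; have [K2 K20 h2] := continuous_bounded hab ci.
have me (f : R -> R) : {within `[a, b], continuous f} -> measurable_fun D f.
  move=> c; apply: (@measurable_funS _ _ _ _ `[a, b]) => //; first exact: subset_itv_oo_cc.
  exact: subspace_continuous_measurable_fun.
apply: (@inL2_bounded _ _ _ _ (K1 ^+ 2 + K2 ^+ 2)); first by split; exact: me.
move=> x /andP[ax xb]; have xab : a <= x <= b by rewrite !ltW.
have := h1 x xab; have := h2 x xab => /= g2 g1.
rewrite /sq lerD // -real_normK ?num_real // ler_sqr ?nnegrE //.
Qed.

(** A weakly differentiable function is a primitive of its weak derivative up
    to a constant, so that equal boundary values make the derivative have mean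
    zero and differentiation act on the coefficients as i mu_l. *)
Lemma weak1_fcoef u w0 w1 l : inL2 u -> inL2 w1 ->
  weak_derivative 0 u w0 ->
  {within `[a, b], continuous (@complex.Re R \o w0)} ->
  {within `[a, b], continuous (@complex.Im R \o w0)} -> w0 a = w0 b ->
  weak_derivative 1 u w1 ->
  fcoef w1 l = 'i%C * (freq l)%:C%C * fcoef u l.
Proof.
move=> Lu Lw1 h0 cr ci wab h1.
have iu := inL2_Cint Lu; have iw1 := inL2_Cint Lw1; have iw0 := inL2_Cint (inL2_within cr ci).
pose P := cprim a b w1; have iP : Cint P := Cint_cprim hab iw1.
have [k hk] : exists k, ae_eqD (fun x => u x - P x) (fun=> k).
  apply: (weak_cst hab); first exact: CintB.
  move=> phi t; have t' := test_deriv t.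
  have [iup _ _] := Cintegral_mulC hab iu (test_cont t').
  have [iPp _ _] := Cintegral_mulC hab iP (test_cont t').
  rewrite (_ : (fun x => _) = (fun x => u x * ((phi^`())%classic x)%:C%C - P x * ((phi^`())%classic x)%:C%C)); last first.
    by apply/funext => x; rewrite mulrBl.
  rewrite CintegralB // -derive1n1 h1 // expr1 mulN1r.
  have d1 (x : R) := test_is_derive x t.
  have d2 (x : R) : is_derive x 1 (fun=> 0 : R) 0 by exact: is_derive_cst.
  rewrite (@cprim_by_parts _ _ _ hab w1 (fun x => (phi x)%:C%C)
    (fun x => ((phi^`())%classic x)%:C%C) iw1 d1 d2 (test_cont t') (fun x => cvg_cst _)).
  by rewrite [phi b](test_out t) ?ltxx ?andbF // mulr0 sub0r opprK addNr.
have h0' := weak0_ae iu iw0 h0.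
have ae0 : {ae mu, forall x, D x -> w0 x - k - P x = 0}.
  apply: aeS2 hk h0' => x hk h0' xD; rewrite -h0' // -(hk xD); ring.
have [ru ri] := iw1.
have z x : a <= x <= b -> w0 x - k - P x = 0.
  move=> xab; apply: cext.
  - apply: (ae0_continuous hab (h := fun x => Re (w0 x - k - P x))) xab => [y|].
    + have -> : (fun x => Re (w0 x - k - P x)) = (fun x => Re (w0 x) - Re k - prim a b (fun x => Re (w1 x)) x).
        by apply/funext => x'; rewrite !ReD !ReN.
      apply: cvgB; last exact: (continuous_prim hab ru).
      by apply: cvgB; [exact: cr|exact: cvg_cst].
    + by apply: aeS ae0 => y h yD; rewrite h.
  - apply: (ae0_continuous hab (h := fun x => Im (w0 x - k - P x))) xab => [y|].
    + have -> : (fun x => Im (w0 x - k - P x)) = (fun x => Im (w0 x) - Im k - prim a b (fun x => Im (w1 x)) x).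
        by apply/funext => x'; rewrite !ImD !ImN.
      apply: cvgB; last exact: (continuous_prim hab ri).
      by apply: cvgB; [exact: ci|exact: cvg_cst].
    + by apply: aeS ae0 => y h yD; rewrite h.
have Pb : P b = 0.
  have za := z a; have zb := z b.
  move: za zb; rewrite !lexx !(ltW hab) => /(_ isT) za /(_ isT).
  rewrite -wab; move: za; rewrite /P cprim_a subr0 => -> ; rewrite sub0r => /eqP.
  by rewrite oppr_eq0 => /eqP.
have hP : fcoef u l = (if 0 == l then k else 0) + fcoef P l.
  rewrite -(fcoef_cst hab) -fcoefD //; last exact/inL2_Cint/inL2_cst.
  apply: ae_fcoef; [exact: inL2_meas|by apply: CmeasD; [exact: Cmeas_cst|exact: Cint_meas]|].
  by apply: aeS hk => x h xD; rewrite -(h xD); ring.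
rewrite hP mulrDr (fcoef_cprim hab l iw1) -/P Pb mulr0 subr0.
by case: eqP => [<-|_]; rewrite ?freq0 ?mulr0 ?mul0r add0r.
Qed.

(** What the sequel needs to know of a function of H^2_per. *)
Definition per2 u := inL2 u /\ exists w, [/\ inL2 w, weak_derivative 2 u w &
  forall l, fcoef w l = - (freq l ^+ 2)%:C%C * fcoef u l].

(** [weak1_fcoef] applies to [u], and then to the continuous representative of its
    first derivative. *)
Lemma inHper_per2 u : inHper a b 2 u -> per2 u.
Proof.
move=> [[Lu hm] hp]; split=> //.
have [w2 [Lw2 h2]] := hm 2%N isT.
have [w0 [h0 c0r c0i w0ab]] := hp 0%N isT.
have [w1 [h1 c1r c1i w1ab]] := hp 1%N isT.
have Lw1 := inL2_within c1r c1i.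
exists w2; split=> // l.
have h1' : weak_derivative 1 w1 w2.
  move=> phi t; have t' := test_deriv t.
  have := h1 _ t'; have := h2 _ t.
  rewrite derive1nS !derive1n1 => -> ; rewrite sqrrN expr1n expr1 mulN1r mul1r => ->.
  by rewrite mulN1r opprK.
rewrite (weak1_fcoef l Lw1 Lw2 _ c1r c1i w1ab h1'); last first.
  by move=> phi t; rewrite expr0 mul1r.
rewrite (weak1_fcoef l Lu Lw1 h0 c0r c0i w0ab h1).
by move: (freq l) (fcoef u l) => m [p q]; apply: cext => /=; ring.
Qed.

Lemma per2B u v : per2 u -> per2 v -> per2 (fun x => u x - v x).
Proof.
move=> [Lu [w [Lw hw cw]]] [Lv [z [Lz hz cz]]]; split; first exact: inL2B.
exists (fun x => w x - z x); split; first exact: inL2B.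
  by apply: weakB => //; exact: inL2_Cint.
by move=> l; rewrite !fcoefB ?cw ?cz ?mulrBr //; exact: inL2_Cint.
Qed.

Lemma half_mono (x y : \bar R) : (0 <= x -> x <= y -> x `^ 2^-1 <= y `^ 2^-1)%E.
Proof.
move=> x0 xy; have y0 := le_trans x0 xy.
by apply: gt0_ler_poweR; rewrite ?invr_ge0 // in_itv /= ?x0 ?y0 leey.
Qed.

Lemma Hnorm_wderiv m u (B : R) k : (Hnorm a b m u <= B%:E)%E -> 0 <= B -> (k <= m)%N ->
  [/\ inL2 (wderiv a b k u), weak_derivative k u (wderiv a b k u) &
      (L2norm a b (wderiv a b k u) <= B%:E)%E].
Proof.
rewrite /Hnorm; case: asboolP => [[Lu hm]|_]; last by rewrite leye_eq.
move=> hB B0 km; have [w [Lw hw]] := hm k km.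
have [Lk hk _] := wderivP Lw hw; split=> //.
have nn (x : \bar R) : (0 <= x ^+ 2)%E by exact: sqre_ge0.
have h1 : ((L2norm a b (wderiv a b k u)) ^+ 2 <= \sum_(k < m.+1) L2norm a b (wderiv a b k u) ^+ 2)%E.
  have km' : (k < m.+1)%N by [].
  rewrite (bigD1 (Ordinal km')) //=; apply: leeDl; apply: sume_ge0 => i _; exact: nn.
have h2 : ((L2norm a b (wderiv a b k u) ^+ 2) `^ 2^-1 <= B%:E)%E.
  apply: le_trans hB; apply: half_mono; [exact: nn|exact: h1].
move: h2; rewrite L2normE // -EFin_expe poweR_EFin powR12_sqrt ?sqr_ge0 //.
by rewrite sqrtr_sqr ger0_norm ?sqrtr_ge0.
Qed.

Lemma per2_Hnorm u (B : R) : per2 u -> (Hnorm a b 2 u <= B%:E)%E -> 0 <= B ->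
  l2le a b (fcoef u) B /\ l2le a b (fun l => (freq l ^+ 2)%:C%C * fcoef u l) B.
Proof.
move=> [Lu [w [Lw hw cw]]] hB B0; split.
- have [L0 h0 n0] := Hnorm_wderiv hB B0 (isT : 0 <= 2)%N.
  have ae0 := weak0_ae (inL2_Cint Lu) (inL2_Cint L0) h0.
  have -> : fcoef u = fcoef (wderiv a b 0 u).
    by apply/funext => l; apply: ae_fcoef => //; exact: inL2_meas.
  by apply/L2norm_l2le.
- have [L2 h2 n2] := Hnorm_wderiv hB B0 (isT : 2 <= 2)%N.
  have ae2 := weak_unique (inL2_Cint L2) (inL2_Cint Lw) h2 hw.
  have /(L2norm_l2le hab L2 B0) := n2.
  apply: (l2le_dom hab) => l; rewrite (ae_fcoef l _ _ ae2) ?cw ?mulNr ?sqN //; exact: inL2_meas.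
Qed.

(** A bound by B on each of the at most three terms gives at most
    sqrt 3 B <= 2 B. *)
Lemma Hnorm_coef m u (B : R) : (m <= 2)%N -> 0 <= B -> inL2 u ->
  (forall k, (k <= m)%N -> l2le a b (fun l => (freq l ^+ k)%:C%C * fcoef u l) B) ->
  (Hnorm a b m u <= (2 * B)%:E)%E.
Proof.
move=> m2 B0 Lu h.
have ex k : (k <= m)%N -> exists w, [/\ inL2 w, weak_derivative k u w &
    l2le a b (fcoef w) B].
  move=> km.
  have hk : l2le a b (fun l => ('i%C * (freq l)%:C%C) ^+ k * fcoef u l) B.
    apply: (l2le_dom hab) (h k km) => l; rewrite exprMn rmorphXn /= -mulrA sqM.
    suff -> : sq ('i%C ^+ k : R[i]) = 1 by rewrite mul1r.
    by elim: k {km} => [|k IH]; [rewrite expr0 -[1]/(1%:C%C) sqC expr1n|rewrite exprS sqM IH sqi mulr1].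
  have [w Lw cw] := l2le_fun hab hk; exists w; split; rewrite ?cw //.
  by apply: weak_of_coef => // l; rewrite cw.
rewrite /Hnorm; case: asboolP => [_|]; last first.
  by case; split=> // k /ex[w [Lw hw _]]; exists w.
have nb k : (k <= m)%N -> (L2norm a b (wderiv a b k u) ^+ 2 <= (B ^+ 2)%:E)%E.
  move=> /ex[w [Lw hw cw]]; have [Lk _ aek] := wderivP Lw hw.
  have : (L2norm a b (wderiv a b k u) <= B%:E)%E.
    apply/(L2norm_l2le hab Lk B0).
    have -> // : fcoef (wderiv a b k u) = fcoef w.
    by apply/funext => l; apply: ae_fcoef => //; exact: inL2_meas.
  rewrite L2normE // -EFin_expe !lee_fin => hle.
  by rewrite ler_sqr ?nnegrE ?sqrtr_ge0.
have hs : (\sum_(k < m.+1) L2norm a b (wderiv a b k u) ^+ 2 <= ((2 * B) ^+ 2)%:E)%E.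
  apply: (@le_trans _ _ (\sum_(k < m.+1) (B ^+ 2)%:E)%E).
    by apply: lee_sum => k _; apply: nb; rewrite -ltnS.
  rewrite sumEFin lee_fin sumr_const card_ord -[leLHS]mulr_natl exprMn.
  by rewrite ler_wpM2r ?sqr_ge0 // -natrX ler_nat; lia.
apply: (@le_trans _ _ ((((2 * B) ^+ 2)%:E) `^ 2^-1)%E).
  apply: half_mono => //; by apply: sume_ge0 => k _; exact: sqre_ge0.
rewrite poweR_EFin powR12_sqrt ?sqr_ge0 // sqrtr_sqr ger0_norm ?mulr_ge0 //.
Qed.

End Weak.

(** * The functions phi_1 and phi_s *)

Section Phi.
Context {R : realType}.
Implicit Types t h d : R.

(** Both exponential integrators have symbols expressed by this function; every
    property used below follows from [Phi_eq]. *)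
Definition Phi t : R[i] := phi_1 ('i%C * t%:C%C).

Lemma Phi_eq t : 'i%C * t%:C%C * Phi t = cis t - 1.
Proof.
rewrite /Phi /phi_1 cexp_i; case: eqP => [it0|/eqP it0]; last by rewrite mulrC divfK.
have -> : t = 0 by have := congr1 (@complex.Im R) it0; rewrite /= mul0r add0r mul1r.
by rewrite cis0 mulr0 mul0r subrr.
Qed.

Lemma normr_sin_le t : `|sin t| <= `|t|.
Proof.
suff pos (x : R) : 0 <= x -> `|sin x| <= x.
  have [t0|t0] := leP 0 t; first by rewrite (ger0_norm t0) pos.
  by rewrite -normrN -sinN (ltr0_norm t0) pos // oppr_ge0 ltW.
rewrite le_eqVlt => /predU1P[<-|x0]; first by rewrite sin0 normr0.
have dsin (y : R) : y \in `]0, x[ -> is_derive y 1 (@sin R) (cos y) by move=> _; exact: is_derive_sin.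
have [c _] := MVT x0 dsin (continuous_subspaceT (@continuous_sin R)).
rewrite sin0 !subr0 => ->; rewrite normrM (gtr0_norm x0) ler_piMl ?(ltW x0) //.
by rewrite ler_norml cos_geN1 cos_le1.
Qed.

Lemma sq_cis_sub1 t : sq (cis t - 1) <= t ^+ 2.
Proof.
have -> : sq (cis t - 1) = (2 * sin (t / 2)) ^+ 2.
  have e : t = t / 2 + t / 2 by field.
  have c : cos t = 1 - 2 * sin (t / 2) ^+ 2.
    rewrite {1}e cosD; have := cos2Dsin2 (t / 2); move: (cos _) (sin _) => x y; nra.
  have s2 := cos2Dsin2 t.
  rewrite /sq ReD ImD ReN ImN Re_cis Im_cis /= oppr0 addr0.
  rewrite sqrrB1 -addrA (addrC 1) addrAC addrA; move: s2 c; move: (cos t) (sin t) (sin _) => x y z; nra.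
rewrite -real_normK ?num_real // -[leRHS]real_normK ?num_real // ler_sqr ?nnegrE //.
rewrite normrM (ger0_norm (ler0n R 2)) (le_trans (ler_wpM2l _ (normr_sin_le _))) //.
by rewrite normrM normfV (ger0_norm (ler0n R 2)) mulrC divfK.
Qed.

Lemma sq_Phi_le1 t : sq (Phi t) <= 1.
Proof.
have [->|t0] := eqVneq t 0.
  by rewrite /Phi /phi_1 mulr0 eqxx -[1]/(1%:C%C) sqC expr1n.
have t20 : 0 < t ^+ 2 by rewrite exprn_even_gt0.
rewrite -(ler_pM2l t20) mulr1.
by have := sq_cis_sub1 t; rewrite -Phi_eq !sqM sqi mul1r sqC.
Qed.

Lemma cis_phi_s t : cis t * (phi_s t)%:C%C = Phi (2 * t).
Proof.
have [->|t0] := eqVneq t 0.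
  by rewrite /Phi /phi_1 /phi_s !mulr0 !eqxx cis0 mulr1.
have i0 : 'i%C * (2 * t)%:C%C != 0 :> R[i].
  by apply/eqP => /(congr1 (@complex.Im R)) /=; rewrite mul0r add0r mul1r => /eqP; rewrite mulf_eq0 (negbTE t0) orbF pnatr_eq0.
apply: (mulfI i0); rewrite Phi_eq /phi_s (negbTE t0).
have e : 2 * t = t + t by ring.
have s2 := cos2Dsin2 t.
rewrite {2}e cisD; apply: cext; rewrite !(ReM, ImM, ReD, ImD, ReN, ImN) Re_cis Im_cis /=.
  have -> : cos t * cos t - sin t * sin t = - 2 * sin t ^+ 2 + 1.
    by move: s2; move: (cos t) (sin t) => x y; nra.
  by field.
by field.
Qed.

End Phi.

(** * Fourier multipliers and the Sobolev bound *)

Section Mult.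
Context {R : realType} (a b : R) (hab : a < b).
Implicit Types (u v w : R -> R[i]) (c : int -> R[i]).
Local Notation mu := (@lebesgue_measure R).
Local Notation D := (`]a, b[%classic : set R).
Local Notation L := (b - a).
Local Notation E := (E a b).
Local Notation freq := (freq a b).
Local Notation fcoef := (fcoef a b).
Local Notation inL2 := (inL2 a b).

Lemma L2norm_cvg0 (f : nat -> R -> R[i]) : (forall N, inL2 (f N)) ->
  (L2norm a b (f N) @[N --> \oo] --> 0%E) <-> (nsq a b (f N) @[N --> \oo] --> (0 : R)).
Proof.
move=> Lf.
have e : (fun N => L2norm a b (f N)) = (fun N => (Num.sqrt (nsq a b (f N)))%:E).
  by apply/funext => N; rewrite L2normE.
rewrite e; split.
  move=> /fine_cvgP[_ h].
  have -> : (fun N => nsq a b (f N)) = (fun N => Num.sqrt (nsq a b (f N)) ^+ 2).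
    by apply/funext => N; rewrite sqr_sqrtr ?nsq_ge0.
  have -> : (fun N => Num.sqrt (nsq a b (f N)) ^+ 2) = (fun N => Num.sqrt (nsq a b (f N)) * Num.sqrt (nsq a b (f N))).
    by apply/funext => N; rewrite expr2.
  have h' : Num.sqrt (nsq a b (f N)) @[N --> \oo] --> (0 : R) by exact: h.
  by have := cvgM h' h'; rewrite mulr0; apply.
move=> h; apply: cvg_EFin; first exact: nearW.
rewrite -[X in _ --> X](sqrtr0 R).
apply: (@cvg_comp _ _ _ (fun N => nsq a b (f N)) (@Num.sqrt R) _ (nbhs (0 : R))) h _.
exact: sqrt_continuous.
Qed.

Lemma fmultP (m : R -> R[i]) u (K : R) : inL2 u ->
  (forall d, sq (m d) <= K ^+ 2) ->
  inL2 (fmult a b m u) /\ forall l, fcoef (fmult a b m u) l = m (- freq l ^+ 2) * fcoef u l.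
Proof.
move=> Lu hm; pose c l := m (- freq l ^+ 2) * fcoef u l.
have hc : l2le a b c (`|K| * Num.sqrt (nsq a b u)).
  have h0 : l2le a b (fcoef u) (Num.sqrt (nsq a b u)).
    by apply/(parseval hab) => //; rewrite sqr_sqrtr ?nsq_ge0.
  move=> N; have := l2leZ hab (z := (K%:C)%C) (k := `|K|) _ h0 N.
  rewrite sqC real_normK ?num_real // => /(_ (lexx _)); apply: le_trans.
  rewrite ler_pM2l ?subr_gt0 //; apply: ler_ssum => l.
  by rewrite /c (sqM (m _)) (sqM (K%:C)%C) sqC; apply: ler_wpM2r; [exact: sq_ge0|exact: hm].
have [g Lg gc] := l2le_fun hab hc.
pose term l x : R[i] := m (- freq l ^+ 2) * fcoef u l * cexp ('i%C * (freq l * (x - a))%:C%C).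
have tE N x : \sum_(k < (2 * N).+1) term (k%:Z - N%:Z) x = psum a b c N x.
  by apply: eq_bigr => k _; rewrite /term cexp_i.
pose S := [set g | inL2 g /\
    L2norm a b (fun x => g x - \sum_(k < (2 * N).+1) term (k%:Z - N%:Z) x) @[N --> \oo] --> 0%E].
have eqS w : inL2 w -> (fun N => L2norm a b (fun x => w x - \sum_(k < (2 * N).+1) term (k%:Z - N%:Z) x)) =
    (fun N => L2norm a b (fun x => w x - psum a b c N x)).
  by move=> _; apply/funext => N; congr L2norm; apply/funext => x; rewrite tE.
have LB w : inL2 w -> forall N, inL2 (fun x => w x - psum a b c N x).
  by move=> Lw N; apply: inL2B => //; exact: inL2_psum.
have Sg : S g.
  split=> //; rewrite eqS //; apply/(L2norm_cvg0 (LB _ Lg)).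
  by rewrite -gc; exact: psum_cvg.
have [Lf hf] : S (fmult a b m u) by apply: (@xgetPex _ (fun=> 0) S); exists g.
split=> // l; move: hf; rewrite eqS // => /(L2norm_cvg0 (LB _ Lf)) hf.
exact: (fcoef_lim hab l Lf hf).
Qed.

Let w := 2 * pi / L : R.

(** Telescoping: 1 / n^2 <= 2 (1 / n - 1 / (n + 1)). *)
Lemma ssum_inv_freq N : ssum N (fun l => (1 + freq l ^+ 2)^-1) <= 1 + 4 / w ^+ 2.
Proof.
have w0 : 0 < w by rewrite divr_gt0 ?subr_gt0 // mulr_gt0 ?pi_gt0.
have fE l : freq l = w * l%:~R by rewrite /Defs.freq /w; ring.
suff h : ssum N (fun l => (1 + freq l ^+ 2)^-1) <= 1 + 4 / w ^+ 2 * (1 - N.+1%:R^-1).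
  apply: le_trans h _; rewrite lerD2l; apply: ler_piMr.
    by rewrite divr_ge0 // sqr_ge0.
  by rewrite lerBlDr lerDl invr_ge0.
elim: N => [|N IH].
  by rewrite ssum0 freq0 expr0n /= addr0 invr1 subrr mulr0 addr0.
rewrite ssum_recr (freqN a b) sqrrN -mulr2n.
apply: (le_trans (lerD IH (lexx _))).
rewrite fE -[(N.+1%:Z)%:~R]/(N.+1%:R) [(w * _) ^+ 2]exprMn.
set n := N.+1%:R : R; have n0 : 1 <= n by rewrite /n ler1n.
have -> : N.+2%:R = n + 1 by rewrite /n -[N.+2]addn1 natrD.
have h1 : (1 + w ^+ 2 * n ^+ 2)^-1 <= (w ^+ 2 * n ^+ 2)^-1.
  have q0 : 0 < w ^+ 2 * n ^+ 2 by rewrite mulr_gt0 ?exprn_gt0 //; exact: lt_le_trans n0.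
  by rewrite lef_pV2 ?posrE ?lerDr // addr_gt0.
have h2 : (n ^+ 2)^-1 <= 2 * (n^-1 - (n + 1)^-1).
  rewrite -subr_ge0 (_ : _ - _ = (n - 1) / (n ^+ 2 * (n + 1))); last by field; lra.
  by rewrite divr_ge0 ?mulr_ge0 ?sqr_ge0; lra.
rewrite -addrA lerD2l mulr2n.
have -> : 4 / w ^+ 2 * (1 - (n + 1)^-1) =
   4 / w ^+ 2 * (1 - n^-1) + (w ^+ 2)^-1 * (4 * (n^-1 - (n + 1)^-1)) by ring.
rewrite lerD2l.
have h3 := ler_wpM2l (_ : 0 <= (w ^+ 2)^-1) h2.
move: h1; rewrite invfM => h1.
have := h3 _; rewrite invr_ge0 sqr_ge0 => /(_ isT).
move=> h4; apply: (le_trans (lerD (le_trans h1 h4) (le_trans h1 h4))).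
by rewrite le_eqVlt; apply/orP; left; apply/eqP; ring.
Qed.

Definition sob : R := (L^-1 + 1 + 4 / w ^+ 2) / 2.

Lemma sob_ge0 : 0 <= sob.
Proof.
have L0 : 0 <= L by rewrite subr_ge0 ltW.
by rewrite divr_ge0 // !addr_ge0 ?divr_ge0 ?invr_ge0 ?sqr_ge0.
Qed.

(** Weighted arithmetic-geometric mean with weights 1 + mu_l^2, whose inverses
    are summable. *)
Lemma l2le_ssum c (A B : R) N : 0 < A -> 0 <= B -> l2le a b c A ->
  l2le a b (fun l => (freq l)%:C%C * c l) B -> ssum N (fun l => normc (c l)) <= sob * (A + B).
Proof.
move=> A0 B0 hA hB.
have L0 : 0 < L by rewrite subr_gt0.
pose M := A + B; have M0 : 0 < M by rewrite ltr_wpDr.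
have step l : normc (c l) <= (2 * M)^-1 * (sq (c l) + sq ((freq l)%:C%C * c l)) + M / 2 * (1 + freq l ^+ 2)^-1.
  rewrite sqM sqC -sqr_normc; set x := normc _; set m := freq l ^+ 2.
  have q0 : 0 < 1 + m by rewrite ltr_pwDl // sqr_ge0.
  rewrite -subr_ge0 (_ : _ - _ = ((1 + m) * x - M) ^+ 2 / (2 * M * (1 + m))); last first.
    by field; rewrite !gt_eqF.
  by rewrite divr_ge0 ?sqr_ge0 // !mulr_ge0 // ltW.
apply: le_trans (ler_ssum N step) _; rewrite ssumD !ssumZ ssumD.
have h1 : ssum N (fun l => sq (c l)) + ssum N (fun l => sq ((freq l)%:C%C * c l)) <= L^-1 * M ^+ 2.
  rewrite -(ler_pM2l L0) mulrA divff ?gt_eqF // mul1r mulrDr.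
  apply: (le_trans (lerD (hA N) (hB N))); rewrite /M; have := mulr_ge0 (ltW A0) B0; nra.
have h2 := ssum_inv_freq N.
have i0 : 0 <= (2 * M)^-1 by rewrite invr_ge0 mulr_ge0 // ltW.
have j0 : 0 <= M / 2 by rewrite divr_ge0 // ltW.
apply: (le_trans (lerD (ler_wpM2l i0 h1) (ler_wpM2l j0 h2))).
rewrite /sob -/M le_eqVlt; apply/orP; left; apply/eqP.
move: (4 / _) => q; field; by rewrite !gt_eqF.
Qed.

Lemma psum_normc_le c N x : normc (psum a b c N x) <= ssum N (fun l => normc (c l)).
Proof.
have nE l : normc (E l x) = 1 by rewrite normcE sq_E sqrtr1.
rewrite /psum /ssum.
elim/big_ind2: _ => [|u r v s hu hv|k _]; first by rewrite normcE sq0 sqrtr0.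
  exact: le_trans (normcD _ _) (lerD hu hv).
by rewrite normcM nE mulr1.
Qed.

(** The positive part of |u| - M is dominated by |u - f N| for every N, so its
    L^2 norm is zero. *)
Lemma L2_limit_bounded u (f : nat -> R -> R[i]) (M : R) : inL2 u -> (forall N, inL2 (f N)) ->
  (forall N x, normc (f N x) <= M) ->
  nsq a b (fun x => u x - f N x) @[N --> \oo] --> (0 : R) ->
  {ae mu, forall x, D x -> normc (u x) <= M}.
Proof.
move=> Lu Lf hM lim.
pose g x : R[i] := (Num.max 0 (normc (u x) - M))%:C%C.
have gle N x : sq (g x) <= sq (u x - f N x).
  rewrite /g sqC -sqr_normc.
  have h : normc (u x) - M <= normc (u x - f N x).
    rewrite lerBlDr (le_trans _ (lerD (lexx _) (hM N x))) //.
    by rewrite -{1}(subrK (f N x) (u x)); exact: normcD.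
  rewrite ler_sqr ?nnegrE ?normc_ge0 ?le_max ?lexx //; by rewrite ge_max normc_ge0 h.
have Ln N : inL2 (fun x => u x - f N x) by exact: inL2B.
have Lg : inL2 g.
  apply: inL2_dom (inL2_int (Ln 0%N)) _ => [|x _]; last exact: gle.
  apply: CmeasC; apply: measurable_maxr; first exact: measurable_cst.
  apply: measurable_funB; last exact: measurable_cst.
  apply: mf_eq (fun x => normcE _).
  apply: (measurableT_comp (continuous_measurable_fun (@sqrt_continuous R))).
  exact: (Cmeas_sq (inL2_meas Lu)).
have n0 : nsq a b g = 0.
  apply/eqP; rewrite eq_le nsq_ge0 andbT.
  rewrite -(cvg_lim _ lim) //; apply: limr_ge; first by apply/cvg_ex; exists 0.
  apply: nearW => N; apply: le_Rintegral => //; first [exact: inL2_int|by move=> x _; exact: gle].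
by apply: aeS (nsq_ae0 hab Lg n0) => x h xD; move/(congr1 (@complex.Re R)): (h xD) => /= /eqP; rewrite eq_maxl subr_le0.
Qed.

(** The coefficients are absolutely summable, and the partial sums are bounded by the
    sum of their moduli. *)
Lemma sobolev u (A B : R) : inL2 u -> 0 < A -> 0 <= B -> l2le a b (fcoef u) A ->
  l2le a b (fun l => (freq l)%:C%C * fcoef u l) B ->
  {ae mu, forall x, D x -> normc (u x) <= sob * (A + B)}.
Proof.
move=> Lu A0 B0 hA hB.
apply: (L2_limit_bounded Lu (fun N => inL2_psum a b (fcoef u) N)) (psum_cvg hab Lu) => N x.
by apply: le_trans (psum_normc_le _ _ _) _; exact: l2le_ssum.
Qed.

End Mult.

(** * The nonlinearity *)

Section Power.
Context {R : realType}.
Implicit Types (p r s M : R) (z w : R[i]).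

(** The factor s absorbs the singularity at 0 of the derivative of the power when
    p < 1. Writing s = r exp(ln s - ln r), this is exp x >= 1 + x together with
    ln x <= x - 1. *)
Lemma powR_sub_mul p r s : 0 < p -> 0 <= s -> s <= r ->
  (r `^ p - s `^ p) * s <= p * r `^ p * (r - s).
Proof.
move=> p0; rewrite le_eqVlt => /predU1P[<-|s0] sr.
  by rewrite mulr0 subr0 !mulr_ge0 ?powR_ge0 // ltW.
have r0 := lt_le_trans s0 sr.
rewrite /powR (gt_eqF r0) (gt_eqF s0).
set A := expR (p * ln r).
have eB : expR (p * ln s) = A * expR (p * (ln s - ln r)) by rewrite -expRD; congr expR; ring.
have h1 : A * (1 + p * (ln s - ln r)) <= expR (p * ln s).
  by rewrite eB ler_wpM2l ?expR_ge0 // expR_ge1Dx.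
have h2 : ln r - ln s <= r / s - 1.
  rewrite lerBrDl -ln_div ?posrE // (le_trans (expR_ge1Dx _)) // lnK ?posrE ?divr_gt0 //.
have h3 : (ln r - ln s) * s <= r - s.
  by rewrite -ler_pdivlMr // mulrBl divff ?gt_eqF.
have A0 : 0 <= p * A by rewrite mulr_ge0 ?expR_ge0 // ltW.
apply: (@le_trans _ _ (p * A * ((ln r - ln s) * s))); last exact: ler_wpM2l.
rewrite mulrA; apply: ler_wpM2r; first exact: ltW.
by rewrite lerBlDl -lerBlDr; apply: le_trans h1; rewrite le_eqVlt; apply/orP; left; apply/eqP; ring.
Qed.

Lemma powR_sqr sigma r : 0 <= r -> (r ^+ 2) `^ sigma = r `^ (2 * sigma).
Proof. by move=> r0; rewrite powRrM powR_mulrn. Qed.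

(** With |w| <= |z|, the difference is |z|^(2 sigma) (z - w) plus
    (|z|^(2 sigma) - |w|^(2 sigma)) w, to which [powR_sub_mul] applies. *)
Lemma nonlin_lip beta sigma M z w : 0 < sigma -> normc z <= M -> normc w <= M ->
  normc ((nonlin beta sigma (normc z ^+ 2))%:C%C * z - (nonlin beta sigma (normc w ^+ 2))%:C%C * w) <=
  `|beta| * ((2 * sigma + 1) * M `^ (2 * sigma)) * normc (z - w).
Proof.
move=> s0; wlog wz : z w / normc w <= normc z => [hw zM wM|zM wM].
  have [wz|/ltW zw] := leP (normc w) (normc z); first exact: hw.
  have nB (x y : R[i]) : normc (x - y) = normc (y - x) by rewrite !normcE sqB.
  by rewrite [leLHS]nB [normc (z - w)]nB; exact: hw.
rewrite /nonlin !powR_sqr ?normc_ge0 //; set p := 2 * sigma.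
have p0 : 0 < p by rewrite mulr_gt0.
have -> : (beta * normc z `^ p)%:C%C * z - (beta * normc w `^ p)%:C%C * w =
    beta%:C%C * ((normc z `^ p)%:C%C * (z - w) + (normc z `^ p - normc w `^ p)%:C%C * w).
  by rewrite !rmorphM !rmorphB /=; move: (_%:C)%C (_%:C)%C (_%:C)%C => x y t; ring.
rewrite normcM normcC -!mulrA; apply: ler_wpM2l => //.
apply: (le_trans (normcD _ _)); rewrite !normcM !normcC.
have np : normc w `^ p <= normc z `^ p.
  by apply: ge0_ler_powR; rewrite ?nnegrE ?normc_ge0 // ltW.
rewrite ger0_norm ?powR_ge0 // ger0_norm ?subr_ge0 //.
have h := powR_sub_mul p0 (normc_ge0 w) wz.
have tri : normc z - normc w <= normc (z - w).
  by rewrite lerBlDr (le_trans _ (normcD _ _)) // subrK.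
have hM : normc z `^ p <= M `^ p.
  by apply: ge0_ler_powR; rewrite ?nnegrE ?normc_ge0 ?(le_trans _ zM) ?normc_ge0 // ltW.
apply: (@le_trans _ _ (normc z `^ p * normc (z - w) + p * normc z `^ p * normc (z - w))).
  by rewrite lerD2l (le_trans h) // ler_wpM2l // mulr_ge0 ?powR_ge0 // ltW.
rewrite -[leLHS](_ : (p + 1) * normc z `^ p * normc (z - w) = _); last by ring.
rewrite [leRHS]mulrA; apply: ler_wpM2r; first exact: normc_ge0.
by apply: ler_wpM2l => //; rewrite addr_ge0 // ltW.
Qed.

End Power.

Section Bop.
Context {R : realType} (a b : R) (hab : a < b).
Implicit Types (u v w : R -> R[i]).
Local Notation mu := (@lebesgue_measure R).
Local Notation D := (`]a, b[%classic : set R).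
Local Notation inL2 := (inL2 a b).

Lemma ae_dom u v (K : R) : Cmeas a b u -> inL2 v -> 0 <= K ->
  {ae mu, forall x, D x -> sq (u x) <= K * sq (v x)} ->
  inL2 u /\ nsq a b u <= K * nsq a b v.
Proof.
move=> mu_ Lv K0 h.
have m1 : measurable_fun D (fun x => (sq (u x))%:E) by apply/measurable_EFinP; exact: Cmeas_sq.
have iv : mu.-integrable D (EFin \o (fun x => K * sq (v x))) by apply: rintZ; exact: inL2_int.
have m2 : measurable_fun D (fun x => (K * sq (v x))%:E) by have /integrableP[] := iv.
have le1 : (\int[mu]_(x in D) (sq (u x))%:E <= \int[mu]_(x in D) (K * sq (v x))%:E)%E.
  apply: ae_ge0_le_integral => //.
  - by move=> x _; rewrite lee_fin sq_ge0.
  - by move=> x _; rewrite lee_fin mulr_ge0 ?sq_ge0.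
have fin : (\int[mu]_(x in D) (sq (u x))%:E < +oo)%E.
  by apply: le_lt_trans le1 _; rewrite EFin_rint // ltry.
have iu : mu.-integrable D (EFin \o (fun x => sq (u x))).
  apply/integrableP; split => //.
  by apply: le_lt_trans fin; apply: ge0_le_integral => // [|x _]; [exact: measurableT_comp|rewrite lee_fin ger0_norm ?sq_ge0].
have Lu : inL2 u by apply/inL2P.
split=> //; move: le1; rewrite !EFin_rint // lee_fin RintegralZl //; exact: inL2_int.
Qed.

Lemma inLinfty_ae (V : R -> R) : inLinfty a b V ->
  measurable_fun D V /\ exists M : R, {ae mu, forall x, D x -> `|V x| <= M}.
Proof.
rewrite /inLinfty inE => /andP[]; rewrite !inE /= => mV fV.
split; first exact/(measurable_restrictT _ (measurable_itv _)).
have mpos : (0 < mu [set: R])%E.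
  apply: (@lt_le_trans _ _ (mu D)); last first.
    by apply: le_measure; rewrite ?inE //; exact: measurable_itv.
  by rewrite lebesgue_measure_itv /= lte_fin hab lte_fin subr_gt0.
move: fV; rewrite /finite_norm unlock /= mpos.
set S := ess_sup_inf.ess_sup _ _ => Sfin.
have h : {ae mu, forall x, (abse (V \_ D x)%:E <= S)%E} by exact: ess_sup_inf.ess_sup_ge.
exists (fine S); apply: aeS h => x; rewrite patchE => h xD; move: h; rewrite mem_set //.
by case: (S) Sfin => [r| |] //=; rewrite lee_fin.
Qed.

Context (V : R -> R) (hV : inLinfty a b V) (beta sigma : R) (s0 : 0 < sigma).

Lemma Cmeas_Bop v : Cmeas a b v -> Cmeas a b (Bop V beta sigma v).
Proof.
move=> mv; have [mV _] := inLinfty_ae hV.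
apply: CmeasD; first by apply: CmeasM => //; exact: CmeasC.
apply: CmeasM => //; apply: CmeasC; apply: measurable_funM; first exact: measurable_cst.
apply: (measurableT_comp (measurable_powR sigma)).
by apply: mf_eq (fun x => sqr_normc _); exact: Cmeas_sq.
Qed.

Lemma Bop_lip (M : R) : exists2 K : R, 0 <= K & forall v w, inL2 v -> inL2 w ->
  {ae mu, forall x, D x -> normc (v x) <= M} ->
  {ae mu, forall x, D x -> normc (w x) <= M} ->
  [/\ inL2 (Bop V beta sigma v),
      inL2 (fun x => Bop V beta sigma v x - Bop V beta sigma w x) &
      nsq a b (fun x => Bop V beta sigma v x - Bop V beta sigma w x) <=
      K ^+ 2 * nsq a b (fun x => v x - w x)].
Proof.
have [mV [N hN]] := inLinfty_ae hV.
pose K0 := `|beta| * ((2 * sigma + 1) * M `^ (2 * sigma)).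
have K00 : 0 <= K0 by rewrite !mulr_ge0 ?powR_ge0 // addr_ge0 // mulr_ge0 // ltW.
have lip v w : inL2 v -> inL2 w ->
  {ae mu, forall x, D x -> normc (v x) <= M} ->
  {ae mu, forall x, D x -> normc (w x) <= M} ->
  {ae mu, forall x, D x -> sq (Bop V beta sigma v x - Bop V beta sigma w x) <= (`|N| + K0) ^+ 2 * sq (v x - w x)}.
  move=> Lv Lw hv hw.
  apply: aeS2 hN (aeS2 (fun x p q => conj p q) hv hw) => x hN' [hv' hw'] xD.
  have {}hN' := hN' xD; have {}hv' := hv' xD; have {}hw' := hw' xD.
  have -> : Bop V beta sigma v x - Bop V beta sigma w x = (V x)%:C%C * (v x - w x) +
     ((nonlin beta sigma (normc (v x) ^+ 2))%:C%C * v x - (nonlin beta sigma (normc (w x) ^+ 2))%:C%C * w x).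
    by rewrite /Bop; ring.
  rewrite -!sqr_normc -exprMn ler_sqr ?nnegrE ?mulr_ge0 ?addr_ge0 ?normc_ge0 //.
  apply: (le_trans (normcD _ _)); rewrite mulrDl; apply: lerD; last exact: nonlin_lip.
  by rewrite normcM normcC ler_wpM2r ?normc_ge0 // (le_trans hN') // ler_norm.
exists (`|N| + K0); first exact: addr_ge0.
move=> v w Lv Lw hv hw.
have mB u : inL2 u -> Cmeas a b (Bop V beta sigma u) by move/inL2_meas; exact: Cmeas_Bop.
have L0 : inL2 (fun=> 0) by exact: inL2_cst.
have B0 x : Bop V beta sigma (fun=> 0) x = 0 by rewrite /Bop !mulr0 addr0.
split.
- have h0 : {ae mu, forall x, D x -> normc ((fun=> 0 : R[i]) x) <= M}.
    by apply: aeS hv => x h xD; apply: le_trans (h xD); rewrite normcE sq0 sqrtr0 normc_ge0.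
  have := lip v _ Lv L0 hv h0 => hB.
  have [] // := @ae_dom (Bop V beta sigma v) v ((`|N| + K0) ^+ 2) (mB _ Lv) Lv (sqr_ge0 _).
  by apply: aeS hB => x; rewrite B0 !subr0.
- have [] // := @ae_dom (fun x => Bop V beta sigma v x - Bop V beta sigma w x) (fun x => v x - w x)
    ((`|N| + K0) ^+ 2) _ (inL2B Lv Lw) (sqr_ge0 _) (lip _ _ Lv Lw hv hw).
  apply: CmeasD; first exact: mB.
  apply: CmeasN; exact: mB.
- have [] // := @ae_dom (fun x => Bop V beta sigma v x - Bop V beta sigma w x) (fun x => v x - w x)
    ((`|N| + K0) ^+ 2) _ (inL2B Lv Lw) (sqr_ge0 _) (lip _ _ Lv Lw hv hw).
  apply: CmeasD; first exact: mB.
  apply: CmeasN; exact: mB.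
Qed.

End Bop.

(** * Mean value inequality in time *)

Section Cderiv.
Context {R : realType}.
Implicit Types (f g : R -> R[i]) (z w : R[i]).

(** Componentwise, so that the real mean value theorem applies. *)
Definition cderiv f (t : R) z :=
  is_derive t 1 (fun s : R => Re (f s)) (Re z) /\ is_derive t 1 (fun s : R => Im (f s)) (Im z).

Lemma cderiv_eq f t z w : cderiv f t z -> z = w -> cderiv f t w.
Proof. by move=> h <-. Qed.

Lemma is_derive_fext (f g : R -> R) (t d : R) : is_derive t 1 f d -> (forall s, g s = f s) -> is_derive t 1 g d.
Proof. by move=> h e; have -> : g = f by apply/funext. Qed.

Lemma cderivD f g t z w : cderiv f t z -> cderiv g t w -> cderiv (fun s => f s + g s) t (z + w).
Proof.
move=> [fr fi] [gr gi]; split.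
- apply: is_derive_eq (is_derive_fext (is_deriveD fr gr) _) _ => [s|]; rewrite ReD //.
- apply: is_derive_eq (is_derive_fext (is_deriveD fi gi) _) _ => [s|]; rewrite ImD //.
Qed.

Lemma cderivM f g t z w : cderiv f t z -> cderiv g t w ->
  cderiv (fun s => f s * g s) t (z * g t + f t * w).
Proof.
move=> [fr fi] [gr gi]; split.
- apply: is_derive_eq (is_derive_fext (is_deriveB (is_deriveM fr gr) (is_deriveM fi gi)) _) _ => [s|].
    by rewrite ReM.
  by rewrite ReD !ReM /GRing.scale /=; ring.
- apply: is_derive_eq (is_derive_fext (is_deriveD (is_deriveM fr gi) (is_deriveM fi gr)) _) _ => [s|].
    by rewrite ImM.
  by rewrite ImD !ImM /GRing.scale /=; ring.
Qed.

Lemma cderiv_cst z (t : R) : cderiv (fun=> z) t 0.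
Proof. by split; exact: is_derive_cst. Qed.

Lemma cderivZ f t z w : cderiv f t z -> cderiv (fun s => w * f s) t (w * z).
Proof.
by move=> h; apply: cderiv_eq (cderivM (cderiv_cst w t) h) _; rewrite mul0r add0r.
Qed.

Lemma cderiv_cis (m p t : R) : cderiv (fun s => cis (m * (s - p))) t ('i%C * m%:C%C * cis (m * (t - p))).
Proof.
have dl : is_derive t 1 (fun x : R => m * (x - p)) m.
  have h : is_derive t 1 (fun x : R => x - p) 1.
    by apply: is_derive_eq (is_deriveB (is_derive_id t 1) (is_derive_cst p t 1)) _; rewrite subr0.
  apply: is_derive_eq (is_deriveZ m h) _; rewrite /GRing.scale /= mulr1 //.
split.
- apply: is_derive_eq (is_derive_fext (@is_derive1_comp _ (@cos R) _ t _ _ _ dl) _) _ => [s|].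
    by rewrite Re_cis.
  by rewrite ReM !(ReM, ImM) Re_cis Im_cis /=; ring.
- apply: is_derive_eq (is_derive_fext (@is_derive1_comp _ (@sin R) _ t _ _ _ dl) _) _ => [s|].
    by rewrite Im_cis.
  by rewrite ImM !(ReM, ImM) Re_cis Im_cis /=; ring.
Qed.

Lemma cderiv_id (p t : R) : cderiv (fun s => (s - p)%:C%C) t 1.
Proof.
split => /=; last exact: is_derive_cst.
by apply: is_derive_eq (is_deriveB (is_derive_id t 1) (is_derive_cst p t 1)) _; rewrite subr0.
Qed.

Definition ccont (A : set R) f := {within A, continuous (fun s => Re (f s))} /\
  {within A, continuous (fun s => Im (f s))}.

Lemma within_fext (A : set R) (f g : R -> R) : {within A, continuous f} -> (forall s, g s = f s) ->
  {within A, continuous g}.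
Proof. by move=> h e; have -> : g = f by apply/funext. Qed.

Lemma ccont_deriv (A : set R) f (df : R -> R[i]) : (forall t, cderiv f t (df t)) -> ccont A f.
Proof.
move=> h; split; apply: continuous_subspaceT => t; apply/differentiable_continuous/derivable1_diffP.
- by have [[]] := h t.
- by have [_ []] := h t.
Qed.

Lemma ccontM (A : set R) f g : ccont A f -> ccont A g -> ccont A (fun s => f s * g s).
Proof.
move=> [fr fi] [gr gi]; split.
- apply: within_fext (fun s => ReM (f s) (g s)) => s.
  by apply: cvgB; apply: cvgM; [exact: fr|exact: gr|exact: fi|exact: gi].
- apply: within_fext (fun s => ImM (f s) (g s)) => s.
  by apply: cvgD; apply: cvgM; [exact: fr|exact: gi|exact: fi|exact: gr].
Qed.

Lemma ccontD (A : set R) f g : ccont A f -> ccont A g -> ccont A (fun s => f s + g s).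
Proof.
move=> [fr fi] [gr gi]; split.
- apply: within_fext (fun s => ReD (f s) (g s)) => s.
  by apply: cvgD; [exact: fr|exact: gr].
- apply: within_fext (fun s => ImD (f s) (g s)) => s.
  by apply: cvgD; [exact: fi|exact: gi].
Qed.

Lemma is_derive_sumo n (f : 'I_n -> R -> R) (df : 'I_n -> R) (t : R) :
  (forall k, is_derive t 1 (f k) (df k)) -> is_derive t 1 (fun s => \sum_(k < n) f k s) (\sum_(k < n) df k).
Proof.
elim: n f df => [|n IH] f df h.
  have -> : (fun s => \sum_(k < 0) f k s) = cst 0 by apply/funext => s; rewrite big_ord0.
  by rewrite big_ord0; exact: is_derive_cst.
rewrite big_ord_recr /=.
apply: (@is_derive_fext (fun s => \sum_(k < n) f (widen_ord (leqnSn n) k) s + f ord_max s)).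
  by apply: is_deriveD; exact: IH.
by move=> s; rewrite big_ord_recr.
Qed.

Lemma within_sumo n (A : set R) (f : 'I_n -> R -> R) : (forall k, {within A, continuous (f k)}) ->
  {within A, continuous (fun s => \sum_(k < n) f k s)}.
Proof.
elim: n f => [|n IH] f h.
  apply: (@within_fext A (fun=> 0)); last by move=> s; rewrite big_ord0.
  by move=> s; exact: cvg_cst.
apply: (@within_fext A (fun s => \sum_(k < n) f (widen_ord (leqnSn n) k) s + f ord_max s)).
  by move=> s; apply: cvgD; [apply: IH => k; exact: h|exact: h].
by move=> s; rewrite big_ord_recr.
Qed.

End Cderiv.

Section Time.
Context {R : realType} (a b : R) (hab : a < b).
Local Notation L := (b - a).

(** The mean value theorem is applied to the real function obtained by pairing P
    with its total increment; the increment of that function is the squared norm of the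
    increment of P. *)
Lemma l2le_mvt (P dP : int -> R -> R[i]) (p q A : R) : p < q -> 0 <= A ->
  (forall l t, p < t < q -> cderiv (P l) t (dP l t)) ->
  (forall l, ccont `[p, q] (P l)) ->
  (forall t, p < t < q -> l2le a b (dP^~ t) A) ->
  l2le a b (fun l => P l q - P l p) ((q - p) * A).
Proof.
move=> pq A0 dPP cP hA N.
pose Q l := P l q - P l p.
pose F s := ssum N (fun l => Re (Q l) * Re (P l s) + Im (Q l) * Im (P l s)).
pose dF s := ssum N (fun l => Re (Q l) * Re (dP l s) + Im (Q l) * Im (dP l s)).
have dFF (t : R) : t \in `]p, q[ -> is_derive t 1 F (dF t).
  rewrite in_itv /= => tpq; apply: is_derive_sumo => k.
  have [dr di] := dPP (k%:Z - N%:Z) _ tpq.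
  by apply: is_deriveD; exact: is_deriveZ.
have cF : {within `[p, q], continuous F}.
  apply: within_sumo => k; have [cr ci] := cP (k%:Z - N%:Z) => s.
  by apply: cvgD; apply: cvgMr; [exact: cr|exact: ci].
have [t] := MVT pq dFF cF; rewrite in_itv /= => tpq eF.
have FQ : F q - F p = ssum N (fun l => sq (Q l)).
  rewrite /F /ssum -sumrB; apply: eq_bigr => k _; rewrite /Q.
  by move: (P _ q) (P _ p) => [x y] [x' y']; rewrite /sq /=; ring.
have h0 : 0 < q - p by rewrite subr_gt0.
have amgm : 2 * (q - p) * dF t <= ssum N (fun l => sq (Q l)) + (q - p) ^+ 2 * ssum N (fun l => sq (dP l t)).
  rewrite -!ssumZ -ssumD; apply: ler_ssum => l; move: (Q l) (dP l t) (q - p) => [x y] [z w] h.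
  rewrite /sq /= -subr_ge0 (_ : _ - _ = (x - h * z) ^+ 2 + (y - h * w) ^+ 2); last by ring.
  by rewrite addr_ge0 ?sqr_ge0.
have L0 : 0 < L by rewrite subr_gt0.
have hAt := hA t tpq N.
move: amgm; rewrite -mulrA [(q - p) * _]mulrC -eF FQ exprMn.
set X := ssum _ _; set Y := ssum _ _ in hAt * => hX.
have h2 : 0 <= (q - p) ^+ 2 := sqr_ge0 _.
have := ler_wpM2l h2 hAt; have : X <= (q - p) ^+ 2 * Y by lra.
by move=> /(ler_wpM2l (ltW L0)); rewrite mulrCA => h3 h4; exact: le_trans h3 h4.
Qed.

(** Compactness of [0, T]; stated for a predicate so as to bound several
    quantities at once. *)
Lemma bounded_of_local (T : R) (Q : R -> R -> Prop) :
  (forall A B s, Q A s -> A <= B -> Q B s) ->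
  (forall t, 0 <= t <= T -> exists A, \forall s \near t, 0 <= s <= T -> Q A s) ->
  exists M, forall s, 0 <= s <= T -> Q M s.
Proof.
move=> mono loc.
have /compact_near_coveringP cov := @segment_compact R 0 T.
have := cov R (pinfty_nbhs R) (fun M s => 0 <= s <= T -> Q M s) _.
case=> [t|M [_ hM]].
  rewrite /= in_itv /= => tT; have [A hA] := loc t tT.
  exists ([set s | 0 <= s <= T -> Q A s], [set M | A <= M]) => /=.
    by split; [exact: hA|exact: nbhs_pinfty_ge (num_real A)].
  by move=> [s M] [/= hs hM] sT; apply: mono (hs sT) hM.
exists (M + 1) => s sT; apply: (hM (M + 1)) => //=; by rewrite ?ltrDl // in_itv.
Qed.

End Time.

(** * Time regularity of the exact solution *)

Section Near.
Context {R : realType}.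

Lemma near_small (F : set_system R) (f : R -> \bar R) (e : R) {FF : Filter F} : 0 < e ->
  f s @[s --> F] --> 0%E -> \forall s \near F, (f s <= e%:E)%E.
Proof.
move=> e0 /fine_cvgP[ff /cvgrPdist_le /(_ e e0)].
move: ff; apply: filterS2 => s fs; rewrite sub0r normrN => h.
by rewrite -(fineK fs) lee_fin (le_trans (ler_norm _)).
Qed.

Lemma Re_le_normc (z : R[i]) : `|Re z| <= normc z.
Proof. by rewrite normcE -sqrtr_sqr ler_wsqrtr // Re_le_sq. Qed.

Lemma Im_le_normc (z : R[i]) : `|Im z| <= normc z.
Proof. by rewrite normcE -sqrtr_sqr ler_wsqrtr // Im_le_sq. Qed.

Lemma cderiv_near (f : R -> R[i]) (t : R) (z : R[i]) :
  (forall e, 0 < e -> \forall h \near 0^', normc ((f (h + t) - f t) / h%:C%C - z) <= e) ->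
  cderiv f t z.
Proof.
move=> H.
have real (g : R -> R) (w : R) :
   (forall e, 0 < e -> \forall h \near 0^', `|(g (h + t) - g t) / h - w| <= e) -> is_derive t 1 g w.
  move=> h.
  have lim : h^-1 *: (g (h *: (1 : R) + t) - g t) @[h --> 0^'] --> w.
    apply/cvgrPdist_le => e e0; move: (h e e0); apply: filterS => s.
    by rewrite distrC /GRing.scale /= mulr1 mulrC.
  by apply: DeriveDef; [apply/cvg_ex; exists w; exact: lim|apply: cvg_lim => //; exact: lim].
have quot (x : R[i]) (h : R) : Re (x / h%:C%C) = Re x / h /\ Im (x / h%:C%C) = Im x / h.
  have -> : (h%:C%C)^-1 = (h^-1)%:C%C :> R[i] by rewrite fmorphV.
  by split; rewrite (ReM, ImM) /= mulr0 ?subr0 ?add0r.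
split; apply: real => e e0; move: (H e e0); apply: filterS => h; apply: le_trans.
- have := Re_le_normc ((f (h + t) - f t) / h%:C%C - z).
  by rewrite ReD ReN (quot _ _).1 ReD ReN.
- have := Im_le_normc ((f (h + t) - f t) / h%:C%C - z).
  by rewrite ImD ImN (quot _ _).2 ImD ImN.
Qed.

Lemma near_shift (T t : R) (P : R -> Prop) : 0 < t < T ->
  (\forall s \near within `[0, T] t^', P s) -> \forall h \near 0^', P (h + t).
Proof.
move=> /andP[t0 tT].
rewrite near_withinE near_withinE => /nbhs_ballP[d /= d0 hd].
rewrite near_withinE; apply/nbhs_ballP; exists (Num.min d (Num.min t (T - t))).
  by rewrite /= !lt_min d0 t0 subr_gt0.
move=> h; rewrite /ball /= sub0r normrN !lt_min => /and3P[h1 h2 h3] h0.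
apply: hd; rewrite /ball /=.
- by rewrite opprD addrCA subrr addr0 normrN.
- by apply: contra h0 => /eqP e; rewrite -(addrK t h) e subrr.
- rewrite in_itv /=; move: h2 h3; rewrite !ltr_norml => /andP[x1 _] /andP[_ x2]; apply/andP; split; lra.
Qed.

End Near.

Section Solution.
Context {R : realType} (a b : R) (hab : a < b).
Local Notation mu := (@lebesgue_measure R).
Local Notation D := (`]a, b[%classic : set R).
Local Notation L := (b - a).
Local Notation freq := (freq a b).
Local Notation fcoef := (fcoef a b).
Local Notation inL2 := (inL2 a b).
Local Notation l2le := (l2le a b).
Context (V : R -> R) (hV : inLinfty a b V) (beta sigma : R) (s0 : 0 < sigma).
Local Notation B := (Bop V beta sigma).

Lemma Bcoef_lip (M : R) : exists2 K : R, 0 <= K & forall v w, inL2 v -> inL2 w ->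
  {ae mu, forall x, D x -> normc (v x) <= M} -> {ae mu, forall x, D x -> normc (w x) <= M} ->
  [/\ inL2 (B v), forall A, 0 <= A -> l2le (fun l => fcoef v l - fcoef w l) A ->
        l2le (fun l => fcoef (B v) l - fcoef (B w) l) (K * A)
    & forall A, 0 <= A -> l2le (fcoef v) A -> l2le (fcoef (B v)) (K * A)].
Proof.
have [K K0 hK] := Bop_lip hab hV beta s0 M; exists K => // v w Lv Lw hv hw.
have [LBv LBvw h] := hK _ _ Lv Lw hv hw.
have [LBw _ _] := hK _ _ Lw Lv hw hv.
have Cs := @inL2_Cint R a b.
split=> // A A0 hA.
- have e : (fun l => fcoef v l - fcoef w l) = fcoef (fun x => v x - w x).
    by apply/funext => l; rewrite fcoefB //; exact: Cs.
  have e' : (fun l => fcoef (B v) l - fcoef (B w) l) = fcoef (fun x => B v x - B w x).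
    by apply/funext => l; rewrite fcoefB //; exact: Cs.
  rewrite e in hA; rewrite e'; apply/(parseval hab) => //; apply: le_trans h _.
  by rewrite exprMn ler_wpM2l ?sqr_ge0 //; apply/(parseval hab) => //; exact: inL2B.
- have L0 : inL2 (fun=> 0) by exact: inL2_cst.
  have h0 : {ae mu, forall x, D x -> normc ((fun=> 0 : R[i]) x) <= M}.
    by apply: aeS hv => x hx xD; apply: le_trans (hx xD); rewrite normcE sq0 sqrtr0 normc_ge0.
  have [_ _ h'] := hK _ _ Lv L0 hv h0.
  apply/(parseval hab) => //.
  have eB : (fun x => B v x - B (fun=> 0) x) = B v by apply/funext => x; rewrite {2}/Bop !mulr0 addr0 subr0.
  have ev : (fun x => v x - 0) = v by apply/funext => x; rewrite subr0.
  move: h'; rewrite eB ev => h'; apply: le_trans h' _.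
  by rewrite exprMn ler_wpM2l ?sqr_ge0 //; apply/(parseval hab).
Qed.

Context (T : R) (psi dpsi : R -> R -> R[i]).
Context (hC0 : C0_Hper a b 2 T psi).
Context (hC1 : C1_L2 a b T psi dpsi).
Context (heq : forall t : R, 0 < t <= T ->
  {ae mu, forall x, x \in `]a, b[ -> 'i%C * dpsi t x = - wderiv a b 2 (psi t) x + B (psi t) x}).

Local Notation u l t := (fcoef (psi t) l).
Local Notation bc l t := (fcoef (B (psi t)) l).

Lemma psi_per2 t : 0 <= t <= T -> per2 a b (psi t).
Proof. by move=> tT; apply: (inHper_per2 hab); exact: hC0.1. Qed.

Lemma psi_L2 t : 0 <= t <= T -> inL2 (psi t).
Proof. by move=> /psi_per2[]. Qed.

Lemma coef_near t e : 0 <= t <= T -> 0 < e -> \forall s \near t, 0 <= s <= T ->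
  l2le (fun l => u l s - u l t) e /\ l2le (fun l => (freq l ^+ 2)%:C%C * (u l s - u l t)) e.
Proof.
move=> tT e0; have := near_small (FF := within_filter _ (nbhs_filter t)) e0 (hC0.2 t tT); rewrite near_withinE.
apply: filterS => s h sT; have {}h := h sT.
have pB := per2B hab (psi_per2 sT) (psi_per2 tT).
have [h1 h2] := per2_Hnorm hab pB h (ltW e0).
have e1 : fcoef (fun x => psi s x - psi t x) = (fun l => u l s - u l t).
  by apply/funext => l; rewrite fcoefB //; apply/inL2_Cint/psi_L2.
by move: h1 h2; rewrite e1.
Qed.

Lemma coef_bounded : exists2 M, 0 < M & forall t, 0 <= t <= T ->
  l2le (fun l => u l t) M /\ l2le (fun l => (freq l ^+ 2)%:C%C * u l t) M.
Proof.
pose Q M t := 0 <= M /\ l2le (fun l => u l t) M /\ l2le (fun l => (freq l ^+ 2)%:C%C * u l t) M.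
have [||M hM] := @bounded_of_local R T Q.
- move=> A A' s [A0 [h1 h2]] AA; split; first exact: le_trans AA.
  by split; [exact: l2le_mono h1 A0 AA|exact: l2le_mono h2 A0 AA].
- move=> t tT; have [Lt [w [Lw _ cw]]] := psi_per2 tT.
  pose A := Num.sqrt (nsq a b (psi t)) + Num.sqrt (nsq a b w).
  have A0 : 0 <= A by rewrite addr_ge0 ?sqrtr_ge0.
  have h1 : l2le (fun l => u l t) A.
    apply: (l2le_mono (A := Num.sqrt (nsq a b (psi t)))); rewrite ?sqrtr_ge0 ?lerDl ?sqrtr_ge0 //.
    by apply/(parseval hab) => //; rewrite sqr_sqrtr ?nsq_ge0.
  have h2 : l2le (fun l => (freq l ^+ 2)%:C%C * u l t) A.
    apply: (l2le_dom hab (d := fcoef w)) => [l|]; first by rewrite cw mulNr sqN.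
    apply: (l2le_mono (A := Num.sqrt (nsq a b w))); rewrite ?sqrtr_ge0 ?lerDr ?sqrtr_ge0 //.
    by apply/(parseval hab) => //; rewrite sqr_sqrtr ?nsq_ge0.
  exists (A + 1); apply: filterS (coef_near tT ltr01) => s h sT; have [h3 h4] := h sT.
  split; first exact: addr_ge0.
  split.
    have := l2leD hab A0 ler01 h1 h3.
    by apply: (l2le_dom hab) => l; rewrite addrC subrK.
  have := l2leD hab A0 ler01 h2 h4.
  by apply: (l2le_dom hab) => l; rewrite -mulrDr addrC subrK.
- exists (`|M| + 1); first by rewrite ltr_wpDl.
  move=> t tT; have [M0 [h1 h2]] := hM t tT.
  have MM : M <= `|M| + 1 by rewrite (le_trans (ler_norm M)) // lerDl.
  by split; [exact: l2le_mono h1 M0 MM|exact: l2le_mono h2 M0 MM].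
Qed.

Lemma coef_cont l : ccont `[0, T] (fun t => u l t).
Proof.
have L0 : 0 < L by rewrite subr_gt0.
have key t e : 0 <= t <= T -> 0 < e -> \forall s \near within `[0, T] (nbhs t), normc (u l s - u l t) <= e.
  move=> tT e0.
  have e1 : 0 < e * Num.sqrt L by rewrite mulr_gt0 // sqrtr_gt0.
  rewrite near_withinE; apply: filterS (coef_near tT e1) => s h; rewrite /= in_itv /= => sT.
  have [h1 _] := h sT; have := l2le_term hab l h1.
  rewrite exprMn sqr_sqrtr ?(ltW L0) // [e ^+ 2 * _]mulrC ler_pM2l // -sqr_normc.
  by rewrite ler_sqr ?nnegrE ?normc_ge0 // ltW.
split; apply/subspace_continuousP => t; rewrite /= in_itv /= => tT; apply/cvgrPdist_le => e e0.
- apply: filterS (key t e tT e0) => s; apply: le_trans.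
  by have := Re_le_normc (u l s - u l t); rewrite ReD ReN distrC.
- apply: filterS (key t e tT e0) => s; apply: le_trans.
  by have := Im_le_normc (u l s - u l t); rewrite ImD ImN distrC.
Qed.

Lemma ccont_sub (A A' : set R) (f : R -> R[i]) : A' `<=` A -> ccont A f -> ccont A' f.
Proof. by move=> s [h1 h2]; split; exact: continuous_subspaceW s _. Qed.

(** Each coefficient is controlled by the L^2 norm, and the difference quotient
    converges in L^2. *)
Lemma coef_deriv l t : 0 < t < T -> cderiv (fun t => u l t) t (fcoef (dpsi t) l).
Proof.
move=> t0T; have tT : 0 <= t <= T by have /andP[/ltW -> /ltW ->] := t0T.
have L0 : 0 < L by rewrite subr_gt0.
have [hL hlim _] := hC1; have [Lp Ld] := hL t tT.
apply: cderiv_near => e e0.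
have e1 : 0 < e * Num.sqrt L by rewrite mulr_gt0 // sqrtr_gt0.
have := near_shift t0T (P := fun s => normc ((u l s - u l t) / (s - t)%:C%C - fcoef (dpsi t) l) <= e) _.
move=> H; have : \forall h \near 0^', normc ((u l (h + t) - u l t) / (h + t - t)%:C%C - fcoef (dpsi t) l) <= e.
  apply: H; have := near_small (FF := within_filter _ (within_filter _ (nbhs_filter t))) e1 (hlim t tT); rewrite !near_withinE.
  apply: filterS => s h s0' sT; have {h} := h s0' sT.
  move: sT; rewrite /= in_itv /= => sT; have Ls := psi_L2 sT.
  pose g x := ((s - t)%:C%C)^-1 * (psi s x - psi t x) - dpsi t x.
  have -> : (fun x => (psi s x - psi t x) / (s - t)%:C%C - dpsi t x) = g.
    by apply/funext => x; rewrite /g mulrC.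
  have Lst : inL2 (fun x => psi s x - psi t x) by exact: inL2B.
  have Lg : inL2 g by apply: inL2B => //; exact: inL2Z.
  have eg : fcoef g l = (u l s - u l t) / (s - t)%:C%C - fcoef (dpsi t) l.
    rewrite /g fcoefB; [|by apply/inL2_Cint/inL2Z|exact: inL2_Cint].
    rewrite fcoefZ; last exact: inL2_Cint.
    by rewrite fcoefB ?[_ * (_ - _)]mulrC //; exact: inL2_Cint.
  move/(L2norm_l2le hab Lg (ltW e1)) => /(l2le_term hab l); rewrite eg.
  rewrite exprMn sqr_sqrtr ?(ltW L0) // [e ^+ 2 * _]mulrC ler_pM2l // -sqr_normc.
  by rewrite ler_sqr ?nnegrE ?normc_ge0 // ltW.
by apply: filterS => h; rewrite addrK.
Qed.

Context (M K : R) (M0 : 0 < M) (K0 : 0 <= K).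
Context (hM : forall t, 0 <= t <= T ->
  l2le (fun l => u l t) M /\ l2le (fun l => (freq l ^+ 2)%:C%C * u l t) M).

Lemma psi_sup t : 0 <= t <= T -> {ae mu, forall x, D x -> normc (psi t x) <= sob a b * (M + M)}.
Proof.
move=> tT; have [h1 h2] := hM tT; have M0' := ltW M0.
apply: sobolev => //; first exact: psi_L2.
have := l2le_interp hab M0' M0' h1 h2.
by rewrite -expr2 sqrtr_sqr gtr0_norm.
Qed.

Context (hK : forall s t, 0 <= s <= T -> 0 <= t <= T ->
  [/\ inL2 (B (psi s)), forall A, 0 <= A -> l2le (fun l => u l s - u l t) A ->
        l2le (fun l => bc l s - bc l t) (K * A)
    & forall A, 0 <= A -> l2le (fun l => u l s) A -> l2le (fun l => bc l s) (K * A)]).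

Lemma coef_ode l t : 0 < t < T ->
  cderiv (fun t => u l t) t (- 'i%C * ((freq l ^+ 2)%:C%C * u l t + bc l t)).
Proof.
move=> t0T; have tT : 0 <= t <= T by have /andP[/ltW -> /ltW ->] := t0T.
have tT' : 0 < t <= T by have /andP[-> /ltW ->] := t0T.
apply: cderiv_eq (coef_deriv l t0T) _.
have [hL _ _] := hC1; have [Lp Ld] := hL t tT.
have [_ [w [Lw hw cw]]] := psi_per2 tT; have [Lw2 _ aew] := wderivP hab Lw hw.
have [LB _ _] := hK tT tT.
have c2 : fcoef (wderiv a b 2 (psi t)) l = - (freq l ^+ 2)%:C%C * u l t.
  by rewrite -cw; apply: ae_fcoef => //; exact: inL2_meas.
have h : fcoef (fun x => 'i%C * dpsi t x) l = fcoef (fun x => - wderiv a b 2 (psi t) x + B (psi t) x) l.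
  apply: ae_fcoef; [exact/inL2_meas/inL2Z|apply/inL2_meas/inL2D => //; exact: inL2N|].
  exact: heq.
move: h; rewrite fcoefZ; last exact: inL2_Cint.
rewrite fcoefD; [|exact/inL2_Cint/inL2N|exact: inL2_Cint].
rewrite (_ : (fun x => - wderiv a b 2 (psi t) x) = (fun x => -1 * wderiv a b 2 (psi t) x)); last first.
  by apply/funext => x; rewrite mulN1r.
rewrite fcoefZ; last exact: inL2_Cint.
rewrite c2 => h.
rewrite -[LHS]mul1r (_ : 1 = - 'i%C * 'i%C :> R[i]); last first.
  by apply: cext => /=; ring.
by rewrite -mulrA h; move: (u l t) (bc l t) (_%:C)%C => *; ring.
Qed.

Lemma coef_lip p q : 0 <= p -> p <= q -> q <= T ->
  l2le (fun l => u l q - u l p) ((q - p) * (M + K * M)).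
Proof.
move=> p0; rewrite le_eqVlt => /predU1P[-> _ N|pq qT].
  rewrite subrr mul0r expr0n /= (@eq_ssum _ _ _ (fun=> 0 * 0 : R)) => [|l]; last by rewrite subrr sq0 mul0r.
  by rewrite ssumZ mul0r mulr0.
have MK : 0 <= M + K * M by rewrite addr_ge0 ?mulr_ge0 // ltW.
have sub t : p < t < q -> 0 < t < T by move=> /andP[pt tq]; rewrite (le_lt_trans p0 pt) (lt_le_trans tq qT).
apply: (l2le_mvt hab (P := fun l t => u l t) (dP := fun l t => - 'i%C * ((freq l ^+ 2)%:C%C * u l t + bc l t))) => //.
- by move=> l t /sub; exact: coef_ode.
- move=> l; apply: ccont_sub (coef_cont l) => t; rewrite /= !in_itv /= => /andP[pt tq].
  by rewrite (le_trans p0 pt) (le_trans tq qT).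
- move=> t /sub /andP[/ltW t0 /ltW tT].
  have tT' : 0 <= t <= T by rewrite t0 tT.
  have [h1 h2] := hM tT'; have [_ _ h3] := hK tT' tT'.
  have := l2leD hab (ltW M0) (mulr_ge0 K0 (ltW M0)) h2 (h3 M (ltW M0) h1).
  by apply: (l2le_dom hab) => l; rewrite sqM sqN sqi mul1r.
Qed.

Lemma coef_lip_abs s r : 0 <= s <= T -> 0 <= r <= T ->
  l2le (fun l => u l s - u l r) (`|s - r| * (M + K * M)).
Proof.
move=> /andP[s0' sT] /andP[r0 rT]; have [rs|sr] := leP r s.
  by rewrite ger0_norm ?subr_ge0 //; exact: coef_lip.
rewrite distrC ger0_norm ?subr_ge0 ?(ltW sr) //.
apply: (l2le_dom hab) (coef_lip s0' (ltW sr) rT) => l; by rewrite sqB.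
Qed.

(** Value at time h of the solution of y' = - i (mu_l^2 y + w) with y(0) = z,
    for a constant w. *)
Definition flow (h : R) (l : int) (z w : R[i]) : R[i] :=
  cis (- freq l ^+ 2 * h) * z - 'i%C * h%:C%C * Phi (- freq l ^+ 2 * h) * w.

Lemma cisN_Phi (t : R) : cis (- t) * Phi t = Phi (- t).
Proof.
have [->|t0] := eqVneq t 0; first by rewrite oppr0 cis0 mul1r.
have i0 : 'i%C * (- t)%:C%C != 0 :> R[i].
  by apply/eqP => /(congr1 (@complex.Im R)) /=; rewrite mul0r add0r mul1r => /eqP; rewrite oppr_eq0 (negbTE t0).
apply: (mulfI i0); rewrite Phi_eq mulrCA rmorphN /= mulrN mulNr Phi_eq mulrN mulrBr mulr1 -cisD addNr cis0.
by rewrite opprB.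
Qed.

(** In the variable P below, the constant part of the right-hand side is
    integrated exactly, so that P' has the modulus of b(s) - b(r), of size O(q - p)
    because psi is Lipschitz in time. *)
Lemma local_error p q r : 0 <= p -> p < q -> q <= T -> p <= r <= q ->
  l2le (fun l => u l q - flow (q - p) l (u l p) (bc l r)) (K * (M + K * M) * (q - p) ^+ 2).
Proof.
move=> p0 pq qT /andP[pr rq].
have h0 : 0 < q - p by rewrite subr_gt0.
have MK : 0 <= M + K * M by rewrite addr_ge0 ?mulr_ge0 // ltW.
have rT : 0 <= r <= T by rewrite (le_trans p0 pr) (le_trans rq qT).
have sub t : p < t < q -> 0 < t < T by move=> /andP[pt tq]; rewrite (le_lt_trans p0 pt) (lt_le_trans tq qT).
pose J l s : R[i] := if freq l ^+ 2 == 0 then (s - p)%:C%C else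
  ('i%C * (freq l ^+ 2)%:C%C)^-1 * (cis (freq l ^+ 2 * (s - p)) + - 1).
pose P l s := cis (freq l ^+ 2 * (s - p)) * u l s + 'i%C * bc l r * J l s.
have i0 (m : R) : m != 0 -> 'i%C * m%:C%C != 0 :> R[i].
  by move=> m0; apply/eqP => /(congr1 (@complex.Im R)) /=; rewrite mul0r add0r mul1r => /eqP; rewrite (negbTE m0).
have dJ l t : cderiv (J l) t (cis (freq l ^+ 2 * (t - p))).
  rewrite /J; case: (eqVneq (freq l ^+ 2) 0) => [->|m0].
    by rewrite mul0r cis0; exact: cderiv_id.
  apply: cderiv_eq (cderivZ _ (cderivD (cderiv_cis (freq l ^+ 2) p t) (cderiv_cst (- 1) t))) _.
  by rewrite addr0 mulrA mulVf ?mul1r // i0.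
have Jp l : J l p = 0.
  by rewrite /J subrr mulr0 cis0 subrr mulr0; case: ifP.
have Jq l : J l q = (q - p)%:C%C * Phi (freq l ^+ 2 * (q - p)).
  rewrite /J; case: (eqVneq (freq l ^+ 2) 0) => [->|m0].
    by rewrite mul0r /Phi /phi_1 mulr0 eqxx mulr1.
  apply: (mulfI (i0 _ m0)); rewrite mulrA divff ?mul1r ?i0 //.
  by rewrite -Phi_eq rmorphM /= !mulrA.
pose dP l s := - 'i%C * cis (freq l ^+ 2 * (s - p)) * (bc l s - bc l r).
have hl : l2le (fun l => P l q - P l p) ((q - p) * (K * ((q - p) * (M + K * M)))).
  apply: (l2le_mvt hab (dP := dP)) => //.
  - by rewrite !mulr_ge0 // ltW.
  - move=> l t tpq; have h1 := cderivM (cderiv_cis (freq l ^+ 2) p t) (coef_ode l (sub t tpq)).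
    apply: cderiv_eq (cderivD h1 (cderivZ ('i%C * bc l r) (dJ l t))) _.
    by rewrite /dP; move: (cis _) (u l t) (bc l t) (bc l r) (_%:C)%C => *; ring.
  - move=> l; apply: ccontD.
      apply: ccontM; first exact: ccont_deriv (fun t => cderiv_cis (freq l ^+ 2) p t).
      apply: ccont_sub (coef_cont l) => t; rewrite /= !in_itv /= => /andP[pt tq].
      by rewrite (le_trans p0 pt) (le_trans tq qT).
    exact: ccont_deriv (fun t => cderivZ _ (dJ l t)).
  - move=> t tpq; have /andP[/ltW t0 /ltW tT] := sub t tpq.
    have tT' : 0 <= t <= T by rewrite t0 tT.
    have [_ hB _] := hK tT' rT.
    have hb : l2le (fun l => bc l t - bc l r) (K * (`|t - r| * (M + K * M))).
      by apply: hB; [rewrite mulr_ge0|exact: coef_lip_abs].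
    apply: (l2le_dom hab (d := fun l => bc l t - bc l r)).
      by move=> l; rewrite /dP sqM (sqM (- 'i%C)) sqN sqi sq_cis !mul1r.
    apply: (l2le_mono hb); first by rewrite !mulr_ge0.
    rewrite ler_wpM2l // ler_wpM2r // ler_norml.
    by move: tpq => /andP[pt tq]; apply/andP; split; lra.
apply: (l2le_mono (A := (q - p) * (K * ((q - p) * (M + K * M))))).
- apply: (l2le_dom hab) hl => l.
  rewrite -[X in _ <= X]mul1r -(sq_cis (- (freq l ^+ 2 * (q - p)))) -sqM.
  rewrite /P Jp Jq subrr mulr0 cis0 mulr0 addr0 mul1r /flow mulNr -cisN_Phi.
  rewrite [X in _ <= sq X](_ : _ = u l q - (cis (- (freq l ^+ 2 * (q - p))) * u l p -
    'i%C * (q - p)%:C%C * (cis (- (freq l ^+ 2 * (q - p))) * Phi (freq l ^+ 2 * (q - p))) * bc l r)) //.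
  rewrite mulrBr mulrDr [cis _ * (cis _ * _)]mulrA -cisD addNr cis0 mul1r.
  by move: (cis _) (u l q) (u l p) (bc l r) (Phi _) (_%:C)%C => *; ring.
- by rewrite !mulr_ge0 // ltW.
- by rewrite le_eqVlt; apply/orP; left; apply/eqP; ring.
Qed.

End Solution.

(** * One step of the scheme *)

Section Scheme.
Context {R : realType} (a b : R) (hab : a < b).
Local Notation mu := (@lebesgue_measure R).
Local Notation D := (`]a, b[%classic : set R).
Local Notation freq := (freq a b).
Local Notation fcoef := (fcoef a b).
Local Notation inL2 := (inL2 a b).
Local Notation l2le := (l2le a b).
Context (V : R -> R) (beta sigma tau : R).
Local Notation B := (Bop V beta sigma).

Lemma sEWI_first_coef v : inL2 v -> inL2 (B v) ->
  inL2 (sEWI_first a b V beta sigma tau v) /\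
  forall l, fcoef (sEWI_first a b V beta sigma tau v) l = flow a b tau l (fcoef v l) (fcoef (B v) l).
Proof.
move=> Lv LB.
have b1 (d : R) : sq (cexp ('i%C * (tau * d)%:C%C)) <= 1 ^+ 2 by rewrite cexp_i sq_cis expr1n.
have b2 (d : R) : sq (phi_1 ('i%C * (tau * d)%:C%C)) <= 1 ^+ 2 by rewrite expr1n; exact: sq_Phi_le1.
have [L1 c1] := fmultP hab Lv b1; have [L2 c2] := fmultP hab LB b2.
split; first by apply: inL2B => //; exact: inL2Z.
move=> l; rewrite /sEWI_first fcoefB; [|exact: inL2_Cint|exact/inL2_Cint/inL2Z].
rewrite fcoefZ; last exact: inL2_Cint.
have e1 : cexp ('i%C * (tau * - freq l ^+ 2)%:C%C) = cis (- freq l ^+ 2 * tau).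
  by rewrite cexp_i mulrC.
have e2 : phi_1 ('i%C * (tau * - freq l ^+ 2)%:C%C) = Phi (- freq l ^+ 2 * tau).
  by rewrite /Phi [X in (X%:C)%C]mulrC.
apply: etrans (f_equal2 (fun x y => x - 'i%C * tau%:C%C * y) (c1 l) (c2 l)) _.
rewrite {}e1 {}e2 /flow {c1 c2 L1 L2}.
move: (cis _) (Phi _) (fcoef _ _) (fcoef _ _) => p q r s; ring.
Qed.

Lemma sEWI_step_coef v w : inL2 v -> inL2 (B w) ->
  inL2 (sEWI_step a b V beta sigma tau v w) /\
  forall l, fcoef (sEWI_step a b V beta sigma tau v w) l =
    flow a b (2 * tau) l (fcoef v l) (fcoef (B w) l).
Proof.
move=> Lv LB.
have e2 (d : R) : 2 * 'i%C * (tau * d)%:C%C = 'i%C * (2 * tau * d)%:C%C :> R[i].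
  by apply: cext => /=; ring.
have b1 (d : R) : sq (cexp (2 * 'i%C * (tau * d)%:C%C)) <= 1 ^+ 2.
  by rewrite e2 cexp_i sq_cis expr1n.
have b2 (d : R) : sq (cexp ('i%C * (tau * d)%:C%C)) <= 1 ^+ 2 by rewrite cexp_i sq_cis expr1n.
have b3 (d : R) : sq ((phi_s (tau * d))%:C%C) <= 1 ^+ 2.
  by rewrite expr1n -[leLHS]mul1r -{1}(sq_cis (tau * d)) -sqM cis_phi_s; exact: sq_Phi_le1.
have [L1 c1] := fmultP hab Lv b1; have [L3 c3] := fmultP hab LB b3.
have [L2 c2] := fmultP hab L3 b2.
split; first by apply: inL2B => //; exact: inL2Z.
move=> l; rewrite /sEWI_step fcoefB; [|exact: inL2_Cint|exact/inL2_Cint/inL2Z].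
rewrite fcoefZ; last exact: inL2_Cint.
have e1 : cexp (2 * 'i%C * (tau * - freq l ^+ 2)%:C%C) = cis (- freq l ^+ 2 * (2 * tau)).
  by rewrite e2 cexp_i; congr cis; ring.
have e3 (z : R[i]) : cexp ('i%C * (tau * - freq l ^+ 2)%:C%C) * ((phi_s (tau * - freq l ^+ 2))%:C%C * z) =
    Phi (- freq l ^+ 2 * (2 * tau)) * z.
  by rewrite cexp_i mulrA cis_phi_s; congr (Phi _ * _); ring.
apply: etrans (f_equal2 (fun x y => x - 2 * 'i%C * tau%:C%C * y) (c1 l)
  (etrans (c2 l) (f_equal (fun x => cexp ('i%C * (tau * - freq l ^+ 2)%:C%C) * x) (c3 l)))) _.
rewrite {}e1 {}e3 /flow rmorphM rmorph_nat {c1 c2 c3 L1 L2 L3}.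
move: (cis _) (Phi _) (fcoef _ _) (fcoef _ _) => p q r s; ring.
Qed.

Lemma flowB h l (z w z' w' : R[i]) : flow a b h l z w - flow a b h l z' w' = flow a b h l (z - z') (w - w').
Proof. by rewrite /flow; ring. Qed.

Lemma l2le_flow h (z w : int -> R[i]) (A A' : R) : 0 <= h -> 0 <= A -> 0 <= A' -> l2le z A -> l2le w A' ->
  l2le (fun l => flow a b h l (z l) (w l)) (A + h * A').
Proof.
move=> h0 A0 A0' hz hw; rewrite /flow; apply: (l2leB hab) => //; first exact: mulr_ge0.
  by apply: (l2le_dom hab) hz => l; rewrite sqM sq_cis mul1r.
have := l2leZ hab (z := (h%:C)%C) (k := h) _ hw; rewrite sqC => /(_ (lexx _)).
apply: (l2le_dom hab) => l; rewrite -!mulrA sqM sqi mul1r !(sqM (h%:C)%C) ler_wpM2l ?sq_ge0 //.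
by rewrite sqM ler_piMl ?sq_ge0 ?sq_Phi_le1.
Qed.

(** The smoothing of phi_1 compensates the factor mu^2 exactly; this is
    what makes the H^2 bound possible. *)
Lemma flow_chi h l (z w : R[i]) :
  (freq l ^+ 2)%:C%C * flow a b h l z w + w = cis (- freq l ^+ 2 * h) * ((freq l ^+ 2)%:C%C * z + w).
Proof.
have := Phi_eq (- freq l ^+ 2 * h); rewrite /flow rmorphM rmorphN /=.
move: (cis _) (Phi _) (_%:C)%C (_%:C)%C => c p m k e.
have -> : c = 1 + 'i%C * (- k * m) * p by rewrite e addrC subrK.
by ring.
Qed.

End Scheme.

(** * Accumulation of the errors *)

Section Growth.
Context {R : realType} (C0 K tau : R) (C00 : 0 <= C0) (K0 : 0 <= K) (tau0 : 0 < tau).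

(** Solution of a discrete Gronwall inequality with source C0 tau^2 at each
    step. *)
Definition err_growth (k : nat) : R := k%:R * (C0 * tau ^+ 2) * (1 + 2 * (K * tau)) ^+ k.

Let q1 : 1 <= 1 + 2 * (K * tau).
Proof. by rewrite lerDl !mulr_ge0 // ltW. Qed.

Let q0 : 0 <= 1 + 2 * (K * tau).
Proof. exact: le_trans q1. Qed.

Lemma Gr_ge0 k : 0 <= err_growth k.
Proof.
rewrite /err_growth; apply: mulr_ge0; last by rewrite exprn_ge0.
by rewrite mulr_ge0 // mulr_ge0 // sqr_ge0.
Qed.

Lemma Gr_step k : C0 * tau ^+ 2 + (1 + 2 * (K * tau)) * err_growth k <= err_growth k.+1.
Proof.
rewrite /err_growth -natr1; set q := 1 + _; set c := C0 * _.
have c0 : 0 <= c by rewrite mulr_ge0 ?sqr_ge0.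
have h : c <= c * q ^+ k.+1 by rewrite ler_peMr // exprn_ege1.
rewrite [leRHS](_ : _ = c * q ^+ k.+1 + q * (k%:R * c * q ^+ k)) ?lerD2r //.
by rewrite exprS; ring.
Qed.

Lemma Gr_homo k : err_growth k <= err_growth k.+1.
Proof.
apply: le_trans (Gr_step k); rewrite -[leLHS]add0r; apply: lerD.
  by rewrite mulr_ge0 ?sqr_ge0.
by apply: ler_peMl; [exact: Gr_ge0|].
Qed.

Lemma Gr_bound k (T : R) : k%:R * tau <= T -> err_growth k <= T * C0 * expR (2 * K * T) * tau.
Proof.
move=> kT; rewrite /err_growth.
have h : (1 + 2 * (K * tau)) ^+ k <= expR (2 * K * T).
  apply: (@le_trans _ _ (expR (2 * (K * tau)) ^+ k)).
    by rewrite lerXn2r ?nnegrE ?expR_ge0 ?expR_ge1Dx // (le_trans _ q1).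
  rewrite -expRM_natl ler_expR.
  rewrite [leLHS](_ : _ = 2 * K * (k%:R * tau)); last by ring.
  by rewrite ler_wpM2l // mulr_ge0.
rewrite [leLHS](_ : _ = k%:R * tau * C0 * (1 + 2 * (K * tau)) ^+ k * tau); last by ring.
apply: ler_wpM2r; first exact: ltW.
apply: ler_pM => //; [|exact: exprn_ge0|exact: ler_wpM2r].
by apply: mulr_ge0 => //; apply: mulr_ge0 => //; exact: ltW.
Qed.

End Growth.

(** * Convergence of the scheme *)

Lemma sqrt_mul_le (R : realType) (x y : R) : 0 <= x -> 0 <= y -> Num.sqrt (x * y) <= x + y.
Proof.
move=> x0 y0; rewrite -(ger0_norm (addr_ge0 x0 y0)) -sqrtr_sqr ler_wsqrtr //.
have := mulr_ge0 x0 y0; nra.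
Qed.

Section Convergence.
Context {R : realType} (a b : R) (hab : a < b).
Local Notation mu := (@lebesgue_measure R).
Local Notation D := (`]a, b[%classic : set R).
Local Notation freq := (freq a b).
Local Notation fcoef := (fcoef a b).
Local Notation inL2 := (inL2 a b).
Local Notation l2le := (l2le a b).
Context (V : R -> R) (beta sigma : R).
Local Notation B := (Bop V beta sigma).
Context (T : R) (T0 : 0 < T) (psi0 : R -> R[i]) (psi dpsi : R -> R -> R[i]).
Context (hC0 : C0_Hper a b 2 T psi).
Context (hC1 : C1_L2 a b T psi dpsi).
Context (heq : forall t : R, 0 < t <= T ->
  {ae mu, forall x, x \in `]a, b[ -> 'i%C * dpsi t x = - wderiv a b 2 (psi t) x + B (psi t) x}).
Context (Lpsi0 : inL2 psi0).
Context (hpsi0 : {ae mu, forall x, x \in `]a, b[ -> psi 0 x = psi0 x}).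
Context (M K : R) (M0 : 0 < M) (K0 : 0 <= K).
Context (hM : forall t, 0 <= t <= T ->
  l2le (fcoef (psi t)) M /\ l2le (fun l => (freq l ^+ 2)%:C%C * fcoef (psi t) l) M).

(** The exact solution is bounded by this constant minus 1, which leaves room
    for a sup-norm error of at most 1. *)
Let sup_cst : R := sob a b * (M + M) + 1.

Context (hlip : forall v w, inL2 v -> inL2 w ->
  {ae mu, forall x, D x -> normc (v x) <= sup_cst} -> {ae mu, forall x, D x -> normc (w x) <= sup_cst} ->
  [/\ inL2 (B v), forall A, 0 <= A -> l2le (fun l => fcoef v l - fcoef w l) A ->
        l2le (fun l => fcoef (B v) l - fcoef (B w) l) (K * A)
    & forall A, 0 <= A -> l2le (fcoef v) A -> l2le (fcoef (B v)) (K * A)]).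

Definition lip_cst : R := M + K * M.
Definition trunc_cst : R := 4 * (K * lip_cst).
Definition err_cst : R := T * trunc_cst * expR (2 * K * T) + 1.
Definition chi0_cst : R := M + K * (M + err_cst).
Definition chi_incr_cst : R := K * (2 * err_cst + 2 * lip_cst).
Definition lap_cst : R := chi0_cst + T * chi_incr_cst + K * (M + err_cst) + M.
Definition h1_cst : R := err_cst + Num.sqrt (err_cst * (M + lap_cst)).

Let M0' : 0 <= M. Proof. exact: ltW. Qed.
Let Kt0 : 0 <= lip_cst. Proof. by rewrite /lip_cst addr_ge0 // mulr_ge0. Qed.
Let C00 : 0 <= trunc_cst. Proof. by rewrite /trunc_cst mulr_ge0 // mulr_ge0. Qed.
Let C1_1 : 1 <= err_cst.
Proof. by rewrite /err_cst lerDr; apply: mulr_ge0; [apply: mulr_ge0 => //; exact: ltW|exact: expR_ge0]. Qed.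
Let C10 : 0 < err_cst. Proof. exact: lt_le_trans C1_1. Qed.
Let C10' : 0 <= err_cst. Proof. exact: ltW. Qed.
Let KMC0 : 0 <= K * (M + err_cst). Proof. by rewrite mulr_ge0 // addr_ge0. Qed.
Let X10 : 0 <= chi_incr_cst.
Proof. by rewrite /chi_incr_cst mulr_ge0 // addr_ge0 // mulr_ge0. Qed.
Let X00 : 0 <= chi0_cst. Proof. by rewrite /chi0_cst addr_ge0. Qed.
Let TX0 : 0 <= T * chi_incr_cst. Proof. by apply: mulr_ge0 => //; exact: ltW. Qed.
Let C20 : 0 <= lap_cst. Proof. by rewrite /lap_cst !addr_ge0. Qed.
Let C30 : 0 <= h1_cst. Proof. by rewrite /h1_cst addr_ge0 // sqrtr_ge0. Qed.

Context (tau : R) (tau0 : 0 < tau) (tau1 : tau <= 1) (tauS : sob a b * h1_cst * Num.sqrt tau <= 1).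

Local Notation t n := (n%:R * tau).
Local Notation pn n := (sEWI a b V beta sigma tau psi0 n).
Local Notation c n l := (fcoef (pn n) l).
Local Notation g n l := (fcoef (B (pn n)) l).
Local Notation u n l := (fcoef (psi (t n)) l).
Local Notation bc n l := (fcoef (B (psi (t n))) l).
Local Notation G n := (err_growth trunc_cst K tau n).

Lemma tn_in n : t n <= T -> 0 <= t n <= T.
Proof. by move=> ->; rewrite andbT mulr_ge0 // ltW. Qed.

Lemma tn_le m n : (m <= n)%N -> t n <= T -> t m <= T.
Proof. by move=> mn; apply: le_trans; rewrite ler_wpM2r ?(ltW tau0) // ler_nat. Qed.

Lemma tau_le_sqrt : tau <= Num.sqrt tau.
Proof.
rewrite -{1}(sqr_sqrtr (ltW tau0)) expr2 ler_piMl ?sqrtr_ge0 //.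
by rewrite -sqrtr1 ler_wsqrtr.
Qed.

(** Invariant of the induction. The second part gives the L^2 error, and with
    the third one the sup bound that makes B Lipschitz at the next step. *)
Definition good n := [/\ inL2 (pn n), l2le (fun l => u n l - c n l) (G n) &
  l2le (fun l => (freq l ^+ 2)%:C%C * c n l) lap_cst].

Lemma err_growth_le n : t n <= T -> G n <= err_cst * tau.
Proof.
move=> nT; apply: le_trans (Gr_bound C00 K0 tau0 nT) _.
by rewrite ler_wpM2r ?(ltW tau0) // /err_cst lerDl.
Qed.

Lemma good_err n : t n <= T -> good n ->
  [/\ l2le (fun l => u n l - c n l) (err_cst * tau),
      l2le (fun l => (freq l)%:C%C * (u n l - c n l)) (Num.sqrt (err_cst * (M + lap_cst)) * Num.sqrt tau) &
      l2le (fun l => c n l) (M + err_cst)].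
Proof.
move=> nT [Lc he hc].
have [hu1 hu2] := hM (tn_in nT).
have e1 := l2le_mono he (Gr_ge0 C00 K0 tau0 n) (err_growth_le nT).
have ct0 : 0 <= err_cst * tau by rewrite mulr_ge0 // ltW.
have MC : 0 <= M + lap_cst by rewrite addr_ge0.
split=> //.
- have e2 : l2le (fun l => (freq l ^+ 2)%:C%C * (u n l - c n l)) (M + lap_cst).
    by apply: (l2le_dom hab) (l2leB hab M0' C20 hu2 hc) => l; rewrite mulrBr.
  have := l2le_interp hab ct0 MC e1 e2.
  by rewrite -sqrtrM ?mulr_ge0 // mulrAC.
- have h := l2leB hab M0' ct0 hu1 e1.
  apply: (@l2le_mono _ a b _ (M + err_cst * tau)).
  + by apply: (l2le_dom hab) h => l; rewrite opprB addrC subrK.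
  + exact: addr_ge0.
  + by rewrite lerD2l ler_piMr.
Qed.

(** The interpolated H^1 error is O(tau^(1/2)), hence at most 1 in sup norm for
    small tau, by Sobolev. *)
Lemma good_sup n : t n <= T -> good n -> {ae mu, forall x, D x -> normc (pn n x) <= sup_cst}.
Proof.
move=> nT gn; have [e1 e2 _] := good_err nT gn; have [Lc _ _] := gn.
have tT := tn_in nT; have Lp := psi_L2 hab hC0 tT.
pose e x := psi (t n) x - pn n x; have Le : inL2 e by exact: inL2B.
have ee : fcoef e = fun l => u n l - c n l.
  by apply/funext => l; rewrite fcoefB //; exact: inL2_Cint.
have ct0 : 0 < err_cst * tau by rewrite mulr_gt0.
have sq0 : 0 <= Num.sqrt (err_cst * (M + lap_cst)) * Num.sqrt tau by rewrite mulr_ge0 ?sqrtr_ge0.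
have hs : {ae mu, forall x, D x -> normc (e x) <= sob a b * (err_cst * tau + Num.sqrt (err_cst * (M + lap_cst)) * Num.sqrt tau)}.
  by apply: sobolev => //; rewrite ee.
have hb : sob a b * (err_cst * tau + Num.sqrt (err_cst * (M + lap_cst)) * Num.sqrt tau) <= 1.
  apply: le_trans tauS; rewrite -mulrA; apply: ler_wpM2l; first exact: sob_ge0.
  rewrite /h1_cst [(_ + Num.sqrt _) * _]mulrDl; apply: lerD => //.
  by apply: ler_wpM2l => //; exact: tau_le_sqrt.
apply: aeS2 hs (psi_sup hab hC0 M0 hM tT) => x h1 h2 xD.
have -> : pn n x = psi (t n) x - e x by rewrite /e opprB addrC subrK.
apply: le_trans (normcD _ _) _; rewrite /sup_cst; apply: lerD; first exact: h2.
rewrite normcE sqN -normcE; exact: le_trans (h1 xD) hb.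
Qed.

Lemma psi_le s : 0 <= s <= T -> {ae mu, forall x, D x -> normc (psi s x) <= sup_cst}.
Proof.
move=> sT; apply: aeS (psi_sup hab hC0 M0 hM sT) => x h xD.
by apply: le_trans (h xD) _; rewrite /sup_cst lerDl.
Qed.

Lemma Bcoef_psi_lip s t' : 0 <= s <= T -> 0 <= t' <= T ->
  [/\ inL2 (B (psi s)), forall A, 0 <= A -> l2le (fun l => fcoef (psi s) l - fcoef (psi t') l) A ->
        l2le (fun l => fcoef (B (psi s)) l - fcoef (B (psi t')) l) (K * A)
    & forall A, 0 <= A -> l2le (fun l => fcoef (psi s) l) A -> l2le (fun l => fcoef (B (psi s)) l) (K * A)].
Proof.
by move=> sT tT; apply: hlip; [exact: (psi_L2 hab hC0)..|exact: psi_le|exact: psi_le].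
Qed.

Lemma good_g n : t n <= T -> good n ->
  [/\ inL2 (B (pn n)), l2le (fun l => g n l) (K * (M + err_cst)) &
      l2le (fun l => bc n l - g n l) (K * G n)].
Proof.
move=> nT gn; have [_ _ hc] := good_err nT gn; have [Lc he _] := gn.
have tT := tn_in nT; have Lp := psi_L2 hab hC0 tT.
have sp := psi_le tT; have sn := good_sup nT gn.
have [LB _ h1] := hlip Lc Lp sn sp.
have [_ h2 _] := hlip Lp Lc sp sn.
split=> //; first by apply: h1 => //; rewrite addr_ge0.
by apply: h2 => //; exact: (Gr_ge0 C00 K0 tau0).
Qed.

Lemma good_lip m n A : t m <= T -> t n <= T -> good m -> good n -> 0 <= A ->
  l2le (fun l => c m l - c n l) A -> l2le (fun l => g m l - g n l) (K * A).
Proof.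
move=> mT nT gm gn; have [Lm _ _] := gm; have [Ln _ _] := gn.
by have [_ h _] := hlip Lm Ln (good_sup mT gm) (good_sup nT gn); exact: h.
Qed.

(** Consistency error of the flow plus propagation of the errors in both of its
    arguments. *)
Lemma step_error p q r (z w : int -> R[i]) (A A' : R) :
  0 <= p -> p < q -> q <= T -> p <= r <= q -> 0 <= A -> 0 <= A' ->
  l2le (fun l => fcoef (psi p) l - z l) A -> l2le (fun l => fcoef (B (psi r)) l - w l) A' ->
  l2le (fun l => fcoef (psi q) l - flow a b (q - p) l (z l) (w l))
    (K * lip_cst * (q - p) ^+ 2 + (A + (q - p) * A')).
Proof.
move=> p0 pq qT prq A0 A0' hz hw.
have h0 : 0 <= q - p by rewrite subr_ge0 ltW.
have l1 := local_error hab hC0 hC1 heq M0 K0 hM Bcoef_psi_lip p0 pq qT prq.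
have l2 := l2le_flow hab h0 A0 A0' hz hw.
apply: (l2le_dom hab) (l2leD hab _ _ l1 l2) => [l||].
- by rewrite -flowB addrA subrK.
- by rewrite mulr_ge0 ?sqr_ge0 // mulr_ge0.
- by rewrite addr_ge0 // mulr_ge0.
Qed.

Lemma good0 : good 0.
Proof.
have zT : 0 <= (0 : R) <= T by rewrite lexx ltW.
have ae0 : ae_eqD a b (psi 0) psi0 by exact/ae_inD.
have e0 : fcoef psi0 = fcoef (psi 0).
  apply/funext => l; symmetry; apply: ae_fcoef => //; apply: inL2_meas => //.
  exact: (psi_L2 hab hC0).
have [h1 h2] := hM zT.
split=> //=.
- move=> N; rewrite /err_growth !mul0r expr0n /= e0.
  rewrite (@eq_ssum _ _ _ (fun=> 0 * 0 : R)) => [|l]; last by rewrite subrr sq0 mul0r.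
  by rewrite ssumZ mul0r mulr0.
- rewrite e0; apply: l2le_mono h2 M0' _; rewrite /lap_cst lerDr !addr_ge0 //.
Qed.

Lemma good_start : l2le (fun l => (freq l ^+ 2)%:C%C * c 0 l) M.
Proof.
have zT : 0 <= (0 : R) <= T by rewrite lexx ltW.
have ae0 : ae_eqD a b (psi 0) psi0 by exact/ae_inD.
have [_] := hM zT; apply: (l2le_dom hab) => l.
rewrite (_ : fcoef (psi 0) l = fcoef psi0 l) //; apply: ae_fcoef => //; apply: inL2_meas => //.
exact: (psi_L2 hab hC0).
Qed.

Lemma pn_first : inL2 (pn 1) /\ forall l, c 1 l = flow a b tau l (c 0 l) (g 0 l).
Proof.
have t0T : t 0 <= T by rewrite mul0r ltW.
have [LB _ _] := good_g t0T good0.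
exact: sEWI_first_coef.
Qed.

Lemma pn_step n : t n.+1 <= T -> good n -> good n.+1 ->
  inL2 (pn n.+2) /\ forall l, c n.+2 l = flow a b (2 * tau) l (c n l) (g n.+1 l).
Proof.
move=> nT [Ln _ _] gn1; have [LB _ _] := good_g nT gn1.
exact: sEWI_step_coef.
Qed.

(** The H^2 bound of psi^n is read off chi^{n+1} = mu^2 psi^{n+1} + B(psi^n),
    which grows by O(tau) at each step. *)
Definition chi_le n := l2le (fun l => (freq l ^+ 2)%:C%C * c n.+1 l + g n l) (chi0_cst + n.+1%:R * tau * chi_incr_cst).

Lemma good_of_chi n : t n.+1 <= T -> good n -> inL2 (pn n.+1) ->
  l2le (fun l => u n.+1 l - c n.+1 l) (G n.+1) -> chi_le n -> good n.+1.
Proof.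
move=> nT gn Ln he hchi; split=> //.
have nT' := tn_le (leqnSn n) nT.
have [_ hg _] := good_g nT' gn.
have x0 : 0 <= chi0_cst + n.+1%:R * tau * chi_incr_cst.
  by apply: addr_ge0 => //; apply: mulr_ge0 => //; have /andP[] := tn_in nT.
apply: (@l2le_mono _ a b _ (chi0_cst + n.+1%:R * tau * chi_incr_cst + K * (M + err_cst))).
- by apply: (l2le_dom hab) (l2leB hab x0 KMC0 hchi hg) => l; rewrite addrK.
- exact: addr_ge0.
- rewrite /lap_cst -[leLHS]addr0; apply: lerD => //; rewrite lerD2r lerD2l.
  by rewrite ler_wpM2r.
Qed.

(** The first two values of chi are transported from psi_0: the second one by
    the first use of the two-step recursion. *)
Lemma chi_start n h : good n -> t n <= T -> (forall l, c n.+1 l = flow a b h l (c 0 l) (g n l)) -> chi_le n.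
Proof.
move=> gn nT hc; have [_ hg _] := good_g nT gn.
apply: (@l2le_mono _ a b _ (M + K * (M + err_cst))).
- apply: (l2le_dom hab) (l2leD hab M0' KMC0 good_start hg) => l.
  by rewrite hc (flow_chi a b h l) sqM sq_cis mul1r.
- exact: addr_ge0.
- by rewrite /chi0_cst lerDl; apply: mulr_ge0 => //; apply: mulr_ge0 => //; exact: ltW.
Qed.

(** Transport replaces B(psi^n) by B(psi^{n+2}) in chi; the change is O(tau)
    because psi^n and psi^{n+2} are O(tau)-close to values of psi at times 2 tau apart. *)
Lemma chi_step n : t n.+3 <= T -> good n -> good n.+2 -> chi_le n ->
  (forall l, c n.+3 l = flow a b (2 * tau) l (c n.+1 l) (g n.+2 l)) -> chi_le n.+2.
Proof.
move=> nT gn gn2 hchi hc.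
have n2T : t n.+2 <= T := tn_le (leqnSn _) nT.
have n1T : t n.+1 <= T := tn_le (leqnSn _) n2T.
have n0T : t n <= T := tn_le (leqnSn _) n1T.
have ct0 : 0 <= err_cst * tau by rewrite mulr_ge0 // ltW.
have [e2 _ _] := good_err n2T gn2; have [e0 _ _] := good_err n0T gn.
have /andP[tn0 _] := tn_in n0T.
have dt : t n.+2 - t n = 2 * tau by rewrite -mulrBl -[n.+2]addn2 natrD addrC addKr.
have tle : t n <= t n.+2 by rewrite -subr_ge0 dt mulr_ge0 // ltW.
have hu := coef_lip hab hC0 hC1 heq M0 K0 hM Bcoef_psi_lip tn0 tle n2T.
rewrite dt -/lip_cst in hu.
have u0 : 0 <= 2 * tau * lip_cst by rewrite mulr_ge0 // mulr_ge0 // ltW.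
have hcc : l2le (fun l => c n l - c n.+2 l) (2 * tau * lip_cst + (err_cst * tau + err_cst * tau)).
  apply: (l2le_dom hab) (l2leD hab u0 (addr_ge0 ct0 ct0) hu (l2leB hab ct0 ct0 e0 e2)) => l.
  rewrite -[leLHS]sqN; set lhs := - _; rewrite (_ : lhs = u n.+2 l - u n l + (u n l - c n l - (u n.+2 l - c n.+2 l))) // /lhs.
  by move: (c n l) (c n.+2 l) (u n l) (u n.+2 l) => *; ring.
have A0 : 0 <= 2 * tau * lip_cst + (err_cst * tau + err_cst * tau) by rewrite !addr_ge0.
have hg := good_lip n0T n2T gn gn2 A0 hcc.
have x0 : 0 <= chi0_cst + n.+1%:R * tau * chi_incr_cst.
  by apply: addr_ge0 => //; apply: mulr_ge0 => //; have /andP[] := tn_in n1T.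
have h := l2leB hab x0 (mulr_ge0 K0 A0) hchi hg.
apply: l2le_mono.
- apply: (l2le_dom hab) h => l.
  rewrite hc flow_chi sqM sq_cis mul1r.
  rewrite (_ : _ + g n.+2 l = (freq l ^+ 2)%:C%C * c n.+1 l + g n l - (g n l - g n.+2 l)) //.
  by move: (g n l) (g n.+2 l) => *; ring.
- by apply: addr_ge0 => //; rewrite mulr_ge0.
- have -> : chi0_cst + n.+3%:R * tau * chi_incr_cst = chi0_cst + n.+1%:R * tau * chi_incr_cst + 2 * tau * chi_incr_cst.
    by rewrite -[n.+3]addn2 natrD; ring.
  rewrite lerD2l /chi_incr_cst.
  have -> : K * (2 * tau * lip_cst + (err_cst * tau + err_cst * tau)) = tau * K * (2 * err_cst + 2 * lip_cst) by ring.
  have : 0 <= tau * K * (2 * err_cst + 2 * lip_cst).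
    by apply: mulr_ge0; [exact: mulr_ge0 (ltW tau0) K0|rewrite addr_ge0 // mulr_ge0].
  by move=> hh; rewrite (_ : 2 * tau * _ = 2 * (tau * K * (2 * err_cst + 2 * lip_cst))); [lra|ring].
Qed.

Lemma good_all n : t n <= T -> good n /\ forall j, n = j.+1 -> chi_le j.
Proof.
suff H m : forall k, (k <= m)%N -> t k <= T -> good k /\ forall j, k = j.+1 -> chi_le j.
  exact: (H n n (leqnn n)).
elim: m => [|m IH] k.
  by rewrite leqn0 => /eqP -> _; split; first exact: good0.
rewrite leq_eqVlt => /predU1P[->|]; last by rewrite ltnS; exact: IH.
case: m IH => [|m] IH nT.
  have [L1 c1] := pn_first.
  have t0T : t 0 <= T by rewrite mul0r ltW.
  have hchi : chi_le 0 := chi_start good0 t0T c1.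
  suff g1 : good 1 by split=> // j [<-].
  apply: good_of_chi => //; first exact: good0.
  have [_ he0 _] := good0; have [_ _ hb0] := good_g t0T good0.
  have G0 : G 0 = 0 by rewrite /err_growth !mul0r.
  rewrite mul1r in nT; rewrite mul0r G0 in he0; rewrite mul0r G0 mulr0 in hb0.
  have := step_error (lexx 0) tau0 nT _ (lexx 0) (lexx 0) he0 hb0.
  rewrite lexx (ltW tau0) subr0 mulr0 !addr0 => /(_ isT) h.
  apply: l2le_mono.
  - by apply: (l2le_dom hab) h => l; rewrite mul1r c1.
  - by rewrite mulr_ge0 ?sqr_ge0 // mulr_ge0.
  - apply: le_trans (Gr_step C00 K0 tau0 0); rewrite G0 mulr0 addr0 ler_wpM2r ?sqr_ge0 // /trunc_cst.
    have := mulr_ge0 K0 Kt0; lra.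
have n1T : t m.+1 <= T := tn_le (leqnSn _) nT.
have n0T : t m <= T := tn_le (leqnSn _) n1T.
have [gm chim] := IH m (leqnSn m) n0T; have [gm1 _] := IH m.+1 (leqnn _) n1T.
have [L2 c2] := pn_step n1T gm gm1.
have hchi : chi_le m.+1.
  case: m IH nT n1T n0T gm chim gm1 L2 c2 => [|m] IH nT n1T n0T gm chim gm1 L2 c2.
    exact: chi_start gm1 n1T c2.
  have gm0 : good m by have [] := IH m (leqW (leqnSn m)) (tn_le (leqnSn _) n0T).
  exact: chi_step nT gm0 gm1 (chim m erefl) c2.
suff g2 : good m.+2 by split=> // j [<-].
apply: good_of_chi => //.
have [_ he _] := gm; have [_ _ hb] := good_g n1T gm1.
have /andP[tm0 _] := tn_in n0T.
have dt : t m.+2 - t m = 2 * tau by rewrite -mulrBl -[m.+2]addn2 natrD addrC addKr.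
have lt : t m < t m.+2 by rewrite -subr_gt0 dt mulr_gt0.
have mid : t m <= t m.+1 <= t m.+2 by rewrite !ler_wpM2r ?(ltW tau0) ?ler_nat.
have Gm := Gr_ge0 C00 K0 tau0 m; have Gm1 := Gr_ge0 C00 K0 tau0 m.+1.
have := step_error tm0 lt nT mid Gm (mulr_ge0 K0 Gm1) he hb.
rewrite dt => h; apply: l2le_mono.
- by apply: (l2le_dom hab) h => l; rewrite c2.
- have KG : 0 <= K * G m.+1 by rewrite mulr_ge0.
  have tt : 0 <= 2 * tau by rewrite mulr_ge0 // ltW.
  apply: addr_ge0; first by apply: mulr_ge0; [exact: mulr_ge0|exact: sqr_ge0].
  by apply: addr_ge0 => //; exact: mulr_ge0.
- apply: le_trans (Gr_step C00 K0 tau0 m.+1).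
  have hh := Gr_homo C00 K0 tau0 m.
  rewrite [leLHS](_ : _ = trunc_cst * tau ^+ 2 + (G m + 2 * (K * tau) * G m.+1)); last by rewrite /trunc_cst; ring.
  by rewrite lerD2l [leRHS](_ : _ = G m.+1 + 2 * (K * tau) * G m.+1) ?lerD2r //; ring.
Qed.

Lemma error_bounds n : t n <= T ->
  [/\ (L2norm a b (psi (t n) \- pn n)%R <= (err_cst * tau)%:E)%E,
      (Hnorm a b 1 (psi (t n) \- pn n)%R <= (2 * h1_cst * Num.sqrt tau)%:E)%E &
      (Hnorm a b 2 (pn n) <= (2 * (M + err_cst + lap_cst))%:E)%E].
Proof.
move=> nT; have [gn _] := good_all nT; have [e0 e1 hc] := good_err nT gn.
have [Lc _ hc2] := gn; have tT := tn_in nT; have Lp := psi_L2 hab hC0 tT.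
have Le : inL2 (fun x => psi (t n) x - pn n x) by exact: inL2B.
have ee : fcoef (fun x => psi (t n) x - pn n x) = fun l => u n l - c n l.
  by apply/funext => l; rewrite fcoefB //; exact: inL2_Cint.
have ct0 : 0 <= err_cst * tau by rewrite mulr_ge0 // ltW.
have st0 := sqrtr_ge0 tau.
have MC0 : 0 <= M + err_cst by rewrite addr_ge0.
split.
- by apply/(L2norm_l2le hab Le ct0); rewrite ee.
- rewrite -mulrA; apply: (Hnorm_coef hab) => //; first exact: mulr_ge0.
  rewrite ee; case=> [|[|//]] _.
  + apply: l2le_mono (_ : l2le _ (err_cst * tau)) ct0 _.
      by apply: (l2le_dom hab) e0 => l; rewrite expr0 mul1r.
    rewrite /h1_cst [(_ + Num.sqrt _) * _]mulrDl -[leLHS]addr0; apply: lerD.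
      by apply: ler_wpM2l => //; exact: tau_le_sqrt.
    by rewrite mulr_ge0 ?sqrtr_ge0.
  + apply: l2le_mono (_ : l2le _ (Num.sqrt (err_cst * (M + lap_cst)) * Num.sqrt tau)) _ _.
    * by apply: (l2le_dom hab) e1 => l; rewrite expr1.
    * by rewrite mulr_ge0 ?sqrtr_ge0.
    * by rewrite /h1_cst [(_ + Num.sqrt _) * _]mulrDl lerDr mulr_ge0.
- apply: (Hnorm_coef hab) => //; first by rewrite addr_ge0.
  case=> [|[|[|//]]] _.
  + apply: l2le_mono (_ : l2le _ (M + err_cst)) MC0 _; last by rewrite lerDl.
    by apply: (l2le_dom hab) hc => l; rewrite expr0 mul1r.
  + apply: l2le_mono (_ : l2le _ (Num.sqrt ((M + err_cst) * lap_cst))) _ _.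
    * by apply: (l2le_dom hab) (l2le_interp hab MC0 C20 hc hc2) => l; rewrite expr1.
    * exact: sqrtr_ge0.
    * exact: sqrt_mul_le.
  + apply: l2le_mono hc2 C20 _; by rewrite lerDr.
Qed.

End Convergence.

Theorem theorem3p2 (R : realType) (a b : R) (hab : a < b)
    (V : R -> R) (hV : inLinfty a b V)
    (beta sigma : R) (hsigma : 0 < sigma)
    (psi0 : R -> R[i]) (T : R) (hT : 0 < T)
    (hTmax : (T%:E < nlse_Tmax a b V beta sigma psi0)%E)
    (psi : R -> R -> R[i]) (hpsi : nlse_solution a b V beta sigma psi0 T psi) :
  exists tau0 C : R, [/\ 0 < tau0, 0 < C &
    forall tau : R, 0 < tau < tau0 -> forall n : nat, n%:R <= T / tau ->
      let psi_n := sEWI a b V beta sigma tau psi0 n in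
      [/\ (L2norm a b (psi (n%:R * tau) \- psi_n)%R <= (C * tau)%:E)%E,
          (Hnorm a b 1 (psi (n%:R * tau) \- psi_n)%R <= (C * Num.sqrt tau)%:E)%E
        & (Hnorm a b 2 psi_n <= C%:E)%E]].
Proof.
have [dpsi [hC0 hC1 heq Lpsi0 hpsi0]] := hpsi.
have [M M0 hM] := coef_bounded hab hC0.
have [K K0 hlip] := Bcoef_lip hab hV beta hsigma (sob a b * (M + M) + 1).
pose c1 := err_cst T M K; pose c2 := lap_cst T M K; pose c3 := h1_cst T M K.
pose S := sob a b * c3.
pose tau0 := Num.min 1 ((`|S| + 1)^-1 ^+ 2).
pose C := `|c1| + `|2 * c3| + `|2 * (M + c1 + c2)| + 1.
have S1 : 0 < `|S| + 1 by rewrite ltr_wpDl.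
exists tau0, C; split.
- by rewrite lt_min ltr01 exprn_gt0 // invr_gt0.
- by rewrite ltr_wpDl // !addr_ge0.
move=> tau /andP[t0]; rewrite lt_min => /andP[t1 tS] n nT psi_n.
have nT' : n%:R * tau <= T by rewrite -ler_pdivlMr.
have st : S * Num.sqrt tau <= 1.
  have h1 : Num.sqrt tau <= (`|S| + 1)^-1.
    rewrite -[leRHS]ger0_norm ?invr_ge0 ?(ltW S1) // -sqrtr_sqr ler_wsqrtr //; exact: ltW.
  apply: (@le_trans _ _ ((`|S| + 1) * (`|S| + 1)^-1)); last by rewrite divff // gt_eqF.
  have S0 : S <= `|S| + 1 by rewrite (le_trans (ler_norm S)) // lerDl.
  apply: (@le_trans _ _ ((`|S| + 1) * Num.sqrt tau)).
    by apply: ler_wpM2r => //; exact: sqrtr_ge0.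
  by apply: ler_wpM2l => //; exact: ltW.
have [e1 e2 e3] := error_bounds hab hT hC0 hC1 heq Lpsi0 hpsi0 M0 K0 hM hlip t0 (ltW t1) st nT'.
have n1 : c1 <= C by rewrite (le_trans (ler_norm c1)) // /C -!addrA lerDl !addr_ge0.
have n2 : 2 * c3 <= C.
  by rewrite (le_trans (ler_norm _)) // /C -addrA [`|c1| + _]addrC -!addrA lerDl !addr_ge0.
have n3 : 2 * (M + c1 + c2) <= C.
  rewrite (le_trans (ler_norm _)) // /C -[leLHS]addr0; apply: lerD => //.
  by rewrite lerDr addr_ge0.
split.
- by apply: le_trans e1 _; rewrite lee_fin ler_wpM2r // ltW.
- by apply: le_trans e2 _; rewrite lee_fin ler_wpM2r // sqrtr_ge0.
- by apply: le_trans e3 _; rewrite lee_fin.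
Qed.
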